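(* Let $n\ge1$, $a>0$, $s>0$, $0<\kappa<1$. Let $E\subset\mathbb{R}$ be a bounded Borel set of Hausdorff dimension $\kappa$ with $0<m_\kappa(E)<\infty$ and $0\in E$, and assume that $$\sum_{m=0}^\infty N_E(2^{-m})\,2^{-2ms/a}<\infty.$$ Let $f\in H_s(\mathbb{R}^n)$. Then for almost every $x\in\mathbb{R}^n$ one can modify the function $t\mapsto S_tf(x)$, $t\in E$, on an $m_\kappa$-nullset (depending on $x$) so that, after modification, $$\lim_{\substack{t\to0\\ t\in E}}S_tf(x)=f(x).$$
   Context: $m_\kappa$ denotes $\kappa$-dimensional Hausdorff measure on $\mathbb{R}$ and $m$ denotes Lebesgue measure on $\mathbb{R}^n$. For a bounded set $E\subset\mathbb{R}$ and $r>0$, $N_E(r)$ denotes the minimal number $N$ of intervals $I_1,\dots,I_N$ of length $r$ such that $E\subset\bigcup_{l=1}^N I_l$. The Fourier transform is $\hat f(\xi)=\int_{\mathbb{R}^n}e^{-i\xi\cdot x}f(x)\,dx$, and $H_s=\{f\in\mathscr{S}' : \|f\|_{H_s}<\infty\}$ with $\|f\|_{H_s}=\left(\int_{\mathbb{R}^n}(1+|\xi|^2)^s|\hat f(\xi)|^2\,d\xi\right)^{1/2}$. Precise definition of $S_tf(x)$ for $f\in L^2(\mathbb{R}^n)$ and $(x,t)\in\mathbb{R}^n\times E$: let $Q=[-\frac12,\frac12]^n$ and $$f_N(x,t)=(2\pi)^{-n}\int_{NQ}e^{i\xi\cdot x}e^{it|\xi|^a}\hat f(\xi)\,d\xi,\qquad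 (x,t)\in\mathbb{R}^n\times E,\ N=1,2,3,\dots.$$ By well-known estimates (Carleson-type theorem for cubes) there is a set $F\subset\mathbb{R}^n\times E$ with $(m\times m_\kappa)((\mathbb{R}^n\times E)\setminus F)=0$ such that $\lim_{N\to\infty}f_N(x,t)$ exists for every $(x,t)\in F$. One sets $S_tf(x)$ equal to this limit for $(x,t)\in F$; this is a function defined $m\times m_\kappa$-almost everywhere on $\mathbb{R}^n\times E$ and measurable with respect to $m\times m_\kappa$. *)

(* Defs.v *)
From HB Require Import structures.
From mathcomp Require Import all_boot all_order all_algebra.
From mathcomp Require Import complex.
From mathcomp Require Import all_classical all_reals all_analysis.

Set Implicit Arguments.
Unset Strict Implicit.
Unset Printing Implicit Defensive.

Import Order.TTheory GRing.Theory Num.Theory.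
Import numFieldNormedType.Exports.

Local Open Scope classical_set_scope.
Local Open Scope ring_scope.
Local Open Scope complex_scope.

Local Notation Re := (@complex.Re _).
Local Notation Im := (@complex.Im _).

(* The space R^n is [n.-tuple R]; the sigma-algebra that the library puts on
   it, generated by the coordinates, is the Borel one. *)
Section lebesgue_tuple.
Context {R : realType}.

Definition tuple_cons n (p : n.-tuple R * measurableTypeR R) :
    n.+1.-tuple R :=
  [tuple of (p.2 : R) :: p.1].

Lemma measurable_tuple_cons n : measurable_fun setT (@tuple_cons n).
Proof. exact: measurable_cons. Qed.

Section succ.
Context n (m : {measure set (n.-tuple R) -> \bar R}).

Definition lebesgue_tuple_succ : set (n.+1.-tuple R) -> \bar R :=
  pushforward (m \x (@lebesgue_measure R))%E (@tuple_cons n).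

Let pushforward_measure : {measure set (n.+1.-tuple R) -> \bar R} :=
  measure_function_pushforward__canonical__measure_function_Measure
    (m \x (@lebesgue_measure R))%E (@measurable_tuple_cons n).

HB.instance Definition _ := Measure.copy lebesgue_tuple_succ pushforward_measure.

End succ.

Fixpoint lebesgue_tuple_rec n : {measure set (n.-tuple R) -> \bar R} :=
  if n is n'.+1 then lebesgue_tuple_succ (lebesgue_tuple_rec n')
  else \d_[tuple].

Definition lebesgue_tuple n : set (n.-tuple R) -> \bar R :=
  lebesgue_tuple_rec n.

HB.instance Definition _ n := Measure.on (@lebesgue_tuple n).

End lebesgue_tuple.
Arguments lebesgue_tuple {R} n.

Section complex_valued.
Context {R : realType}.

Definition tuple_dot n (x y : n.-tuple R) : R :=
  \sum_(i < n) tnth x i * tnth y i.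

Definition enorm n (x : n.-tuple R) : R :=
  Num.sqrt (\sum_(i < n) tnth x i ^+ 2).

Definition expi (theta : R) : R[i] := cos theta +i* sin theta.

Definition measurable_cfun n (f : n.-tuple R -> R[i]) :=
  measurable_fun setT (Re \o f) /\ measurable_fun setT (Im \o f).

Definition cintegrable n (f : n.-tuple R -> R[i]) :=
  (lebesgue_tuple n).-integrable setT (EFin \o (Re \o f)) /\
  (lebesgue_tuple n).-integrable setT (EFin \o (Im \o f)).

Definition cintegral n (D : set (n.-tuple R)) (f : n.-tuple R -> R[i]) : R[i] :=
  (\int[lebesgue_tuple n]_(x in D) Re (f x)) +i*
  (\int[lebesgue_tuple n]_(x in D) Im (f x)).

End complex_valued.

Section schwartz.
Context {R : realType} {n : nat}.
Implicit Types (f phi psi : n.-tuple R -> R[i]) (x xi : n.-tuple R).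
Implicit Types (i : 'I_n) (u : (n.-tuple R -> R[i]) -> R[i]) (w : seq 'I_n).

Definition replace_coord x i (y : R) : n.-tuple R :=
  [tuple if j == i then y else tnth x j | j < n].

Definition coord_slice phi x i (y : R) : R[i] := phi (replace_coord x i y).

Definition partial i phi x : R[i] :=
  derive1 (Re \o coord_slice phi x i) (tnth x i) +i*
  derive1 (Im \o coord_slice phi x i) (tnth x i).

Definition iter_partial w phi : n.-tuple R -> R[i] := foldr partial phi w.

(* All iterated partial derivatives exist and decay rapidly; being bounded,
   they are Lipschitz, so that [phi] is indeed C^oo. *)
Definition schwartz phi :=
  (forall w i x,
    derivable (Re \o coord_slice (iter_partial w phi) x i)
      (tnth x i) 1 /\
    derivable (Im \o coord_slice (iter_partial w phi) x i)
      (tnth x i) 1) /\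
  (forall k w, exists M : R, forall x,
    (1 + enorm x) ^+ k * Normc.normc (iter_partial w phi x) <= M).

(* Continuity: |u(phi)| is bounded by a constant times one of the Schwartz
   norms sup_x (1 + |x|)^k |d^w phi(x)|, w of length at most k. *)
Definition tempered_distribution u :=
  (forall (c : R[i]) phi psi, schwartz phi -> schwartz psi ->
    u (fun x => c * phi x + psi x) = c * u phi + u psi) /\
  (exists (C : R) (k : nat), forall phi (M : R), schwartz phi ->
    (forall w x, (size w <= k)%N ->
      (1 + enorm x) ^+ k * Normc.normc (iter_partial w phi x) <= M) ->
    Normc.normc (u phi) <= C * M).

Definition distribution_of f phi : R[i] :=
  cintegral setT (fun x => f x * phi x).

(* The functions f such that phi |-> int f phi is an element of S'. *)
Definition tempered_function f :=
  [/\ measurable_cfun f,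
      forall phi, schwartz phi -> cintegrable (fun x => f x * phi x) &
      tempered_distribution (distribution_of f)].

Definition fourier_schwartz phi xi : R[i] :=
  cintegral setT (fun x => expi (- tuple_dot xi x) * phi x).

(* The function [F] is the Fourier transform of the tempered distribution
   [f]: <F, phi> = <f, phi^> for all Schwartz functions phi. *)
Definition is_fourier f F :=
  tempered_function F /\
  forall phi, schwartz phi ->
    distribution_of F phi = distribution_of f (fourier_schwartz phi).

(* A representative of the Fourier transform; two of them are equal almost
   everywhere. *)
Definition fourier f : n.-tuple R -> R[i] :=
  xget (fun=> 0) [set F | is_fourier f F].

Definition sobolev_norm (s : R) f : \bar R :=
  ((\int[lebesgue_tuple n]_xi
     ((1 + enorm xi ^+ 2) `^ s * Normc.normc (fourier f xi) ^+ 2)%:E) `^ 2^-1)%E.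

(* The elements of H_s that are functions; for s >= 0, that is all of them,
   since then H_s is included in L^2. *)
Definition sobolev (s : R) : set (n.-tuple R -> R[i]) :=
  [set f | [/\ tempered_function f, exists F, is_fourier f F &
               (sobolev_norm s f < +oo)%E]].

Definition cube (N : nat) : set (n.-tuple R) :=
  [set xi | forall i, `|tnth xi i| <= N%:R / 2].

Definition schrodinger_partial (a : R) f (N : nat) x (t : R) : R[i]^o :=
  ((2 * pi) ^- n)%:C *
  cintegral (cube N) (fun xi =>
    expi (tuple_dot xi x) * expi (t * enorm xi `^ a) * fourier f xi).

(* S_t f(x) is defined on the full set of convergence of the cubic partial
   integrals; outside of it the value of [schrodinger] is meaningless. *)
Definition schrodinger_dom (a : R) f : set (n.-tuple R * R) :=
  [set p | cvgn (fun N => schrodinger_partial a f N p.1 p.2)].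

Definition schrodinger (a : R) f x (t : R) : R[i]^o :=
  limn (fun N => schrodinger_partial a f N x t).

End schwartz.

Section hausdorff.
Context {R : realType}.
Implicit Types (A U : set R) (d r : R).

Definition diameter U : \bar R :=
  ereal_sup [set `|x - y|%:E | x in U & y in U].

(* The diameter of the empty set is -oo here, and its contribution is 0, also
   for [d = 0]. *)
Definition diameter_power d U : \bar R :=
  if U == set0 then 0%E else (diameter U `^ d)%E.

Definition hausdorff_content d delta A : \bar R :=
  ereal_inf [set (\sum_(0 <= k <oo) diameter_power d (U k))%E | U in
    [set U : (set R)^nat | A `<=` \bigcup_k U k /\
                           forall k, (diameter (U k) <= delta%:E)%E]].

(* The outer measure, with no normalising constant; its null sets are the
   subsets of the Borel null sets. *)
Definition hausdorff_measure d A : \bar R :=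
  ereal_sup [set hausdorff_content d delta A | delta in
    [set delta : R | 0 < delta]].

Definition hausdorff_dim A : \bar R :=
  ereal_inf [set d%:E | d in
    [set d : R | 0 <= d /\ hausdorff_measure d A = 0%E]].

(* Each interval of length r may contain or omit its endpoints. The infimum
   over an empty set of natural numbers is +oo, otherwise it is a minimum. *)
Definition covering_number A r : \bar R :=
  ereal_inf [set N%:R%:E | N in
    [set N : nat | exists (b b' : 'I_N -> bool) (c : 'I_N -> R),
      A `<=` \bigcup_l
        [set` Interval (BSide (b l) (c l)) (BSide (b' l) (c l + r))]]].

End hausdorff.

(* Main.v *)
(* As s > 0, dyadic maximal estimates replace Carleson's theorem. Cut the
   frequencies along the cubes of side N_m = floor (2 ^ (m / a)): on the block
   between N_m and N_(m+1) the phase |xi|^a is O(2 ^ m). For |t - c| <= 2 ^ -m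
   the block of the evolution is a power series in t - c whose terms obey
   Bessel's inequality, so that the supremum over t of its square has an integral
   bounded by the L^2 mass of the block, that is by 2 ^ (- 2 m s / a) v_m with
   sum_m v_m < oo. Covering E by N_E (2 ^ -m) intervals, the hypothesis yields
   sum_m sup_(t in E) |block_m (x, t)| < oo for almost every x: the partial
   integrals over the cubes of side N_m converge uniformly on E, to a function
   of t that is continuous along E at 0. At t = 0 the limit is f, as testing
   against Gaussians shows.

   Between N_m and N_(m+1), dyadic chaining costs a factor O(m ^ 2), absorbed by
   2 ^ (- m kappa / 2). For almost every x the intervals on which the chaining
   bound exceeds 2 ^ (- m kappa / 2) have summable kappa-contents, and the times
   lying in infinitely many of them form an m_kappa-null set, off which the full
   sequence of partial integrals converges. This Borel-Cantelli argument works
   for each x separately and avoids Fubini's theorem for m x m_kappa. *)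

Require Import Defs.
From HB Require Import structures.
From mathcomp Require Import all_boot all_order all_algebra.
From mathcomp Require Import complex.
From mathcomp Require Import all_classical all_reals all_analysis.
From mathcomp Require Import measurable_realfun ring lra zify.

Set Implicit Arguments.
Unset Strict Implicit.
Unset Printing Implicit Defensive.

Import Order.TTheory GRing.Theory Num.Theory.
Import numFieldNormedType.Exports.

Local Open Scope classical_set_scope.
Local Open Scope ring_scope.
Local Open Scope complex_scope.

Local Notation Re := (@complex.Re _).
Local Notation Im := (@complex.Im _).

(** * Lebesgue integration on tuples *)

(** The supremum over t is never formed: each block has a majorant independent of t on the time
    interval, a measurable series in moments of the normalised frequency with weights C ^ p / p!, to
    which Cauchy-Schwarz and Bessel's inequality apply. To sum square roots of these majorants over
    k, the total over the covering intervals is written as level * p, where level = N_E (2 ^ - k) *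
    2 ^ (- 2 k s / a) is summable by hypothesis and p is summable for almost every x by the Sobolev
    weight; the square root is at most the mean of the two. The Fourier transform of f is given only
    by duality with Schwartz functions. The product of f with a fixed Gaussian is integrable, and
    duality with the translated Gaussians expresses every Fourier integral of this product through
    the transform of f. The limit of the partial integrals yields the same values, by domination
    with the bound summed over the blocks, and the Fourier transform is injective on L^1. Complex
    integrals are handled as pairs of real ones; trigonometric phases replace complex
    exponentials. *)

Lemma normr_cos_le1 (R : realType) (y : R) : `|cos y| <= 1.
Proof. by rewrite ler_norml cos_geN1 cos_le1. Qed.

Lemma normr_sin_le1 (R : realType) (y : R) : `|sin y| <= 1.
Proof. by rewrite ler_norml sin_geN1 sin_le1. Qed.

Section integrable_real.
Context d (T : measurableType d) (R : realType) (mu : {measure set T -> \bar R}).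
Implicit Types (f g h : T -> R) (D : set T).

Lemma le_integrableR D f g : measurable D -> measurable_fun D f ->
  mu.-integrable D (EFin \o g) -> (forall x, D x -> `|f x| <= g x) ->
  mu.-integrable D (EFin \o f).
Proof.
move=> mD mf ig fg; apply: le_integrable ig => //; first exact/measurable_EFinP.
by move=> x Dx; rewrite lee_fin (le_trans (fg _ Dx))// ler_norm.
Qed.

Lemma integrableMr_bounded D f h (M : R) : measurable D ->
  mu.-integrable D (EFin \o f) -> measurable_fun D h ->
  (forall x, D x -> `|h x| <= M) ->
  mu.-integrable D (EFin \o (fun x => f x * h x)).
Proof.
move=> mD intf mh hM.
have /measurable_EFinP mf := measurable_int _ intf.
apply: (@le_integrableR _ _ (fun x => `|f x| * M)) => //.
- exact: measurable_funM.
- rewrite [X in _.-integrable _ X](_ : _ =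
    (fun x => M%:E * (`|f x|%:E))%E); last by apply/funext => x; rewrite -EFinM mulrC.
  exact/integrableZl/integrable_norm.
- by move=> x Dx; rewrite normrM ler_wpM2l// hM.
Qed.

Lemma dominated_cvg_Rintegral D (f_ : nat -> T -> R) f g : measurable D ->
  (forall n, measurable_fun D (f_ n)) ->
  (forall x, D x -> f_ n x @[n --> \oo] --> f x) ->
  mu.-integrable D (EFin \o g) ->
  (forall n x, D x -> `|f_ n x| <= g x) ->
  mu.-integrable D (EFin \o f) /\
  \int[mu]_(x in D) f_ n x @[n --> \oo] --> \int[mu]_(x in D) f x.
Proof.
move=> mD mf_ f_f intg f_g.
have f_fE : {ae mu, forall x, D x -> (f_ n x)%:E @[n --> \oo] --> (f x)%:E}.
  by apply: aeW => x Dx; apply: cvg_EFin; [exact: nearW|exact: f_f].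
have mf : measurable_fun D (EFin \o f).
  apply/measurable_EFinP; apply: (measurable_fun_cvg mf_) => x Dx; exact: f_f.
have [intf _ cvgf] := @dominated_convergence _ _ _ mu D mD
  (fun n x => (f_ n x)%:E) (EFin \o f) (EFin \o g)
  (fun n => proj2 (measurable_EFinP _ _) (mf_ n)) mf f_fE intg
  (aeW _ (fun x n Dx => f_g n x Dx)).
split=> //; apply: fine_cvg; rewrite fineK//.
exact: integrable_fin_num.
Qed.

Lemma integrable_mull D f (c : R) : measurable D ->
  mu.-integrable D (EFin \o f) -> mu.-integrable D (EFin \o (fun x => c * f x)).
Proof.
move=> mD intf; rewrite [X in _.-integrable _ X](_ : _ = (fun x => c%:E * (f x)%:E)%E)//.
exact: integrableZl.
Qed.

Lemma integrable_addR D f g : measurable D ->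
  mu.-integrable D (EFin \o f) -> mu.-integrable D (EFin \o g) ->
  mu.-integrable D (EFin \o (fun x => f x + g x)).
Proof.
move=> mD intf intg.
rewrite [X in _.-integrable _ X](_ : _ = (fun x => (f x)%:E + (g x)%:E)%E)//.
exact: integrableD.
Qed.

Lemma integrable_subR D f g : measurable D ->
  mu.-integrable D (EFin \o f) -> mu.-integrable D (EFin \o g) ->
  mu.-integrable D (EFin \o (fun x => f x - g x)).
Proof.
move=> mD intf intg.
rewrite [X in _.-integrable _ X](_ : _ = (fun x => (f x)%:E - (g x)%:E)%E)//.
exact: integrableB.
Qed.

Lemma integrable_sum_nat D (f : nat -> T -> R) N : measurable D ->
  (forall p, mu.-integrable D (EFin \o f p)) ->
  mu.-integrable D (EFin \o (fun x => \sum_(0 <= p < N) f p x)).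
Proof.
move=> mD intf; elim: N => [|N ih].
  rewrite [X in _.-integrable _ X](_ : _ = cst 0%E); first exact: integrable0.
  by apply/funext => x /=; rewrite big_geq.
rewrite [X in _.-integrable _ X](_ : _ = EFin \o (fun x => \sum_(0 <= p < N) f p x + f N x)).
  exact: integrable_addR.
by apply/funext => x /=; rewrite big_nat_recr.
Qed.

Lemma Rintegral_sum_nat D (f : nat -> T -> R) N : measurable D ->
  (forall p, mu.-integrable D (EFin \o f p)) ->
  \int[mu]_(x in D) (\sum_(0 <= p < N) f p x) =
  \sum_(0 <= p < N) \int[mu]_(x in D) f p x.
Proof.
move=> mD intf; elim: N => [|N ih].
  rewrite big_geq// (_ : Rintegral _ _ _ = \int[mu]_(x in D) 0).
    by rewrite /Rintegral integral0.
  by congr Rintegral; apply/funext => x; rewrite big_geq.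
rewrite big_nat_recr//= -ih -RintegralD//; last exact: integrable_sum_nat.
by congr Rintegral; apply/funext => x; rewrite big_nat_recr.
Qed.

End integrable_real.

Lemma measurable_nneseries d (T : measurableType d) (R : realType) (h : nat -> T -> \bar R) :
  (forall k x, (0 <= h k x)%E) -> (forall k, measurable_fun setT (h k)) ->
  measurable_fun setT (fun x => \sum_(0 <= k <oo) h k x)%E.
Proof.
move=> h0 mh.
rewrite (_ : (fun x => _) = (fun x => \sum_(0 <= k <oo | k \in xpredT) h k x)%E)//.
exact: ge0_emeasurable_sum.
Qed.

Section product_real.
Context d1 d2 (T1 : measurableType d1) (T2 : measurableType d2) (R : realType).
Variables (m1 : {sigma_finite_measure set T1 -> \bar R})
          (m2 : {sigma_finite_measure set T2 -> \bar R}).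

Lemma integrable_prodM (f : T1 -> R) (g : T2 -> R) :
  m1.-integrable setT (EFin \o f) -> m2.-integrable setT (EFin \o g) ->
  (m1 \x m2)%E.-integrable setT (EFin \o (fun z => f z.1 * g z.2)).
Proof.
move=> intf intg.
have /measurable_EFinP mf := measurable_int _ intf.
have /measurable_EFinP mg := measurable_int _ intg.
apply/integrable12ltyP.
  by apply/measurable_EFinP/measurable_funM; exact: measurableT_comp.
under eq_integral => x _.
  under eq_integral => y _ do rewrite /= normrM EFinM.
  rewrite ge0_integralZl//; last exact/measurable_EFinP/measurableT_comp.
  over.
rewrite ge0_integralZr//; last 2 first.
- exact/measurable_EFinP/measurableT_comp.
- exact: integral_ge0.
move/integrableP : intf => [_ intf]; move/integrableP : intg => [_ intg].
by rewrite lte_mul_pinfty// ?integral_ge0// ge0_fin_numE ?integral_ge0.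
Qed.

(** Integrability of every section, rather than of almost every one, makes the inner real-valued
    integral agree everywhere with the extended one, so that Fubini's theorem passes through
    [fine]. *)
Lemma Rintegral_fubini (f : T1 * T2 -> R) :
  (m1 \x m2)%E.-integrable setT (EFin \o f) ->
  (forall x, m2.-integrable setT (EFin \o (fun y => f (x, y)))) ->
  (forall y, m1.-integrable setT (EFin \o (fun x => f (x, y)))) ->
  \int[m1]_x \int[m2]_y f (x, y) = \int[m2]_y \int[m1]_x f (x, y).
Proof.
move=> intf int2 int1; have := Fubini intf; rewrite /Rintegral => H.
transitivity (fine (\int[m1]_x \int[m2]_y (f (x, y))%:E)%E); last rewrite H.
  by congr fine; apply: eq_integral => x _; rewrite fineK//; exact: (integrable_fin_num _ (int2 x)).
by congr fine; apply: eq_integral => x _; rewrite fineK//; exact: (integrable_fin_num _ (int1 x)).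
Qed.

Lemma Rintegral_prodE (f : T1 * T2 -> R) :
  (m1 \x m2)%E.-integrable setT (EFin \o f) ->
  (forall x, m2.-integrable setT (EFin \o (fun y => f (x, y)))) ->
  \int[(m1 \x m2)%E]_z f z = \int[m1]_x \int[m2]_y f (x, y).
Proof.
move=> intf int2; rewrite /Rintegral -integral12_prod_meas1//.
by congr fine; apply: eq_integral => x _; rewrite fineK//; exact: (integrable_fin_num _ (int2 x)).
Qed.

(** The inner integral is the difference of the integrals of the positive and negative parts, each
    measurable in [x] by Tonelli's theorem, and [fine] is measurable; infinite values are
    harmless. *)
Lemma measurable_Rintegral (f : T1 * T2 -> R) :
  measurable_fun setT f -> measurable_fun setT (fun x => \int[m2]_y f (x, y)).
Proof.
move=> mf; apply: (measurableT_comp (fine_measurable measurableT)).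
have mp : measurable_fun setT ((EFin \o f)^\+)%E.
  by apply: measurable_funepos; exact/measurable_EFinP.
have mn : measurable_fun setT ((EFin \o f)^\-)%E.
  by apply: measurable_funeneg; exact/measurable_EFinP.
have -> : (fun x => \int[m2]_y (f (x, y))%:E)%E =
    ((fun x => \int[m2]_y ((EFin \o f)^\+ (x, y))) \-
     (fun x => \int[m2]_y ((EFin \o f)^\- (x, y))))%E.
  apply/funext => x; rewrite [LHS]integralE /=.
  congr (_ - _)%E; by apply: eq_integral => y _; rewrite ?funeposE ?funenegE.
by apply: (@emeasurable_funB _ _ _ _ (fun x => \int[m2]_y ((EFin \o f)^\+ (x, y)))%E (fun x => \int[m2]_y ((EFin \o f)^\- (x, y)))%E);
  exact: measurable_fun_fubini_tonelli_F.
Qed.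

End product_real.

Section tuple_measure.
Context {R : realType}.
Notation mu := (@lebesgue_measure R).

Lemma measurable_cube n N : measurable (@cube R n N).
Proof.
have -> : @cube R n N = \bigcap_(i in [set: 'I_n])
    ((fun x : n.-tuple R => tnth x i) @^-1` `[- (N%:R / 2), N%:R / 2]).
  apply/seteqP; split=> x /= xN i; first by move=> _; rewrite /= in_itv/= -ler_norml; exact: xN.
  by have := xN i I; rewrite /= in_itv/= -ler_norml.
apply: fin_bigcap_measurable => //= i _.
rewrite -[X in measurable X]setTI; exact: measurable_tnth.
Qed.

Lemma lebesgue_tuple_cube n N : lebesgue_tuple n (@cube R n N) = (N%:R ^+ n)%:E.
Proof.
elim: n => [|n ih].
  rewrite /lebesgue_tuple /= diracE expr0 mem_set//.
  by move=> [].
rewrite /lebesgue_tuple/= /lebesgue_tuple_succ/pushforward.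
rewrite [X in product_measure1 _ _ X = _](_ : _ =
    (@cube R n N) `*` `[- (N%:R / 2), N%:R / 2]); last first.
  apply/seteqP; split=> -[x y]/=.
    move=> xN; split=> [i|]; last by rewrite /= in_itv/= -ler_norml; exact: (xN ord0).
    by have := xN (lift ord0 i); rewrite tnthS.
  rewrite in_itv/= -ler_norml => -[xN yN] i.
  by case: (unliftP ord0 i) => [j|] -> //; rewrite tnthS; exact: xN.
rewrite product_measure1E//; last exact: measurable_cube.
rewrite exprSr EFinM -ih; congr (_ * _)%E.
transitivity (lebesgue_measure (`[- (N%:R / 2), N%:R / 2]%classic : set R)); first by [].
rewrite lebesgue_measure_itv/= lte_fin.
case: ifPn => [_|]; first by rewrite -EFinB opprK -splitr.
by rewrite -leNgt => N0; congr EFin; have := ler0n R N; lra.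
Qed.

Lemma bigcup_cube n : \bigcup_N @cube R n N = setT.
Proof.
rewrite -subTset => x _.
have [M xM] : exists M : R, forall i, `|tnth x i| <= M.
  exists (\sum_i `|tnth x i|) => i.
  by rewrite (bigD1 i)//= lerDl sumr_ge0.
exists (Num.truncn (2 * M)).+1 => // i.
rewrite (le_trans (xM i))// ler_pdivlMr// mulrC.
exact/ltW/truncnS_gt.
Qed.

Lemma subset_cube n N M : (N <= M)%N -> @cube R n N `<=` @cube R n M.
Proof.
move=> NM x xN i; apply: (le_trans (xN i)).
by rewrite ler_pM2r ?invr_gt0// ler_nat.
Qed.

Lemma sigma_finite_lebesgue_tuple n :
  sigma_finite [set: n.-tuple R] (lebesgue_tuple n).
Proof.
exists (@cube R n) => [|N]; first by rewrite bigcup_cube.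
by split; [exact: measurable_cube|rewrite lebesgue_tuple_cube ltry].
Qed.

HB.instance Definition _ n :=
  Measure_isSigmaFinite.Build _ _ _ (@lebesgue_tuple R n)
    (@sigma_finite_lebesgue_tuple n).

Lemma ge0_integral_lebesgue_tupleS n (f : n.+1.-tuple R -> \bar R) :
  measurable_fun [set: n.+1.-tuple R] f -> (forall x, (0 <= f x)%E) ->
  (\int[lebesgue_tuple n.+1]_x f x =
   \int[lebesgue_tuple n]_x \int[mu]_y f (tuple_cons (x, y)))%E.
Proof.
move=> mf f0.
rewrite [LHS](@ge0_integral_pushforward _ _ _ _ _ _ (@measurable_tuple_cons R n))//.
rewrite preimage_setT.
rewrite [LHS](@fubini_tonelli1 _ _ _ _ _ (lebesgue_tuple n) mu)//.
  exact: measurableT_comp (@measurable_tuple_cons R n).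
by move=> x; exact: f0.
Qed.

Lemma integrable_lebesgue_tupleS n (f : n.+1.-tuple R -> \bar R) :
  (lebesgue_tuple n.+1).-integrable setT f ->
  (lebesgue_tuple n \x mu)%E.-integrable setT (f \o (@tuple_cons R n)).
Proof.
move=> /integrableP[mf intf]; apply/integrableP; split.
  exact: measurableT_comp (@measurable_tuple_cons R n).
move: intf; rewrite (@ge0_integral_pushforward _ _ _ _ _ _ (@measurable_tuple_cons R n))//.
exact: measurableT_comp.
Qed.

Lemma integral_lebesgue_tupleS n (f : n.+1.-tuple R -> \bar R) :
  (lebesgue_tuple n.+1).-integrable setT f ->
  (\int[lebesgue_tuple n.+1]_x f x =
   \int[lebesgue_tuple n]_x \int[mu]_y f (tuple_cons (x, y)))%E.
Proof.
move=> intf; have mf := measurable_int _ intf.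
have intf' := integrable_lebesgue_tupleS intf.
rewrite [LHS](@integral_pushforward _ _ _ _ _ _ (@measurable_tuple_cons R n))//.
rewrite preimage_setT.
by rewrite -(@integral12_prod_meas1 _ _ _ _ _ (lebesgue_tuple n) mu)//.
Qed.

Lemma ge0_integral_prod n (k : 'I_n -> R -> R) :
  (forall i, measurable_fun setT (k i)) -> (forall i y, 0 <= k i y) ->
  (\int[lebesgue_tuple n]_x (\prod_i k i (tnth x i))%:E =
   \prod_i \int[mu]_y (k i y)%:E)%E.
Proof.
have mprod m (k' : 'I_m -> R -> R) : (forall i, measurable_fun setT (k' i)) ->
    measurable_fun [set: m.-tuple R] (fun x => \prod_i k' i (tnth x i)).
  move=> mk; apply: measurable_prod => i _.
  by apply: measurableT_comp => //; exact: measurable_tnth.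
elim: n k => [|n ih] k mk k0.
  by rewrite big_ord0; under eq_integral do rewrite big_ord0; 
    rewrite integral_dirac// diracT mul1e.
rewrite ge0_integral_lebesgue_tupleS; last 2 first.
- by apply/measurable_EFinP; exact: mprod.
- by move=> x; rewrite lee_fin prodr_ge0.
transitivity (\int[lebesgue_tuple n]_x ((\int[mu]_y (k ord0 y)%:E) *
    (\prod_(i < n) k (lift ord0 i) (tnth x i))%:E))%E.
  apply: eq_integral => x _; rewrite -ge0_integralZr//=.
  - apply: eq_integral => y _; rewrite big_ord_recl /= -EFinM; congr (_ * _)%:E.
    by apply: eq_bigr => i _; rewrite tnthS.
  - by apply: measurableT_comp => //; exact: mk.
  - by move=> y _; rewrite lee_fin.
  - by rewrite lee_fin prodr_ge0.
rewrite ge0_integralZl//.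
- by rewrite (ih (fun i => k (lift ord0 i)))// big_ord_recl.
- by apply/measurable_EFinP; apply: (mprod _ (fun i => k (lift ord0 i))).
- by move=> x _; rewrite lee_fin prodr_ge0.
- by apply: integral_ge0 => y _; rewrite lee_fin.
Qed.

Lemma Rintegral_lebesgue_tupleS n (f : n.+1.-tuple R -> R) :
  (lebesgue_tuple n.+1).-integrable setT (EFin \o f) ->
  (forall x, mu.-integrable setT (EFin \o (fun y => f (tuple_cons (x, y))))) ->
  \int[lebesgue_tuple n.+1]_x f x =
  \int[lebesgue_tuple n]_x \int[mu]_y f (tuple_cons (x, y)).
Proof.
move=> intf int2; rewrite /Rintegral integral_lebesgue_tupleS//.
by congr fine; apply: eq_integral => x _; rewrite fineK//; exact: (integrable_fin_num _ (int2 x)).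
Qed.

Lemma measurable_tuple_dot n :
  measurable_fun [set: n.-tuple R * n.-tuple R] (fun z => tuple_dot z.1 z.2).
Proof.
apply: measurable_sum => i; apply: measurable_funM.
  exact: (measurableT_comp (@measurable_tnth _ R n i)).
exact: (measurableT_comp (@measurable_tnth _ R n i)).
Qed.

Lemma measurable_enorm n : measurable_fun [set: n.-tuple R] (@enorm R n).
Proof.
apply: (measurableT_comp (continuous_measurable_fun (@sqrt_continuous R))).
apply: measurable_sum => i; apply: measurable_funX; exact: measurable_tnth.
Qed.

Lemma enorm_ge0 n (xi : n.-tuple R) : 0 <= enorm xi. Proof. exact: sqrtr_ge0. Qed.

Lemma enorm_le_sum n (xi : n.-tuple R) : enorm xi <= \sum_i `|tnth xi i|.
Proof.
rewrite /enorm -[leRHS]ger0_norm ?sumr_ge0// -sqrtr_sqr ler_wsqrtr//.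
elim: (index_enum _) => [|i s ih]; first by rewrite !big_nil expr0n.
rewrite !big_cons; have : 0 <= \sum_(i <- s) `|tnth xi i| by exact: sumr_ge0.
have := normr_ge0 (tnth xi i); rewrite -(real_normK (num_real (tnth xi i))).
by nra.
Qed.

End tuple_measure.

(** * Gaussians and their Fourier transforms *)

Section gaussian.
Context {R : realType}.
Notation mu := (@lebesgue_measure R).
Implicit Types (e b z y : R).

(** The parameter [e] is the inverse of the standard deviation: the Gaussian flattens to 1 as [e]
    tends to 0, while its Fourier transform concentrates, being a normal density of standard
    deviation [e] up to a factor. *)
Definition gauss e y : R := expR (- ((e * y) ^+ 2 / 2)).

Lemma gauss_ge0 e y : 0 <= gauss e y. Proof. exact: expR_ge0. Qed.

Lemma gauss_le1 e y : gauss e y <= 1.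
Proof. by rewrite /gauss expR_le1 oppr_le0 divr_ge0// sqr_ge0. Qed.

Lemma is_derive_gauss e y :
  is_derive y 1 (gauss e) (- (e ^+ 2 * y * gauss e y)).
Proof.
rewrite /gauss.
apply: is_derive_eq; rewrite /GRing.scale/=; by field.
Qed.

Lemma continuous_gauss e : continuous (gauss e).
Proof.
move=> y.
have : derivable (gauss e) y 1 by exact: ex_derive.
by move/derivable1_diffP/differentiable_continuous.
Qed.

Lemma measurable_gauss e : measurable_fun setT (gauss e).
Proof. by apply: continuous_measurable_fun; exact: continuous_gauss. Qed.

Lemma gauss_normal e y : e != 0 ->
  gauss e y = (Num.sqrt (2 * pi) / `|e|) * normal_pdf 0 e^-1 y.
Proof.
move=> e0; rewrite normal_pdfE ?invr_neq0// /gauss /normal_fun/normal_peak.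
have pi2 : 0 < 2 * pi :> R by rewrite mulr_gt0 ?pi_gt0.
have -> : e^-1 ^+ 2 * pi *+ 2 = e^-1 ^+ 2 * (2 * pi) by ring.
rewrite (@sqrtrM _ (e^-1 ^+ 2)) ?sqr_ge0// sqrtr_sqr normfV.
set p := Num.sqrt (2 * pi).
have p0 : p != 0 by rewrite gt_eqF// sqrtr_gt0.
have en0 : `|e| != 0 by rewrite normr_eq0.
rewrite (_ : p / `|e| * _ = expR (- (y - 0) ^+ 2 / (e^-1 ^+ 2 *+ 2))); last by field; rewrite p0 en0.
by congr expR; field; rewrite e0.
Qed.

Lemma integral_gauss e : e != 0 ->
  (\int[mu]_y (gauss e y)%:E)%E = (Num.sqrt (2 * pi) / `|e|)%:E.
Proof.
move=> e0; under eq_integral do rewrite gauss_normal// EFinM.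
rewrite integralZl//; last exact: integrable_normal_pdf.
by rewrite integral_normal_pdf mule1.
Qed.

Lemma integrable_gauss e : e != 0 -> mu.-integrable setT (EFin \o gauss e).
Proof.
move=> e0.
rewrite [X in _.-integrable _ X](_ : _ = (fun y =>
  (Num.sqrt (2 * pi) / `|e|)%:E * (normal_pdf 0 e^-1 y)%:E)%E).
  by apply: integrableZl => //; exact: integrable_normal_pdf.
by apply/funext => y /=; rewrite gauss_normal// EFinM.
Qed.


(** Half of the exponent absorbs the linear factor: with [z = e * y], [|z| <= 1 + z ^+ 2 / 4 <= expR
    (z ^+ 2 / 4)]. The other half is the Gaussian of parameter [e / Num.sqrt 2]. *)
Lemma gauss_mul_le e y : 0 < e ->
  `|y * gauss e y| <= e^-1 * gauss (e / Num.sqrt 2) y.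
Proof.
move=> e0; rewrite normrM (ger0_norm (gauss_ge0 _ _)) ler_pdivlMl//.
rewrite mulrA -{1}(gtr0_norm e0) -normrM /gauss.
have -> : (e / Num.sqrt 2 * y) ^+ 2 / 2 = (e * y) ^+ 2 / 4.
  rewrite !exprMn exprVn sqr_sqrtr//; by field.
have -> : - ((e * y) ^+ 2 / 4) = (e * y) ^+ 2 / 4 - (e * y) ^+ 2 / 2 by field.
rewrite expRD ler_wpM2r ?expR_ge0//.
apply: le_trans (expR_ge1Dx _).
by have := sqr_ge0 (`|e * y| - 2); have := real_normK (num_real (e * y)); nra.
Qed.

Lemma integrable_gauss_mul e : 0 < e ->
  mu.-integrable setT (EFin \o (fun y => y * gauss e y)).
Proof.
move=> e0; refine (@le_integrableR _ _ R mu setT (fun y : R => y * gauss e y) (fun y => e^-1 * gauss (e / Num.sqrt 2) y) measurableT _ _ _) => //.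
- by apply: measurable_funM => //; exact: measurable_gauss.
- rewrite [X in _.-integrable _ X](_ : _ = (fun y =>
    (e^-1)%:E * (gauss (e / Num.sqrt 2) y)%:E)%E)//.
  apply: integrableZl => //; apply: integrable_gauss.
  by rewrite gt_eqF// divr_gt0// sqrtr_gt0.
- by move=> y _; exact: gauss_mul_le.
Qed.

(** A function vanishing at infinity, with derivative [W']: integrating [W'] over the line is the
    integration by parts behind the differential equation satisfied by the Fourier transform of a
    Gaussian. *)
Let W e z b y := gauss e y * sin (z * y + b).
Let W' e z b y := z * (gauss e y * cos (z * y + b)) - e ^+ 2 * (y * gauss e y * sin (z * y + b)).

Let is_derive_W e z b y : is_derive y 1 (W e z b) (W' e z b y).
Proof.
rewrite /W /W'; have := is_derive_gauss e y => ?.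
by apply: is_derive_eq; rewrite /GRing.scale/=; ring.
Qed.

Lemma continuous_trig (f : R -> R) z b : continuous f -> continuous (fun y => f (z * y + b)).
Proof.
move=> cf y; apply: continuous_comp; last exact: cf.
by apply: cvgD; [apply: cvgM; [exact: cvg_cst|exact: cvg_id]|exact: cvg_cst].
Qed.

Let continuous_W' e z b : continuous (W' e z b).
Proof.
move=> y; apply: cvgB; apply: cvgM; try exact: cvg_cst; apply: cvgM.
- exact: continuous_gauss.
- by apply: continuous_trig; exact: continuous_cos.
- by apply: cvgM; [exact: cvg_id|exact: continuous_gauss].
- by apply: continuous_trig; exact: continuous_sin.
Qed.

Let measurable_trig (f : R -> R) z b : continuous f -> measurable_fun setT (fun y => f (z * y + b)).
Proof. by move=> cf; apply: continuous_measurable_fun; exact: continuous_trig. Qed.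

Lemma integrable_gauss_cos e z b : 0 < e ->
  mu.-integrable setT (EFin \o (fun y => gauss e y * cos (z * y + b))).
Proof.
move=> e0; apply: (@integrableMr_bounded _ _ _ _ _ _ _ 1) => //.
- by apply: integrable_gauss; rewrite gt_eqF.
- by apply: measurable_trig; exact: continuous_cos.
- by move=> y _; exact: normr_cos_le1.
Qed.

Let integrable_gauss_sin e z b : 0 < e ->
  mu.-integrable setT (EFin \o (fun y => y * gauss e y * sin (z * y + b))).
Proof.
move=> e0; apply: (@integrableMr_bounded _ _ _ _ _ _ _ 1) => //.
- exact: integrable_gauss_mul.
- by apply: measurable_trig; exact: continuous_sin.
- by move=> y _; exact: normr_sin_le1.
Qed.

Let integrable_W' e z b : 0 < e -> mu.-integrable setT (EFin \o W' e z b).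
Proof.
move=> e0; rewrite /W'.
rewrite [X in _.-integrable _ X](_ : _ = (fun y =>
  z%:E * (gauss e y * cos (z * y + b))%:E -
  (e ^+ 2)%:E * (y * gauss e y * sin (z * y + b))%:E)%E)//.
by apply: integrableB => //; apply: integrableZl => //;
  [exact: integrable_gauss_cos|exact: integrable_gauss_sin].
Qed.

(** On a symmetric interval the integral is a difference of two boundary values of [W], each at most
    the Gaussian at the endpoint, hence O(1 / N) by [1 + u <= expR u]; dominated convergence extends
    the intervals to the whole line. *)
Let integral_W' e z b : 0 < e -> \int[mu]_y W' e z b y = 0.
Proof.
move=> e0.
pose D (N : nat) : set R := `[- N.+1%:R, N.+1%:R]%classic.
have N0 N : - N.+1%:R < N.+1%:R :> R by rewrite (@lt_trans _ _ 0)// ?oppr_lt0 ltr0n.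
have FTC N : \int[mu]_(y in D N) W' e z b y = W e z b N.+1%:R - W e z b (- N.+1%:R).
  rewrite /Rintegral (@continuous_FTC2 _ _ (W e z b))// ?EFinB//.
  - by apply: continuous_subspaceT; exact: continuous_W'.
  - have dW y : derivable (W e z b) y 1 by have := is_derive_W e z b y => ?; exact: ex_derive.
    have cW y : {for y, continuous (W e z b)}.
      by have /derivable1_diffP/differentiable_continuous := dW y.
    split => //; [exact: cvg_at_right_filter (cW _)|exact: cvg_at_left_filter (cW _)].
  - by move=> y _; rewrite derive1E; have := is_derive_W e z b y => ?; exact: derive_val.
have lim0 : \int[mu]_(y in D N) W' e z b y @[N --> \oo] --> 0.
  under eq_fun do rewrite FTC.
  apply: (@squeeze_cvgr _ _ _ _ (fun N => - (4 / e ^+ 2 * N.+1%:R^-1)) (fun N => 4 / e ^+ 2 * N.+1%:R^-1)).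
  - apply: nearW => N /=; rewrite -ler_norml.
    have Wle y : `|W e z b y| <= gauss e y.
      by rewrite normrM (ger0_norm (gauss_ge0 _ _)) ler_piMr ?gauss_ge0// normr_sin_le1.
    have gN : gauss e (- N.+1%:R) = gauss e N.+1%:R by rewrite /gauss mulrN sqrrN.
    have gle : gauss e N.+1%:R <= 2 / e ^+ 2 * N.+1%:R^-1.
      have N1 : 1 <= N.+1%:R :> R by rewrite ler1n.
      have eN : e ^+ 2 / 2 * N.+1%:R <= expR ((e * N.+1%:R) ^+ 2 / 2).
        apply: le_trans (expR_ge1Dx _).
        by have := mulr_gt0 e0 e0; rewrite exprMn expr2; nra.
      have -> : 2 / e ^+ 2 * N.+1%:R^-1 = (e ^+ 2 / 2 * N.+1%:R)^-1.
        by rewrite !invfM invrK (mulrC 2).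
      rewrite /gauss expRN lef_pV2 ?posrE ?expR_gt0//.
      by rewrite !mulr_gt0// exprn_gt0.
    rewrite (le_trans (ler_normB _ _))//.
    have WN := Wle (- N.+1%:R); rewrite gN in WN.
    rewrite (_ : 4 / e ^+ 2 * N.+1%:R^-1 = 2 / e ^+ 2 * N.+1%:R^-1 + 2 / e ^+ 2 * N.+1%:R^-1); last by ring.
    by apply: lerD; exact: le_trans gle.
  - by rewrite -oppr0; apply: cvgN; rewrite -[X in _ --> X](mulr0 (4 / e ^+ 2)); apply: cvgM; [exact: cvg_cst|exact: cvg_harmonic].
  - by rewrite -[X in _ --> X](mulr0 (4 / e ^+ 2)); apply: cvgM; [exact: cvg_cst|exact: cvg_harmonic].
have mW' : measurable_fun setT (W' e z b) by apply: continuous_measurable_fun; exact: continuous_W'.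
have mf_ N : measurable_fun setT (fun y => W' e z b y * \1_(D N) y).
  apply: measurable_funM => //; apply: measurable_indic; exact: measurable_itv.
have cvgf y : setT y -> W' e z b y * \1_(D N) y @[N --> \oo] --> W' e z b y.
  move=> _; apply: cvg_near_cst.
  exists (Num.truncn `|y|) => // N /= yN.
  rewrite indicE mem_set ?mulr1// /D/= in_itv/= -ler_norml.
  by rewrite (le_trans (ltW (truncnS_gt _)))// ler_nat.
have f_le N y : setT y -> `|W' e z b y * \1_(D N) y| <= `|W' e z b y|.
  by move=> _; rewrite normrM ler_piMr// indicE; case: (_ \in _); rewrite ?normr1 ?normr0.
have [_] := @dominated_cvg_Rintegral _ _ R mu setT _ _ (fun y => `|W' e z b y|)
  measurableT mf_ cvgf (integrable_norm (integrable_W' z b e0)) f_le.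
rewrite (_ : (fun N => _) = (fun N => \int[mu]_(y in D N) W' e z b y)).
  by move/cvg_lim => <-//; exact/cvg_lim.
apply/funext => N; rewrite [RHS]Rintegral_mkcond; congr Rintegral.
apply/funext => y.
by rewrite /patch indicE; case: ifPn; rewrite ?mulr1 ?mulr0.
Qed.

(** Differentiation under the integral sign and [integral_W'] give [phi' = - (z / e ^+ 2) * phi];
    hence [phi z * expR (z ^+ 2 / (2 * e ^+ 2))] is constant, and its value at 0 is the Gaussian
    integral. The phase [b] treats cosine and sine together. *)
Lemma integral_gauss_cos e z b : 0 < e ->
  \int[mu]_y (gauss e y * cos (z * y + b)) =
  2 * pi * normal_pdf 0 e z * cos b.
Proof.
move=> e0.
pose phi z := \int[mu]_y (gauss e y * cos (z * y + b)).
pose f z y := gauss e y * cos (z * y + b).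
have df z0 y : is_derive z0 1 (f ^~ y) (- (y * gauss e y * sin (z0 * y + b))).
  by rewrite /f; apply: is_derive_eq; rewrite /GRing.scale/=; ring.
have dphi z0 : is_derive z0 1 phi (- (z0 / e ^+ 2 * phi z0)).
  have I0 : `]z0 - 1, z0 + 1[%classic z0 by rewrite /= in_itv/=; lra.
  have intf x : `]z0 - 1, z0 + 1[%classic x -> mu.-integrable setT (EFin \o f x) by move=> _; exact: integrable_gauss_cos.
  have derf x y : `]z0 - 1, z0 + 1[%classic x -> setT y -> derivable (f ^~ y) x 1.
    by move=> _ _; have := df x y => ?; exact: ex_derive.
  have G0 y : 0 <= e^-1 * gauss (e / Num.sqrt 2) y.
    by rewrite mulr_ge0 ?gauss_ge0// invr_ge0 ltW.
  have intG : mu.-integrable setT (EFin \o (fun y => e^-1 * gauss (e / Num.sqrt 2) y)).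
    rewrite [X in _.-integrable _ X](_ : _ = (fun y =>
      (e^-1)%:E * (gauss (e / Num.sqrt 2) y)%:E)%E)//.
    apply: integrableZl => //; apply: integrable_gauss.
    by rewrite gt_eqF// divr_gt0// sqrtr_gt0.
  have d1fE x y : partial1of2 f x y = - (y * gauss e y * sin (x * y + b)).
    by rewrite partial1of2E; have := df x y => ?; exact: derive_val.
  have fG x y : `]z0 - 1, z0 + 1[%classic x -> setT y -> `|partial1of2 f x y| <= e^-1 * gauss (e / Num.sqrt 2) y.
    move=> _ _; rewrite d1fE normrN normrM.
    apply: le_trans (gauss_mul_le _ e0); rewrite ler_piMr//.
    by rewrite normr_sin_le1.
  have H1 := @derivable_under_integral R _ _ mu f setT measurableT _ _ _ I0 intf derf _ G0 intG fG.
  have H2 := @differentiation_under_integral R _ _ mu f setT measurableT _ _ _ I0 intf derf _ G0 intG fG.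
  apply: DeriveDef => //; rewrite -derive1E H2 /=.
  rewrite (_ : Rintegral _ _ _ = \int[mu]_y (-1 * (y * gauss e y * sin (z0 * y + b)))); last first.
    by congr Rintegral; apply/funext => y; rewrite d1fE mulN1r.
  rewrite RintegralZl//; last exact: integrable_gauss_sin.
  have := integral_W' z0 b e0; rewrite /W' RintegralB//; last 2 first.
  - rewrite [X in _.-integrable _ X](_ : _ = (fun y =>
      z0%:E * (gauss e y * cos (z0 * y + b))%:E)%E)//.
    by apply: integrableZl => //; exact: integrable_gauss_cos.
  - rewrite [X in _.-integrable _ X](_ : _ = (fun y =>
      (e ^+ 2)%:E * (y * gauss e y * sin (z0 * y + b))%:E)%E)//.
    by apply: integrableZl => //; exact: integrable_gauss_sin.
  rewrite !RintegralZl//; [|exact: integrable_gauss_sin|exact: integrable_gauss_cos].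
  rewrite -/(phi z0) => /eqP; rewrite subr_eq0 => /eqP H.
  by rewrite mulrAC H mulrAC mulfV ?mulN1r ?mul1r// expf_neq0// gt_eqF.
have phiE : phi z = phi 0 * expR (- (z ^+ 2 / (2 * e ^+ 2))).
  pose psi x := phi x * expR (x ^+ 2 / (2 * e ^+ 2)).
  have dpsi (x : R) : is_derive x (1 : R) psi 0.
    have := dphi x => ?; rewrite /psi; apply: is_derive_eq.
    by rewrite /GRing.scale/=; field; rewrite gt_eqF.
  have := is_derive_0_is_cst z 0 dpsi.
  by rewrite /psi expr0n /= mul0r expR0 mulr1 => <-; rewrite -mulrA -expRD subrr expR0 mulr1.
have phi0 : phi 0 = Num.sqrt (2 * pi) / e * cos b.
  rewrite /phi; under eq_Rintegral do rewrite mul0r add0r.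
  rewrite RintegralZr//; last by apply: integrable_gauss; rewrite gt_eqF.
  by rewrite /Rintegral integral_gauss ?gt_eqF//= gtr0_norm.
rewrite -/(phi z) phiE phi0 normal_pdfE ?gt_eqF// /normal_peak /normal_fun.
have pi2 : 0 < 2 * pi :> R by rewrite mulr_gt0 ?pi_gt0.
have -> : e ^+ 2 * pi *+ 2 = e ^+ 2 * (2 * pi) by ring.
rewrite (@sqrtrM _ (e ^+ 2)) ?sqr_ge0// sqrtr_sqr gtr0_norm// subr0.
have -> : - (z ^+ 2 / (2 * e ^+ 2)) = - z ^+ 2 / (e ^+ 2 *+ 2) by field; rewrite gt_eqF.
set p := Num.sqrt (2 * pi).
have p0 : p != 0 by rewrite gt_eqF// sqrtr_gt0.
have -> : 2 * pi = p ^+ 2 by rewrite sqr_sqrtr// ltW.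
by field; rewrite p0 gt_eqF.
Qed.
Lemma ge0_integral_shift y (g : R -> R) : continuous g -> (forall t, 0 <= g t) ->
  (\int[mu]_t (g t)%:E = \int[mu]_t (g (t + y))%:E)%E.
Proof.
move=> cg g0.
have d1 t : is_derive t (1 : R) (fun t : R => t + y) 1.
  by apply: is_derive_eq; rewrite addr0.
have d1E : (fun t : R => t + y)^`()%classic = cst 1.
  by apply/funext => t; rewrite derive1E; exact: derive_val.
rewrite (@increasing_ge0_integration_by_substitutionT _ (fun t => t + y) g)//.
- by apply: eq_integral => t _; rewrite d1E !fctE mulr1.
- by move=> a b ab; rewrite ltrD2r.
- by rewrite d1E => t; exact: cvg_cst.
- by rewrite d1E; exact: is_cvg_cst.
- by rewrite d1E; exact: is_cvg_cst.
- exact: cvg_addrr_Ny.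
- exact: cvg_addrr.
Qed.

Let continuous_gauss_shift e y : continuous (fun t => gauss e (t - y)).
Proof.
move=> t; apply: continuous_comp; last exact: continuous_gauss.
by apply: cvgB; [exact: cvg_id|exact: cvg_cst].
Qed.

Lemma integral_gauss_shift e y : e != 0 ->
  (\int[mu]_t (gauss e (t - y))%:E = (Num.sqrt (2 * pi) / `|e|)%:E)%E.
Proof.
move=> e0; rewrite (ge0_integral_shift y); [|exact: continuous_gauss_shift|by move=> t; exact: gauss_ge0].
by under eq_integral do rewrite addrK; exact: integral_gauss.
Qed.

Lemma integrable_gauss_shift e y : e != 0 ->
  mu.-integrable setT (EFin \o (fun t => gauss e (t - y))).
Proof.
move=> e0; apply/integrableP; split.
  apply/measurable_EFinP; apply: continuous_measurable_fun; exact: continuous_gauss_shift.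
under eq_integral do rewrite /= ger0_norm ?gauss_ge0//.
by rewrite integral_gauss_shift// ltry.
Qed.

Lemma integrable_gauss_shift_cos e z b y : 0 < e ->
  mu.-integrable setT (EFin \o (fun t => gauss e (t - y) * cos (z * t + b))).
Proof.
move=> e0; apply: (@integrableMr_bounded _ _ _ _ _ _ _ 1) => //.
- by apply: integrable_gauss_shift; rewrite gt_eqF.
- by apply: measurable_trig; exact: continuous_cos.
- by move=> t _; exact: normr_cos_le1.
Qed.

(* [1 + cos] makes the integrands nonnegative, as the change of variables
   requires. *)
Lemma integral_gauss_shift_cos e z b y : 0 < e ->
  \int[mu]_t (gauss e (t - y) * cos (z * t + b)) =
  2 * pi * normal_pdf 0 e z * cos (z * y + b).
Proof.
move=> e0; have en0 : e != 0 by rewrite gt_eqF.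
rewrite -integral_gauss_cos//; apply: (addrI (\int[mu]_t gauss e (t - y))).
rewrite -RintegralD//; [|exact: integrable_gauss_shift|exact: integrable_gauss_shift_cos].
have -> : \int[mu]_t gauss e (t - y) = \int[mu]_t gauss e t.
  by rewrite /Rintegral integral_gauss_shift// integral_gauss.
rewrite -RintegralD//; [|exact: integrable_gauss|exact: integrable_gauss_cos].
rewrite /Rintegral; congr fine; rewrite (ge0_integral_shift y); last 2 first.
- move=> t; apply: cvgD; first exact: continuous_gauss_shift.
  apply: cvgM; first exact: continuous_gauss_shift.
  by apply: continuous_trig; exact: continuous_cos.
- move=> t; have := gauss_ge0 e (t - y); have := cos_geN1 (z * t + b); nra.
by apply: eq_integral => t _; rewrite addrK mulrDr addrA.
Qed.

End gaussian.

Section gaussian_tuple.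
Context {R : realType}.
Notation mu := (@lebesgue_measure R).

Definition gaussn n (e : R) (x : n.-tuple R) : R := \prod_i gauss e (tnth x i).

(* The Fourier transform of [gaussn e] *)
Definition gaussn_hat n (e : R) (z : n.-tuple R) : R :=
  \prod_i (2 * pi * normal_pdf 0 e (tnth z i)).

Lemma gaussn_ge0 n e (x : n.-tuple R) : 0 <= gaussn e x.
Proof. by apply: prodr_ge0 => i _; exact: gauss_ge0. Qed.

Lemma gaussn_le1 n e (x : n.-tuple R) : gaussn e x <= 1.
Proof. by apply: prodr_ile1 => i _; rewrite gauss_ge0 gauss_le1. Qed.

Lemma gaussn_hat_ge0 n e (x : n.-tuple R) : 0 <= gaussn_hat e x.
Proof. by apply: prodr_ge0 => i _; rewrite !mulr_ge0 ?pi_ge0 ?normal_pdf_ge0. Qed.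

Lemma measurable_gaussn n e : measurable_fun setT (@gaussn n e).
Proof.
apply: measurable_prod => i _.
exact: measurableT_comp (measurable_gauss e) (@measurable_tnth _ R n i).
Qed.

Lemma measurable_gaussn_hat n e : measurable_fun setT (@gaussn_hat n e).
Proof.
apply: measurable_prod => i _; apply: measurable_funM => //.
exact: measurableT_comp (measurable_normal_pdf 0 e) (@measurable_tnth _ R n i).
Qed.

Definition gaussn_at n (e : R) (y x : n.-tuple R) : R :=
  \prod_i gauss e (tnth x i - tnth y i).

Lemma gaussn_at0 n e : gaussn_at e [tuple 0 | i < n] = @gaussn n e.
Proof.
apply/funext => x; apply: eq_bigr => i _.
by rewrite tnth_mktuple subr0.
Qed.

Lemma gaussn_at_ge0 n e (y x : n.-tuple R) : 0 <= gaussn_at e y x.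
Proof. by apply: prodr_ge0 => i _; exact: gauss_ge0. Qed.

Lemma measurable_gaussn_at n e (y : n.-tuple R) : measurable_fun setT (gaussn_at e y).
Proof.
apply: measurable_prod => i _.
apply: (measurableT_comp (measurable_gauss e)).
by apply: measurable_funB => //; exact: measurable_tnth.
Qed.

Lemma integrable_gaussn_at n e (y : n.-tuple R) : e != 0 ->
  (lebesgue_tuple n).-integrable setT (EFin \o gaussn_at e y).
Proof.
move=> e0; apply/integrableP; split; first by apply/measurable_EFinP; exact: measurable_gaussn_at.
under eq_integral do rewrite /= ger0_norm ?gaussn_at_ge0//.
rewrite (@ge0_integral_prod R n (fun i t => gauss e (t - tnth y i))); last 2 first.
- by move=> i; apply: (measurableT_comp (measurable_gauss e)); exact: measurable_funB.
- by move=> i t; exact: gauss_ge0.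
rewrite (eq_bigr (fun=> (Num.sqrt (2 * pi) / `|e|)%:E)) => [|i _]; last exact: integral_gauss_shift.
by rewrite prodEFin ltry.
Qed.

Lemma measurable_cos_dot n (z : n.-tuple R) b :
  measurable_fun setT (fun x : n.-tuple R => cos (tuple_dot z x + b)).
Proof.
apply: (measurableT_comp (continuous_measurable_fun (@continuous_cos R))).
apply: measurable_funD => //.
apply: measurable_sum => i; apply: measurable_funM => //; exact: measurable_tnth.
Qed.

Lemma integrable_gaussn_at_cos n e (y z : n.-tuple R) b : e != 0 ->
  (lebesgue_tuple n).-integrable setT
    (EFin \o (fun x => gaussn_at e y x * cos (tuple_dot z x + b))).
Proof.
move=> e0; apply: (@integrableMr_bounded _ _ _ _ _ _ _ 1) => //.
- exact: integrable_gaussn_at.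
- exact: measurable_cos_dot.
- by move=> x _; exact: normr_cos_le1.
Qed.

(** The arbitrary phase [b] makes the induction on the dimension close: while the first coordinate
    is integrated, the rest of the inner product belongs to the phase; afterwards the contribution
    of the first coordinate does. *)
Lemma integral_gaussn_at_cos n (e b : R) (y z : n.-tuple R) : 0 < e ->
  \int[lebesgue_tuple n]_x (gaussn_at e y x * cos (tuple_dot z x + b)) =
  gaussn_hat e z * cos (tuple_dot z y + b).
Proof.
move=> e0; have en0 : e != 0 by rewrite gt_eqF.
elim: n y z b => [|n ih] w z b.
  rewrite /gaussn_hat big_ord0 mul1r /Rintegral integral_dirac//.
    by rewrite diracT mul1e /= /gaussn_at big_ord0 mul1r /tuple_dot !big_ord0.
  apply/measurable_EFinP; apply: measurable_funM; first exact: measurable_gaussn_at.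
  exact: measurable_cos_dot.
pose z' := [tuple tnth z (lift ord0 i) | i < n].
pose w' := [tuple tnth w (lift ord0 i) | i < n].
have dotE x y : tuple_dot z (tuple_cons (x, y)) = tnth z ord0 * y + tuple_dot z' x.
  rewrite /tuple_dot big_ord_recl tnth0; congr (_ + _).
  by apply: eq_bigr => i _; rewrite tnthS tnth_mktuple.
have gE x y : gaussn_at e w (tuple_cons (x, y)) = gauss e (y - tnth w ord0) * gaussn_at e w' x.
  rewrite /gaussn_at big_ord_recl tnth0; congr (_ * _).
  by apply: eq_bigr => i _; rewrite tnthS tnth_mktuple.
have inner x : (fun y => gaussn_at e w (tuple_cons (x, y)) * cos (tuple_dot z (tuple_cons (x, y)) + b)) =
    (fun y => gaussn_at e w' x * (gauss e (y - tnth w ord0) * cos (tnth z ord0 * y + (tuple_dot z' x + b)))).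
  by apply/funext => y; rewrite gE dotE addrA; ring.
have intin x : mu.-integrable setT (EFin \o (fun y => gauss e (y - tnth w ord0) * cos (tnth z ord0 * y + (tuple_dot z' x + b)))).
  exact: integrable_gauss_shift_cos.
rewrite Rintegral_lebesgue_tupleS; last 2 first.
- exact: integrable_gaussn_at_cos.
- move=> x; rewrite inner.
  rewrite [X in _.-integrable _ X](_ : _ = (fun y => (gaussn_at e w' x)%:E *
    (gauss e (y - tnth w ord0) * cos (tnth z ord0 * y + (tuple_dot z' x + b)))%:E)%E)//.
  by apply: integrableZl => //; exact: intin.
transitivity (\int[lebesgue_tuple n]_x ((2 * pi * normal_pdf 0 e (tnth z ord0)) *
    (gaussn_at e w' x * cos (tuple_dot z' x + (tnth z ord0 * tnth w ord0 + b))))).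
  congr Rintegral; apply/funext => x; rewrite inner RintegralZl//.
  rewrite integral_gauss_shift_cos// (addrCA (tnth z ord0 * _)).
  by ring.
rewrite RintegralZl//; last exact: integrable_gaussn_at_cos.
rewrite ih /gaussn_hat big_ord_recl mulrA; congr (_ * _ * cos _).
  by apply: eq_bigr => i _; rewrite tnth_mktuple.
rewrite /tuple_dot [in RHS]big_ord_recl addrCA addrA; congr (_ + _ + _).
by apply: eq_bigr => i _; rewrite !tnth_mktuple.
Qed.

Lemma integrable_gaussn n e : e != 0 ->
  (lebesgue_tuple n).-integrable setT (EFin \o @gaussn n e).
Proof. by rewrite -gaussn_at0; exact: integrable_gaussn_at. Qed.

Lemma integrable_gaussn_cos n e (z : n.-tuple R) b : e != 0 ->
  (lebesgue_tuple n).-integrable setT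
    (EFin \o (fun x => gaussn e x * cos (tuple_dot z x + b))).
Proof. by rewrite -gaussn_at0; exact: integrable_gaussn_at_cos. Qed.

Lemma integral_gaussn_cos n (e b : R) (z : n.-tuple R) : 0 < e ->
  \int[lebesgue_tuple n]_x (gaussn e x * cos (tuple_dot z x + b)) =
  gaussn_hat e z * cos b.
Proof.
rewrite -gaussn_at0 => e0; rewrite integral_gaussn_at_cos//.
rewrite /tuple_dot big1 ?add0r// => i _.
by rewrite tnth_mktuple mulr0.
Qed.

End gaussian_tuple.

(** * Bessel's inequality *)

Section lebesgue_tuple2.
Context {R : realType} (n : nat).

(** The product measure under a name of its own, which carries the sigma-finite structure: Bessel's
    inequality applies Fubini's theorem on the product of [T] with [T * T]. *)
Definition lebesgue_tuple2 : set (n.-tuple R * n.-tuple R) -> \bar R :=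
  (@lebesgue_tuple R n \x @lebesgue_tuple R n)%E.

HB.instance Definition _ :=
  Measure.copy lebesgue_tuple2 (@lebesgue_tuple R n \x @lebesgue_tuple R n)%E.

Let sigma_finite_lebesgue_tuple2 : sigma_finite setT lebesgue_tuple2.
Proof.
exists (fun N => @cube R n N `*` @cube R n N) => [|N].
  apply/esym; rewrite -subTset => -[x y] _.
  have [N _ xN] : (\bigcup_N @cube R n N) x by rewrite bigcup_cube.
  have [M _ yM] : (\bigcup_N @cube R n N) y by rewrite bigcup_cube.
  exists (maxn N M) => //; split; [apply: subset_cube xN|apply: subset_cube yM].
    exact: leq_maxl.
  exact: leq_maxr.
split; first by apply: measurableX; exact: measurable_cube.
have -> : lebesgue_tuple2 (@cube R n N `*` @cube R n N) = ((N%:R ^+ n)%:E * (N%:R ^+ n)%:E)%E.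
  rewrite -!lebesgue_tuple_cube; apply: product_measure1E; exact: measurable_cube.
by rewrite -EFinM ltry.
Qed.

HB.instance Definition _ := Measure_isSigmaFinite.Build _ _ _ lebesgue_tuple2
  sigma_finite_lebesgue_tuple2.

End lebesgue_tuple2.

Lemma normal_pdf_sub (R : realType) (e t y : R) : e != 0 ->
  normal_pdf 0 e (t - y) = normal_pdf y e t.
Proof. by move=> e0; rewrite !normal_pdfE// /normal_fun subr0. Qed.

Lemma normal_pdfN (R : realType) (e y : R) : e != 0 ->
  normal_pdf 0 e (- y) = normal_pdf 0 e y.
Proof. by move=> e0; rewrite !normal_pdfE// /normal_fun !subr0 sqrrN. Qed.

Section bessel.
Context {R : realType} {n : nat}.
Notation T := (n.-tuple R).
Notation m := (@lebesgue_tuple R n).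
Implicit Types (h : T -> R) (x xi eta : T).

Definition tuple_sub x y : T := [tuple tnth x i - tnth y i | i < n].

Lemma tuple_dotBl x y z : tuple_dot (tuple_sub x y) z = tuple_dot x z - tuple_dot y z.
Proof.
rewrite /tuple_dot -sumrB; apply: eq_bigr => i _.
by rewrite tnth_mktuple mulrBl.
Qed.

Lemma tuple_dotC x y : tuple_dot x y = tuple_dot y x.
Proof. by apply: eq_bigr => i _; rewrite mulrC. Qed.

Lemma measurable_tuple_sub : measurable_fun [set: T * T] (fun z => tuple_sub z.1 z.2).
Proof.
apply/measurable_fun_tnthP => i.
rewrite (_ : _ \o _ = fun z : T * T => tnth z.1 i - tnth z.2 i); last first.
  by apply/funext => z /=; rewrite tnth_mktuple.
apply: measurable_funB.
  exact: (measurableT_comp (@measurable_tnth _ R n i)).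
exact: (measurableT_comp (@measurable_tnth _ R n i)).
Qed.

Definition cosT h x : R := \int[m]_xi (h xi * cos (tuple_dot xi x)).
Definition sinT h x : R := \int[m]_xi (h xi * sin (tuple_dot xi x)).
(** For real [h], the squared modulus of the Fourier integral whose real and imaginary parts are
    [cosT h x] and [sinT h x]. *)
Definition energyT h x : R := cosT h x ^+ 2 + sinT h x ^+ 2.

Lemma energyT_ge0 h x : 0 <= energyT h x.
Proof. by rewrite addr_ge0 ?sqr_ge0. Qed.

Lemma measurable_dotl x : measurable_fun setT (fun xi => tuple_dot xi x).
Proof. by apply: measurable_sum => i; apply: measurable_funM => //; exact: measurable_tnth. Qed.

Let measurable_dotr (f : R -> R) x : continuous f ->
  measurable_fun setT (fun xi => f (tuple_dot xi x)).
Proof.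
move=> cf; apply: (measurableT_comp (continuous_measurable_fun cf)).
exact: measurable_dotl.
Qed.

Lemma integrable_cosT h x : m.-integrable setT (EFin \o h) ->
  m.-integrable setT (EFin \o (fun xi => h xi * cos (tuple_dot xi x))).
Proof.
move=> inth; apply: (@integrableMr_bounded _ _ _ _ _ _ _ 1) => //.
- by apply: measurable_dotr; exact: continuous_cos.
- by move=> y _; exact: normr_cos_le1.
Qed.

Lemma integrable_sinT h x : m.-integrable setT (EFin \o h) ->
  m.-integrable setT (EFin \o (fun xi => h xi * sin (tuple_dot xi x))).
Proof.
move=> inth; apply: (@integrableMr_bounded _ _ _ _ _ _ _ 1) => //.
- by apply: measurable_dotr; exact: continuous_sin.
- by move=> y _; exact: normr_sin_le1.
Qed.

Lemma measurable_cosT h : measurable_fun setT h -> measurable_fun setT (cosT h).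
Proof.
move=> mh; apply: (@measurable_Rintegral _ _ T T R m (fun z : T * T => h z.2 * cos (tuple_dot z.2 z.1))).
apply: measurable_funM; first exact: measurableT_comp mh _.
apply: (measurableT_comp (continuous_measurable_fun (@continuous_cos R))).
under eq_fun do rewrite tuple_dotC.
exact: measurable_tuple_dot.
Qed.

Lemma measurable_sinT h : measurable_fun setT h -> measurable_fun setT (sinT h).
Proof.
move=> mh; apply: (@measurable_Rintegral _ _ T T R m (fun z : T * T => h z.2 * sin (tuple_dot z.2 z.1))).
apply: measurable_funM; first exact: measurableT_comp mh _.
apply: (measurableT_comp (continuous_measurable_fun (@continuous_sin R))).
under eq_fun do rewrite tuple_dotC.
exact: measurable_tuple_dot.
Qed.

Lemma measurable_energyT h : measurable_fun setT h -> measurable_fun setT (energyT h).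
Proof.
by move=> mh; apply: measurable_funD; apply: measurable_funX;
  [exact: measurable_cosT|exact: measurable_sinT].
Qed.

Local Notation mm := (@lebesgue_tuple2 R n).

Let integrable_hh h : m.-integrable setT (EFin \o h) ->
  mm.-integrable setT (EFin \o (fun z : T * T => h z.1 * h z.2)).
Proof. by move=> inth; exact: integrable_prodM. Qed.

Let integrable_hhcos h x : m.-integrable setT (EFin \o h) ->
  mm.-integrable setT (EFin \o (fun z : T * T => h z.1 * h z.2 * cos (tuple_dot (tuple_sub z.1 z.2) x))).
Proof.
move=> inth; apply: (@integrableMr_bounded _ _ _ _ _ _ _ 1) => //.
+ exact: integrable_hh.
+ apply: (measurableT_comp (continuous_measurable_fun (@continuous_cos R))).
  exact: (measurableT_comp (measurable_dotl x) measurable_tuple_sub).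
+ by move=> y _; exact: normr_cos_le1.
Qed.

(** The addition formula merges the two squares into one double integral whose kernel depends on
    [xi - eta] only; a Gaussian integration in [x] then turns this kernel into [gaussn_hat]. *)
Let energyTE h x : m.-integrable setT (EFin \o h) ->
  energyT h x = \int[mm]_z (h z.1 * h z.2 * cos (tuple_dot (tuple_sub z.1 z.2) x)).
Proof.
move=> inth.
have E xi eta : h xi * h eta * cos (tuple_dot (tuple_sub xi eta) x) =
    h xi * cos (tuple_dot xi x) * (h eta * cos (tuple_dot eta x)) +
    h xi * sin (tuple_dot xi x) * (h eta * sin (tuple_dot eta x)).
  by rewrite tuple_dotBl cosB; ring.
have int2 (c : R) (f : T -> R) := @integrable_mull _ T R m setT f c measurableT.
have int2' (c : R) (f : T -> R) : m.-integrable setT (EFin \o f) ->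
    m.-integrable setT (EFin \o (fun eta => f eta * c)).
  by move=> /(int2 c); congr (_.-integrable _ (EFin \o _)); apply/funext => y; rewrite mulrC.
have inner xi : \int[m]_eta (h xi * h eta * cos (tuple_dot (tuple_sub xi eta) x)) =
    h xi * cos (tuple_dot xi x) * cosT h x + h xi * sin (tuple_dot xi x) * sinT h x.
  under eq_Rintegral do rewrite E.
  rewrite RintegralD//; [|exact/int2/integrable_cosT|exact/int2/integrable_sinT].
  by rewrite !RintegralZl//; [exact: integrable_sinT|exact: integrable_cosT].
rewrite Rintegral_prodE/=; last 2 first.
- exact: integrable_hhcos.
- move=> xi; rewrite (_ : (fun _ => _) = (fun eta => h xi * (h eta * cos (tuple_dot (tuple_sub xi eta) x)))).
    apply: int2; apply: (@integrableMr_bounded _ _ _ _ _ _ _ 1) => //.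
    + apply: (measurableT_comp (continuous_measurable_fun (@continuous_cos R))).
      under eq_fun do rewrite tuple_dotBl.
      by apply: measurable_funB => //; exact: measurable_dotl.
    + by move=> y _; exact: normr_cos_le1.
  by apply/funext => eta; rewrite mulrA.
rewrite (_ : (fun xi => Rintegral _ _ _) = (fun xi => h xi * cos (tuple_dot xi x) * cosT h x + h xi * sin (tuple_dot xi x) * sinT h x)); last first.
  by apply/funext => xi; exact: inner.
rewrite RintegralD//; [|exact/int2'/integrable_cosT|exact/int2'/integrable_sinT].
by rewrite !RintegralZr//; [exact: integrable_sinT|exact: integrable_cosT].
Qed.

Let measurable_ghat e : measurable_fun setT (fun z : T * T => gaussn_hat e (tuple_sub z.1 z.2)).
Proof. exact: measurableT_comp (@measurable_gaussn_hat R n e) measurable_tuple_sub. Qed.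

Lemma integral_gaussn_hat_subl e (y : T) : e != 0 ->
  (\int[m]_x (gaussn_hat e (tuple_sub x y))%:E)%E = ((2 * pi) ^+ n)%:E.
Proof.
move=> e0; pose k i t := 2 * pi * normal_pdf 0 e (t - tnth y i).
transitivity (\int[m]_x (\prod_i k i (tnth x i))%:E)%E.
  apply: eq_integral => x _; congr EFin; apply: eq_bigr => i _.
  by rewrite tnth_mktuple.
rewrite ge0_integral_prod; last 2 first.
- move=> i; apply: measurable_funM => //.
  apply: (measurableT_comp (measurable_normal_pdf 0 e)); exact: measurable_funB.
- by move=> i t; rewrite !mulr_ge0 ?pi_ge0 ?normal_pdf_ge0.
under eq_bigr => i _.
  rewrite (_ : integral _ _ _ = (2 * pi)%:E); first over.
  rewrite /k; under eq_integral do rewrite EFinM normal_pdf_sub//.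
  rewrite integralZl//; last exact: integrable_normal_pdf.
  by rewrite integral_normal_pdf mule1.
by rewrite prodEFin prodr_const card_ord.
Qed.

Lemma gaussn_hat_subC x y e : e != 0 -> gaussn_hat e (tuple_sub x y) = gaussn_hat e (tuple_sub y x).
Proof.
by move=> e0; apply: eq_bigr => i _; rewrite !tnth_mktuple -opprB normal_pdfN.
Qed.

Lemma integral_gaussn_hat_subr e (x : T) : e != 0 ->
  (\int[m]_y (gaussn_hat e (tuple_sub x y))%:E)%E = ((2 * pi) ^+ n)%:E.
Proof.
move=> e0; rewrite -(integral_gaussn_hat_subl x e0).
by apply: eq_integral => y _; rewrite gaussn_hat_subC.
Qed.

(** By Fubini's theorem the left side is the quadratic form in [h] with kernel
    [gaussn_hat e (tuple_sub xi eta)]. This kernel is nonnegative with mass [(2 * pi) ^+ n] in each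
    variable, whatever [e], so Schur's test applies: bound the product of two values of [h] by the
    mean of their squares. *)
Let bessel_gaussn e h : 0 < e -> m.-integrable setT (EFin \o h) ->
  (\int[m]_x (gaussn e x * energyT h x)%:E <=
   ((2 * pi) ^+ n)%:E * \int[m]_xi (h xi ^+ 2)%:E)%E.
Proof.
move=> e0 inth.
have /measurable_EFinP mh := measurable_int _ inth.
pose f (z : T * (T * T)) := gaussn e z.1 * (h z.2.1 * h z.2.2) * cos (tuple_dot (tuple_sub z.2.1 z.2.2) z.1).
have en0 : e != 0 by rewrite gt_eqF.
have mcos : measurable_fun [set: T * (T * T)] (fun z => cos (tuple_dot (tuple_sub z.2.1 z.2.2) z.1)).
  apply: (measurableT_comp (continuous_measurable_fun (@continuous_cos R))).
  apply: (measurableT_comp (@measurable_tuple_dot R n) (measurable_fun_pair _ _)) => //.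
  exact: measurableT_comp measurable_tuple_sub _.
have intf : (m \x mm)%E.-integrable setT (EFin \o f).
  have int1 := @integrable_prodM _ _ T (T * T)%type R m mm (@gaussn R n e) (fun w => h w.1 * h w.2)
    (integrable_gaussn n en0) (integrable_hh inth).
  refine (integrableMr_bounded measurableT int1 mcos (M := 1) _).
  by move=> y _; exact: normr_cos_le1.
have := Fubini intf.
rewrite (_ : (fun x => _) = (fun x => (gaussn e x * energyT h x)%:E)); last first.
  apply/funext => x; rewrite energyTE//.
  transitivity (\int[mm]_z ((gaussn e x)%:E *
      (h z.1 * h z.2 * cos (tuple_dot (tuple_sub z.1 z.2) x))%:E))%E.
    by apply: eq_integral => z _; rewrite -EFinM; congr EFin; rewrite /f/=; ring.
  rewrite integralZl//; last exact: integrable_hhcos.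
  by rewrite EFinM fineK//; exact: (integrable_fin_num _ (integrable_hhcos x inth)).
move=> ->.
pose g (z : T * T) := h z.1 * h z.2 * gaussn_hat e (tuple_sub z.1 z.2).
rewrite (_ : (fun y => _) = EFin \o g); last first.
  apply/funext => z.
  transitivity (\int[m]_x ((h z.1 * h z.2)%:E *
      (gaussn e x * cos (tuple_dot (tuple_sub z.1 z.2) x + 0))%:E))%E.
    by apply: eq_integral => x _; rewrite -EFinM /= /f addr0; congr EFin; ring.
  rewrite integralZl//; last exact: integrable_gaussn_cos.
  rewrite [RHS]/= /g [in RHS]EFinM; congr (_ * _)%E.
  rewrite -[gaussn_hat _ _]mulr1 -cos0 -integral_gaussn_cos// fineK//.
  exact: (integrable_fin_num _ (integrable_gaussn_cos (tuple_sub z.1 z.2) 0 en0)).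
have mhat := measurable_ghat e.
have mh1 : measurable_fun [set: T * T] (fun z => h z.1) by exact: measurableT_comp.
have mh2 : measurable_fun [set: T * T] (fun z => h z.2) by exact: measurableT_comp.
have mg : measurable_fun setT g by apply: measurable_funM => //; exact: measurable_funM.
apply: (le_trans (lee_abs _)); apply: (le_trans (le_abse_integral _ _ _)) => //.
  by apply/measurable_EFinP.
have q0 (u : R) v : 0 <= 2^-1 * u ^+ 2 * gaussn_hat e v :> R.
  by rewrite mulr_ge0 ?gaussn_hat_ge0// mulr_ge0 ?sqr_ge0 ?invr_ge0.
have mq1 : measurable_fun [set: T * T] (fun z => 2^-1 * h z.1 ^+ 2 * gaussn_hat e (tuple_sub z.1 z.2)).
  by apply: measurable_funM => //; apply: measurable_funM => //; exact: measurable_funX.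
have mq2 : measurable_fun [set: T * T] (fun z => 2^-1 * h z.2 ^+ 2 * gaussn_hat e (tuple_sub z.1 z.2)).
  by apply: measurable_funM => //; apply: measurable_funM => //; exact: measurable_funX.
apply: (@le_trans _ _ (\int[mm]_z ((2^-1 * h z.1 ^+ 2 * gaussn_hat e (tuple_sub z.1 z.2))%:E +
    (2^-1 * h z.2 ^+ 2 * gaussn_hat e (tuple_sub z.1 z.2))%:E))%E).
  apply: ge0_le_integral => //.
  - by apply: measurableT_comp => //; apply/measurable_EFinP.
  - by apply: emeasurable_funD; apply/measurable_EFinP.
  - move=> z _; rewrite /= -EFinD lee_fin /g normrM (ger0_norm (gaussn_hat_ge0 _ _)) -mulrDl.
    rewrite ler_wpM2r ?gaussn_hat_ge0// normrM.
    by have := sqr_ge0 (`|h z.1| - `|h z.2|); have := real_normK (num_real (h z.1));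
      have := real_normK (num_real (h z.2)); nra.
rewrite ge0_integralD//; last 4 first.
- by move=> z _; rewrite lee_fin.
- by apply/measurable_EFinP.
- by move=> z _; rewrite lee_fin.
- by apply/measurable_EFinP.
have mh2' : measurable_fun setT (fun x => h x ^+ 2) by exact: measurable_funX.
have intq : (\int[m]_x ((2^-1 * h x ^+ 2)%:E * ((2 * pi) ^+ n)%:E) =
    (2^-1)%:E * (((2 * pi) ^+ n)%:E * \int[m]_xi (h xi ^+ 2)%:E))%E.
  rewrite ge0_integralZr//; last 3 first.
  - by apply/measurable_EFinP; exact: measurable_funM.
  - by move=> x _; rewrite lee_fin mulr_ge0 ?invr_ge0 ?sqr_ge0.
  - by rewrite lee_fin exprn_ge0// mulr_ge0// pi_ge0.
  under eq_integral do rewrite EFinM.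
  rewrite ge0_integralZl//; last 2 first.
  - by apply/measurable_EFinP.
  - by move=> x _; rewrite lee_fin sqr_ge0.
  by rewrite -muleA [X in (_ * X)%E]muleC.
have I1 : (\int[mm]_z (2^-1 * h z.1 ^+ 2 * gaussn_hat e (tuple_sub z.1 z.2))%:E =
    (2^-1)%:E * (((2 * pi) ^+ n)%:E * \int[m]_xi (h xi ^+ 2)%:E))%E.
  rewrite -intq.
  rewrite [LHS](@fubini_tonelli1 _ _ T T R m m (fun z => (2^-1 * h z.1 ^+ 2 * gaussn_hat e (tuple_sub z.1 z.2))%:E)); last 2 first.
  - by apply/measurable_EFinP.
  - by move=> z; rewrite lee_fin.
  apply: eq_integral => x _; rewrite /fubini_F /=.
  under eq_integral do rewrite EFinM.
  rewrite ge0_integralZl ?integral_gaussn_hat_subr//.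
  - apply/measurable_EFinP.
    exact: (measurableT_comp mhat (measurable_fun_pair (measurable_cst x) (@measurable_id _ T setT))).
  - by move=> y _; rewrite lee_fin gaussn_hat_ge0.
  - by rewrite lee_fin mulr_ge0 ?sqr_ge0 ?invr_ge0.
have I2 : (\int[mm]_z (2^-1 * h z.2 ^+ 2 * gaussn_hat e (tuple_sub z.1 z.2))%:E =
    (2^-1)%:E * (((2 * pi) ^+ n)%:E * \int[m]_xi (h xi ^+ 2)%:E))%E.
  rewrite -intq.
  rewrite [LHS](@fubini_tonelli2 _ _ T T R m m (fun z => (2^-1 * h z.2 ^+ 2 * gaussn_hat e (tuple_sub z.1 z.2))%:E)); last 2 first.
  - by apply/measurable_EFinP.
  - by move=> z; rewrite lee_fin.
  apply: eq_integral => x _; rewrite /fubini_G /=.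
  under eq_integral do rewrite EFinM.
  rewrite ge0_integralZl ?integral_gaussn_hat_subl//.
  - apply/measurable_EFinP.
    exact: (measurableT_comp mhat (measurable_fun_pair (@measurable_id _ T setT) (measurable_cst x))).
  - by move=> y _; rewrite lee_fin gaussn_hat_ge0.
  - by rewrite lee_fin mulr_ge0 ?sqr_ge0 ?invr_ge0.
rewrite (_ : (_ + _)%E = ((2^-1)%:E * (((2 * pi) ^+ n)%:E * \int[m]_xi (h xi ^+ 2)%:E) +
  (2^-1)%:E * (((2 * pi) ^+ n)%:E * \int[m]_xi (h xi ^+ 2)%:E))%E); last first.
  by congr (_ + _)%E; [exact: I1|exact: I2].
rewrite -ge0_muleDl ?lee_fin ?invr_ge0// -EFinD.
by rewrite (_ : 2^-1 + 2^-1 = 1) ?mul1e//; field.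
Qed.

(** The bound with a Gaussian factor is uniform in its parameter; as the parameter decreases to 0
    the factor increases to 1, and monotone convergence removes it. *)
Lemma bessel h : m.-integrable setT (EFin \o h) ->
  (\int[m]_x (energyT h x)%:E <=
   ((2 * pi) ^+ n)%:E * \int[m]_xi (h xi ^+ 2)%:E)%E.
Proof.
move=> inth.
have /measurable_EFinP mh := measurable_int _ inth.
pose g k x := (gaussn k.+1%:R^-1 x * energyT h x)%:E.
have mg k : measurable_fun setT (g k).
  apply/measurable_EFinP; apply: measurable_funM; first exact: measurable_gaussn.
  exact: measurable_energyT.
have g0 k x : setT x -> (0 <= g k x)%E.
  by move=> _; rewrite lee_fin mulr_ge0 ?gaussn_ge0 ?energyT_ge0.
have ndg x : setT x -> {homo g^~ x : i j / (i <= j)%N >-> (i <= j)%E}.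
  move=> _ i j ij; rewrite lee_fin ler_wpM2r ?energyT_ge0//.
  apply: ler_prod => l _; rewrite gauss_ge0 /gauss ler_expR lerN2 ler_pM2r ?invr_gt0//.
  rewrite !exprMn ler_wpM2r ?sqr_ge0// lerXn2r ?nnegrE ?invr_ge0//.
  by rewrite lef_pV2 ?posrE ?ltr0n// ler_nat.
have cvgg x : g ^~ x @ \oo --> (energyT h x)%:E.
  apply: cvg_EFin; first exact: nearW.
  rewrite -[X in _ --> X]mul1r; apply: cvgMl.
  rewrite [X in _ --> X](_ : 1 = \prod_(i < n) 1); last by rewrite big1.
  apply: cvg_big => [|i _]; first exact: mul_continuous.
  rewrite (_ : (fun k => _) = (fun k => gauss (tnth x i) k.+1%:R^-1)); last first.
    by apply/funext => k; congr (expR (- (_ ^+ 2 / 2))); exact: mulrC.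
  rewrite [X in _ --> X](_ : 1 = gauss (tnth x i) 0); last first.
    by rewrite /gauss mulr0 expr0n/= mul0r oppr0 expR0.
  have H : (gauss (tnth x i) \o harmonic) @ \oo --> gauss (tnth x i) 0.
    by apply: cvg_comp; [exact: cvg_harmonic|exact: continuous_gauss].
  exact: H.
have := @cvg_monotone_convergence _ _ R m setT measurableT g mg g0 ndg.
rewrite (_ : (fun x => limn (g ^~ x)) = EFin \o energyT h); last first.
  by apply/funext => x; apply/cvg_lim => //; exact: cvgg.
move=> cvgI; rewrite -(cvg_lim _ cvgI)//; apply: lime_le; first by apply/cvg_ex; eexists; exact: cvgI.
by apply: nearW => k; apply: bessel_gaussn => //; rewrite invr_gt0.
Qed.

End bessel.

(** * Maximal estimates in time *)

Lemma weighted_cauchy_schwarz (R : realFieldType) (a b : nat -> R) (P : nat) :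
  (forall p, 0 <= a p) ->
  (\sum_(p < P) a p * b p) ^+ 2 <=
  (\sum_(p < P) a p) * (\sum_(p < P) a p * b p ^+ 2).
Proof.
move=> a0; elim: P => [|P ih]; first by rewrite !big_ord0 mul0r expr0n.
rewrite !big_ord_recr/=.
set A := \sum_(p < P) a p * b p in ih *; set S := \sum_(p < P) a p in ih *.
set Q := \sum_(p < P) a p * b p ^+ 2 in ih *.
have S0 : 0 <= S by exact: sumr_ge0.
have Q0 : 0 <= Q by apply: sumr_ge0 => p _; rewrite mulr_ge0 ?sqr_ge0.
(* Only the cross term of the new square is at stake. It follows from the induction hypothesis by
   completing the square after multiplication by [S], which requires [S] to be positive; [S = 0]
   forces [A = 0]. *)
suff H : 2 * A * b P <= S * b P ^+ 2 + Q by have := a0 P; nra.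
have [S00|Sn0] := eqVneq S 0.
  have /eqP : A ^+ 2 = 0 by apply/eqP; rewrite eq_le sqr_ge0 andbT; move: ih; rewrite S00 mul0r.
  by rewrite sqrf_eq0 => /eqP ->; rewrite S00 !(mulr0, mul0r) add0r.
have Sp : 0 < S by rewrite lt_neqAle eq_sym Sn0.
rewrite -(ler_pM2l Sp).
by have := sqr_ge0 (S * b P - A); nra.
Qed.

Section trig_series.
Context {R : realType}.

(* [F x = \sum_p k p * x^p / p!] with bounded coefficients; it covers both
   [cos] and [sin] *)
Definition bounded_exp_series (F : R -> R) (k : nat -> R) :=
  (forall p, `|k p| <= 1) /\
  (forall x, series (fun p => k p * exp_coeff x p) @ \oo --> F x).

Lemma cos_bounded_exp_series :
  bounded_exp_series cos (fun p => (~~ odd p)%:R * (-1) ^+ p./2).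
Proof.
split=> [p|x].
  by rewrite normrM normrX normrN1 expr1n mulr1; case: odd; rewrite ?normr0 ?normr1.
have := @is_cvg_series_cos_coeff R x; rewrite unlock.
by rewrite (_ : (fun p => _) = cos_coeff x)//; apply/funext => p; rewrite /exp_coeff /cos_coeff/= mulrA.
Qed.

Lemma sin_bounded_exp_series :
  bounded_exp_series sin (fun p => (odd p)%:R * (-1) ^+ p.-1./2).
Proof.
split=> [p|x].
  by rewrite normrM normrX normrN1 expr1n mulr1; case: odd; rewrite ?normr0 ?normr1.
have := @is_cvg_series_sin_coeff R x; rewrite unlock.
by rewrite (_ : (fun p => _) = sin_coeff x)//; apply/funext => p; rewrite /exp_coeff /sin_coeff/= mulrA.
Qed.

Lemma bounded_exp_series_opp F k :
  bounded_exp_series F k -> bounded_exp_series (fun x => - F x) (fun p => - k p).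
Proof.
move=> [k1 cF]; split=> [p|x]; first by rewrite normrN.
rewrite (_ : series _ = fun N => - series (fun p => k p * exp_coeff x p) N).
  exact: cvgN.
apply/funext => N; rewrite /series/= -sumrN.
by apply: eq_bigr => p _; rewrite mulNr.
Qed.

Lemma series_exp_coeff_le (C : R) P : 0 <= C -> series (exp_coeff C) P <= expR C.
Proof.
move=> C0; apply: nondecreasing_cvgn_le; last exact: is_cvg_series_exp_coeff.
by apply: nondecreasing_series => p _ _; exact: exp_coeff_ge0.
Qed.

Context d (T : measurableType d) (mu : {measure set T -> \bar R}).
Variables (g lam : T -> R).
Hypothesis intg : mu.-integrable setT (EFin \o g).
Hypothesis mlam : measurable_fun setT lam.
Hypothesis lam1 : forall x, `|lam x| <= 1.

Lemma integrable_mulX p : mu.-integrable setT (EFin \o (fun x => g x * lam x ^+ p)).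
Proof.
apply: (@integrableMr_bounded _ _ _ _ _ _ _ 1) => //; first exact: measurable_funX.
by move=> x _; rewrite normrX exprn_ile1.
Qed.

(** Since [|lam| <= 1], the partial sums are dominated by [|g| * expR |c|], so that the series is
    integrated term by term. This separates [c] from the moments of [lam]. *)
Lemma cvg_integral_exp_series F k (c : R) : bounded_exp_series F k ->
  series (fun p => k p * exp_coeff c p * \int[mu]_x (g x * lam x ^+ p)) @ \oo -->
  \int[mu]_x (g x * F (c * lam x)).
Proof.
move=> [k1 cF].
have /measurable_EFinP mg := measurable_int _ intg.
pose f_ N x := g x * series (fun p => k p * exp_coeff (c * lam x) p) N.
have fE N : f_ N = fun x => \sum_(0 <= p < N) (k p * exp_coeff c p * (g x * lam x ^+ p)).
  apply/funext => x; rewrite /f_ /series/= mulr_sumr; apply: eq_bigr => p _.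
  by rewrite /exp_coeff/= exprMn; ring.
have mf_ N : measurable_fun setT (f_ N).
  rewrite fE; apply: measurable_sum => p; apply: measurable_funM => //.
  by apply: measurable_funM => //; exact: measurable_funX.
have [] := @dominated_cvg_Rintegral _ _ R mu setT f_ (fun x => g x * F (c * lam x))
  (fun x => `|g x| * expR `|c|) measurableT mf_.
- by move=> x _; apply: cvgM; [exact: cvg_cst|exact: cF].
- rewrite [X in _.-integrable _ X](_ : _ = (fun x => (expR `|c|)%:E * `|g x|%:E)%E).
    by apply: integrableZl => //; exact: integrable_norm.
  by apply/funext => x /=; rewrite mulrC EFinM.
- move=> N x _; rewrite normrM ler_wpM2l//.
  apply: (le_trans (ler_norm_sum _ _ _)).
  apply: le_trans (series_exp_coeff_le N (normr_ge0 c)).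
  rewrite /series/=; apply: ler_sum => p _.
  rewrite normrM /exp_coeff/= normrM normfV (ger0_norm (ler0n _ _)) normrX.
  rewrite -[leRHS]mul1r ler_pM// ler_wpM2r ?invr_ge0// lerXn2r ?nnegrE//.
  by rewrite normrM ler_piMr.
move=> _; rewrite (_ : (fun N => _) = series (fun p => k p * exp_coeff c p * \int[mu]_x (g x * lam x ^+ p)))//.
apply/funext => N; rewrite fE /series/=.
rewrite Rintegral_sum_nat//; last first.
  by move=> p; apply: integrable_mull => //; exact: integrable_mulX.
by apply: eq_bigr => p _; rewrite RintegralZl//; exact: integrable_mulX.
Qed.

End trig_series.

Section trig_sup.
Context {R : realType} d (T : measurableType d) (mu : {measure set T -> \bar R}).
Variables (g1 g2 lam : T -> R).
Hypothesis intg1 : mu.-integrable setT (EFin \o g1).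
Hypothesis intg2 : mu.-integrable setT (EFin \o g2).
Hypothesis mlam : measurable_fun setT lam.
Hypothesis lam1 : forall x, `|lam x| <= 1.

(** Replacing [|c|] by [C] in the coefficients makes the bound independent of [c]. Cauchy-Schwarz
    with the weights [exp_coeff C p], of total mass at most [expR C], brings the square inside the
    sum over [p]. *)
Lemma sqr_integral_exp_series_le F1 F2 k1 k2 (c C : R) :
  bounded_exp_series F1 k1 -> bounded_exp_series F2 k2 -> `|c| <= C ->
  (((\int[mu]_x (g1 x * F1 (c * lam x)) + \int[mu]_x (g2 x * F2 (c * lam x))) ^+ 2)%:E <=
  (expR C)%:E * \sum_(0 <= p <oo) (exp_coeff C p *
    (`|\int[mu]_x (g1 x * lam x ^+ p)| + `|\int[mu]_x (g2 x * lam x ^+ p)|) ^+ 2)%:E)%E.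
Proof.
move=> F1k F2k cC.
have C0 : 0 <= C by exact: le_trans cC.
have cv1 := @cvg_integral_exp_series R _ T mu g1 lam intg1 mlam lam1 F1 k1 c F1k.
have cv2 := @cvg_integral_exp_series R _ T mu g2 lam intg2 mlam lam1 F2 k2 c F2k.
pose b p : R := `|\int[mu]_x (g1 x * lam x ^+ p)| + `|\int[mu]_x (g2 x * lam x ^+ p)|.
rewrite -/b; set l := _ + _.
pose S (P : nat) : R := series (fun p => k1 p * exp_coeff c p * \int[mu]_x (g1 x * lam x ^+ p)) P +
  series (fun p => k2 p * exp_coeff c p * \int[mu]_x (g2 x * lam x ^+ p)) P.
have cvS : S P @[P --> \oo] --> l by exact: cvgD.
have cv22 : (S P ^+ 2)%:E @[P --> \oo] --> (l ^+ 2)%:E.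
  by apply: cvg_EFin; [exact: nearW|exact: cvgM].
rewrite -(cvg_lim _ cv22)//; apply: lime_le; first by apply/cvg_ex; eexists; exact: cv22.
apply: nearW => P.
have b0 p : 0 <= b p by rewrite addr_ge0.
apply: (@le_trans _ _ ((expR C)%:E * \sum_(0 <= p < P) (exp_coeff C p * b p ^+ 2)%:E)%E); last first.
  rewrite lee_pmul2l ?lte_fin ?expR_gt0//.
  apply: nneseries_lim_ge => p _ _; rewrite lee_fin mulr_ge0 ?sqr_ge0//.
  exact: exp_coeff_ge0.
rewrite sumEFin -EFinM lee_fin.
apply: (@le_trans _ _ ((\sum_(p < P) exp_coeff C p * b p) ^+ 2)).
  rewrite -real_normK ?num_real//.
  rewrite lerXn2r ?nnegrE//.
    by apply: sumr_ge0 => p _; rewrite mulr_ge0// exp_coeff_ge0.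
  rewrite /S /series/= -big_split/= big_mkord.
  apply: (le_trans (ler_norm_sum _ _ _)); apply: ler_sum => p _.
  have cp : `|exp_coeff c p| <= exp_coeff C p.
    rewrite /exp_coeff/= normrM normfV normrX (ger0_norm (ler0n _ _)).
    by rewrite ler_wpM2r ?invr_ge0// lerXn2r ?nnegrE.
  rewrite /b mulrDr; apply: (le_trans (ler_normD _ _)); apply: lerD.
    rewrite normrM ler_wpM2r// normrM -[leRHS]mul1r ler_pM//; exact: F1k.1.
  rewrite normrM ler_wpM2r// normrM -[leRHS]mul1r ler_pM//; exact: F2k.1.
apply: (le_trans (weighted_cauchy_schwarz _ _ _)); first by move=> p; exact: exp_coeff_ge0.
rewrite !big_mkord ler_wpM2r//.
  by apply: sumr_ge0 => p _; rewrite mulr_ge0 ?sqr_ge0// exp_coeff_ge0.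
by have := series_exp_coeff_le P C0; rewrite /series/= big_mkord.
Qed.

End trig_sup.

(** * Majorants of oscillatory integrals, uniform in a bounded phase *)

Section wave.
Context {R : realType} {n : nat}.
Notation T := (n.-tuple R).
Notation m := (@lebesgue_tuple R n).
Implicit Types (H F mu lam theta : T -> R) (x xi : T) (c C L t : R).

(* Real and imaginary parts of [int e^(i (xi.x + theta xi)) (F1 + i F2) dxi] *)
Definition waveRe F1 F2 theta x : R :=
  \int[m]_xi (F1 xi * cos (tuple_dot xi x + theta xi) - F2 xi * sin (tuple_dot xi x + theta xi)).
Definition waveIm F1 F2 theta x : R :=
  \int[m]_xi (F1 xi * sin (tuple_dot xi x + theta xi) + F2 xi * cos (tuple_dot xi x + theta xi)).
Definition wave2 F1 F2 theta x : R :=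
  waveRe F1 F2 theta x ^+ 2 + waveIm F1 F2 theta x ^+ 2.

(** The factor 8 is 2 * 4: a factor 2 for the real and imaginary parts, and 4 for the four Fourier
    integrals into which the two moments of order [p] split. *)
Definition waveB C H1 H2 lam x : \bar R :=
  ((8 * expR C)%:E * \sum_(0 <= p <oo) (exp_coeff C p *
    (energyT (fun xi => H1 xi * lam xi ^+ p) x +
     energyT (fun xi => H2 xi * lam xi ^+ p) x))%:E)%E.

Section fixed.
Variables (H1 H2 lam : T -> R) (C : R).
Hypothesis intH1 : m.-integrable setT (EFin \o H1).
Hypothesis intH2 : m.-integrable setT (EFin \o H2).
Hypothesis mlam : measurable_fun setT lam.
Hypothesis lam1 : forall x, `|lam x| <= 1.
Hypothesis C0 : 0 <= C.

Let mH1 : measurable_fun setT H1.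
Proof. by have /measurable_EFinP := measurable_int _ intH1. Qed.

Let mH2 : measurable_fun setT H2.
Proof. by have /measurable_EFinP := measurable_int _ intH2. Qed.

Let mHl p : measurable_fun setT (fun xi => H1 xi * lam xi ^+ p).
Proof. by apply: measurable_funM => //; exact: measurable_funX. Qed.

Let mHl2 p : measurable_fun setT (fun xi => H2 xi * lam xi ^+ p).
Proof. by apply: measurable_funM => //; exact: measurable_funX. Qed.

Let term_ge0 p x : (0 <= (exp_coeff C p *
    (energyT (fun xi => H1 xi * lam xi ^+ p) x +
     energyT (fun xi => H2 xi * lam xi ^+ p) x))%:E)%E.
Proof.
rewrite lee_fin; apply: mulr_ge0; first exact: exp_coeff_ge0.
by rewrite addr_ge0 ?energyT_ge0.
Qed.

Let mterm p : measurable_fun setT (fun x => (exp_coeff C p *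
    (energyT (fun xi => H1 xi * lam xi ^+ p) x +
     energyT (fun xi => H2 xi * lam xi ^+ p) x))%:E).
Proof.
apply/measurable_EFinP; apply: measurable_funM => //.
by apply: measurable_funD; exact: measurable_energyT.
Qed.

Lemma measurable_waveB : measurable_fun setT (waveB C H1 H2 lam).
Proof.
by apply: measurable_funeM; apply: measurable_nneseries => [p x|p]; [exact: term_ge0|exact: mterm].
Qed.

Lemma waveB_ge0 x : (0 <= waveB C H1 H2 lam x)%E.
Proof.
apply: mule_ge0; first by rewrite lee_fin mulr_ge0 ?expR_ge0.
by apply: nneseries_ge0 => p _ _; exact: term_ge0.
Qed.

(** Bessel's inequality term by term: [|lam| <= 1] keeps each [H * lam ^+ p] below [H] in L^2, and
    the weights sum to at most [expR C], whence the second exponential. *)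
Lemma integral_waveB :
  (\int[m]_x waveB C H1 H2 lam x <=
   (8 * expR C * expR C * (2 * pi) ^+ n)%:E * \int[m]_xi (H1 xi ^+ 2 + H2 xi ^+ 2)%:E)%E.
Proof.
pose S x := (\sum_(0 <= p <oo) (exp_coeff C p *
    (energyT (fun xi => H1 xi * lam xi ^+ p) x +
     energyT (fun xi => H2 xi * lam xi ^+ p) x))%:E)%E.
have mS : measurable_fun setT S.
  by apply: measurable_nneseries => [p x|p]; [exact: term_ge0|exact: mterm].
rewrite (_ : waveB C H1 H2 lam = fun x => ((8 * expR C)%:E * S x)%E)//.
rewrite ge0_integralZl//; last first.
  by move=> x _; apply: nneseries_ge0 => p _ _; exact: term_ge0.
rewrite /S; set I := (\int[m]_xi (H1 xi ^+ 2 + H2 xi ^+ 2)%:E)%E.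
have I0 : (0 <= I)%E by apply: integral_ge0 => x _; rewrite lee_fin addr_ge0 ?sqr_ge0.
have P0 : 0 <= (2 * pi) ^+ n :> R by rewrite exprn_ge0// mulr_ge0// pi_ge0.
rewrite integral_nneseries//.
have besselp (H : T -> R) p : m.-integrable setT (EFin \o H) -> measurable_fun setT H ->
    (\int[m]_x (energyT (fun xi => (H xi * lam xi ^+ p)%R) x)%:E <=
     ((2 * pi) ^+ n)%:E * \int[m]_xi (H xi ^+ 2)%:E)%E.
  move=> iH mH; apply: (le_trans (bessel _)); first exact: integrable_mulX.
  apply: lee_wpmul2l; first by rewrite lee_fin exprn_ge0// mulr_ge0// pi_ge0.
  apply: ge0_le_integral => //.
  - by move=> x _; rewrite lee_fin sqr_ge0.
  - apply/measurable_EFinP; apply: measurable_funX; apply: measurable_funM => //; exact: measurable_funX.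
  - by apply/measurable_EFinP; exact: measurable_funX.
  - move=> x _; rewrite lee_fin exprMn ler_piMr ?sqr_ge0// -exprM mulnC exprM.
    by rewrite exprn_ile1 ?sqr_ge0// -real_normK ?num_real// exprn_ile1.
have H p : (\int[m]_x (exp_coeff C p *
    (energyT (fun xi => H1 xi * lam xi ^+ p) x +
     energyT (fun xi => H2 xi * lam xi ^+ p) x))%:E <= (exp_coeff C p)%:E * (((2 * pi) ^+ n)%:E * I))%E.
  under eq_integral do rewrite EFinM EFinD.
  rewrite ge0_integralZl//; last 3 first.
  - by apply: emeasurable_funD; apply/measurable_EFinP; exact: measurable_energyT.
  - by move=> x _; rewrite adde_ge0// lee_fin energyT_ge0.
  - by rewrite lee_fin exp_coeff_ge0.
  apply: lee_wpmul2l; first by rewrite lee_fin exp_coeff_ge0.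
  rewrite ge0_integralD//; last 4 first.
  - by move=> x _; rewrite lee_fin energyT_ge0.
  - by apply/measurable_EFinP; exact: measurable_energyT.
  - by move=> x _; rewrite lee_fin energyT_ge0.
  - by apply/measurable_EFinP; exact: measurable_energyT.
  apply: (@le_trans _ _ (((2 * pi) ^+ n)%:E * \int[m]_xi (H1 xi ^+ 2)%:E +
      ((2 * pi) ^+ n)%:E * \int[m]_xi (H2 xi ^+ 2)%:E)%E).
    by apply: leeD; exact: besselp.
  rewrite -ge0_muleDr; last 2 first.
  - by apply: integral_ge0 => x _; rewrite lee_fin sqr_ge0.
  - by apply: integral_ge0 => x _; rewrite lee_fin sqr_ge0.
  rewrite /I; under [in leRHS]eq_integral do rewrite EFinD.
  rewrite ge0_integralD//; try by move=> x _; rewrite lee_fin sqr_ge0.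
  - by apply/measurable_EFinP; exact: measurable_funX.
  - by apply/measurable_EFinP; exact: measurable_funX.
apply: (@le_trans _ _ ((8 * expR C)%:E * ((expR C)%:E * (((2 * pi) ^+ n)%:E * I)))%E); last first.
  by rewrite !muleA -!EFinM.
apply: lee_wpmul2l; first by rewrite lee_fin mulr_ge0 ?expR_ge0.
apply: lime_le; first by apply: is_cvg_nneseries => p _ _; apply: integral_ge0.
apply: nearW => N.
apply: (@le_trans _ _ (\sum_(0 <= p < N) (exp_coeff C p)%:E * (((2 * pi) ^+ n)%:E * I))%E).
  by apply: lee_sum => p _; exact: H.
rewrite -ge0_sume_distrl; last by move=> p _; rewrite lee_fin exp_coeff_ge0.
rewrite sumEFin; apply: lee_wpmul2r; first by rewrite mule_ge0// lee_fin.
rewrite lee_fin; exact: series_exp_coeff_le.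
Qed.

(** For fixed [x] the factor of phase [tuple_dot xi x] is absorbed in the amplitude, giving
    [g1 + i g2], and only the phase [c * lam] is expanded. The moments of [g1] and [g2] are
    combinations of Fourier integrals at [x] of [H1 * lam ^+ p] and [H2 * lam ^+ p]. *)
Lemma wave_sup c x : `|c| <= C ->
  ((wave2 H1 H2 (fun xi => c * lam xi) x)%:E <= waveB C H1 H2 lam x)%E.
Proof.
move=> cC.
pose g1 xi := H1 xi * cos (tuple_dot xi x) - H2 xi * sin (tuple_dot xi x).
pose g2 xi := H1 xi * sin (tuple_dot xi x) + H2 xi * cos (tuple_dot xi x).
have intg1 : m.-integrable setT (EFin \o g1).
  by apply: integrable_subR => //; [exact: integrable_cosT|exact: integrable_sinT].
have intg2 : m.-integrable setT (EFin \o g2).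
  by apply: integrable_addR => //; [exact: integrable_sinT|exact: integrable_cosT].
have intF g (F : R -> R) : m.-integrable setT (EFin \o g) ->
    continuous F -> (forall y, `|F y| <= 1) ->
    m.-integrable setT (EFin \o (fun xi => g xi * F (c * lam xi))).
  move=> intg cF F1; apply: (@integrableMr_bounded _ _ _ _ _ _ _ 1) => //.
  apply: (measurableT_comp (continuous_measurable_fun cF)).
  exact: measurable_funM.
have cos1 := @normr_cos_le1 R.
have sin1 := @normr_sin_le1 R.
have reE : waveRe H1 H2 (fun xi => c * lam xi) x =
    \int[m]_xi (g1 xi * cos (c * lam xi)) + \int[m]_xi (g2 xi * - sin (c * lam xi)).
  rewrite -RintegralD//; last 2 first.
  - exact: (intF _ _ intg1 (@continuous_cos R)).
  - apply: (intF _ (fun y => - sin y) intg2).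
      by move=> y; apply: cvgN; exact: continuous_sin.
    by move=> y; rewrite normrN.
  by congr Rintegral; apply/funext => xi; rewrite /g1 /g2 cosD sinD; ring.
have imE : waveIm H1 H2 (fun xi => c * lam xi) x =
    \int[m]_xi (g1 xi * sin (c * lam xi)) + \int[m]_xi (g2 xi * cos (c * lam xi)).
  rewrite -RintegralD//; last 2 first.
  - exact: (intF _ _ intg1 (@continuous_sin R)).
  - exact: (intF _ _ intg2 (@continuous_cos R)).
  by congr Rintegral; apply/funext => xi; rewrite /g1 /g2 cosD sinD; ring.
have reB := sqr_integral_exp_series_le intg1 intg2 mlam lam1
  (@cos_bounded_exp_series R) (bounded_exp_series_opp (@sin_bounded_exp_series R)) cC.
have imB := sqr_integral_exp_series_le intg1 intg2 mlam lam1
  (@sin_bounded_exp_series R) (@cos_bounded_exp_series R) cC.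
rewrite /wave2 reE imE EFinD; apply: (le_trans (leeD reB imB)).
pose a p := (exp_coeff C p * (`|\int[m]_xi (g1 xi * lam xi ^+ p)| + `|\int[m]_xi (g2 xi * lam xi ^+ p)|) ^+ 2)%:E.
pose e p := (exp_coeff C p *
    (energyT (fun xi => H1 xi * lam xi ^+ p) x +
     energyT (fun xi => H2 xi * lam xi ^+ p) x))%:E.
have ae p : (a p <= 4%:E * e p)%E.
  rewrite -EFinM lee_fin [leRHS]mulrCA; apply: ler_wpM2l; first exact: exp_coeff_ge0.
  have l1 := integrable_mulX intH1 mlam lam1 p.
  have l2 := integrable_mulX intH2 mlam lam1 p.
  have g1E : \int[m]_xi (g1 xi * lam xi ^+ p) =
      cosT (fun xi => H1 xi * lam xi ^+ p) x - sinT (fun xi => H2 xi * lam xi ^+ p) x.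
    rewrite /cosT /sinT -RintegralB//; [|exact: integrable_cosT|exact: integrable_sinT].
    by congr Rintegral; apply/funext => xi; rewrite /g1; ring.
  have g2E : \int[m]_xi (g2 xi * lam xi ^+ p) =
      sinT (fun xi => H1 xi * lam xi ^+ p) x + cosT (fun xi => H2 xi * lam xi ^+ p) x.
    rewrite /cosT /sinT -RintegralD//; [|exact: integrable_sinT|exact: integrable_cosT].
    by congr Rintegral; apply/funext => xi; rewrite /g2; ring.
  rewrite g1E g2E /energyT.
  set A := cosT _ _; set B := sinT _ _; set D := sinT _ _; set E := cosT _ _.
  have := sqr_ge0 (`|A - B| - `|D + E|); have := real_normK (num_real (A - B)).
  have := real_normK (num_real (D + E)); have := sqr_ge0 (A + B); have := sqr_ge0 (D - E).
  by nra.
rewrite /waveB -/(e _).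
have -> : (\sum_(0 <= p <oo) (exp_coeff C p *
    (energyT (fun xi => H1 xi * lam xi ^+ p) x +
     energyT (fun xi => H2 xi * lam xi ^+ p) x))%:E = \sum_(0 <= p <oo) e p)%E by [].
rewrite -/(\sum_(0 <= p <oo) a p)%E.
have sumae : (\sum_(0 <= p <oo) a p <= 4%:E * \sum_(0 <= p <oo) e p)%E.
  rewrite -nneseriesZl//; last by move=> p _; exact: term_ge0.
  apply: lee_nneseries => p _; last exact: ae.
  by rewrite lee_fin mulr_ge0 ?sqr_ge0// exp_coeff_ge0.
have sume0 : (0 <= \sum_(0 <= p <oo) e p)%E by apply: nneseries_ge0 => p _ _; exact: term_ge0.
have -> : ((8 * expR C)%:E = (expR C)%:E * 4%:E + (expR C)%:E * 4%:E)%E.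
  by rewrite -!EFinM -EFinD; congr EFin; ring.
rewrite ge0_muleDl ?lee_fin ?mulr_ge0 ?expR_ge0// -muleA.
by apply: leeD; apply: lee_wpmul2l => //; rewrite lee_fin expR_ge0.
Qed.

End fixed.
End wave.

Section wave_local.
Context {R : realType} {n : nat}.
Notation T := (n.-tuple R).
Notation m := (@lebesgue_tuple R n).
Variables (F1 F2 mu : T -> R) (L C : R).
Hypothesis intF1 : m.-integrable setT (EFin \o F1).
Hypothesis intF2 : m.-integrable setT (EFin \o F2).
Hypothesis mmu : measurable_fun setT mu.
Hypothesis mu0 : forall xi, 0 <= mu xi.
Hypothesis L0 : 0 < L.
Hypothesis C0 : 0 <= C.

(* [e^(i c mu) (F1 + i F2)] and the normalised frequency *)
Definition rotRe (c : R) xi := F1 xi * cos (c * mu xi) - F2 xi * sin (c * mu xi).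
Definition rotIm (c : R) xi := F1 xi * sin (c * mu xi) + F2 xi * cos (c * mu xi).
Definition cap xi := Num.min 1 (mu xi / L).

Definition localB (c : R) x : \bar R := waveB C (rotRe c) (rotIm c) cap x.

Let cap1 xi : `|cap xi| <= 1.
Proof.
rewrite ger0_norm /cap ?ge_min ?lexx// le_min ler01/=.
by rewrite divr_ge0// ltW.
Qed.

Let mcap : measurable_fun setT cap.
Proof. by apply: measurable_minr => //; exact: measurable_funM. Qed.

Let mtrig (f : R -> R) c : continuous f -> measurable_fun setT (fun xi => f (c * mu xi)).
Proof.
move=> cf; apply: (measurableT_comp (continuous_measurable_fun cf)).
exact: measurable_funM.
Qed.

Let int_trig F (f : R -> R) c : continuous f -> (forall y, `|f y| <= 1) ->
  m.-integrable setT (EFin \o F) -> m.-integrable setT (EFin \o (fun xi => F xi * f (c * mu xi))).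
Proof.
move=> cf f1 intF; apply: (@integrableMr_bounded _ _ _ _ _ _ _ 1) => //.
exact: mtrig.
Qed.

Let cos1 := @normr_cos_le1 R.
Let sin1 := @normr_sin_le1 R.

Let int_rotRe c : m.-integrable setT (EFin \o rotRe c).
Proof.
apply: integrable_subR => //; apply: int_trig => //; first exact: continuous_cos.
exact: continuous_sin.
Qed.

Let int_rotIm c : m.-integrable setT (EFin \o rotIm c).
Proof.
apply: integrable_addR => //; apply: int_trig => //; first exact: continuous_sin.
exact: continuous_cos.
Qed.

Lemma localB_ge0 c x : (0 <= localB c x)%E.
Proof. exact: waveB_ge0. Qed.

Lemma measurable_localB c : measurable_fun setT (localB c).
Proof. exact: measurable_waveB. Qed.

Lemma integral_localB c :
  (\int[m]_x localB c x <=
   (8 * expR C * expR C * (2 * pi) ^+ n)%:E * \int[m]_xi (F1 xi ^+ 2 + F2 xi ^+ 2)%:E)%E.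
Proof.
apply: (le_trans (integral_waveB _ _ _ _ _)) => //.
rewrite le_eqVlt; apply/orP; left; apply/eqP; congr (_ * _)%E.
apply: eq_integral => xi _; congr EFin; rewrite /rotRe /rotIm.
transitivity ((F1 xi ^+ 2 + F2 xi ^+ 2) * (cos (c * mu xi) ^+ 2 + sin (c * mu xi) ^+ 2)); first by ring.
by rewrite cos2Dsin2 mulr1.
Qed.

(** The rotation by [c * mu] goes into the amplitude, so that only [t - c] is expanded, with phase
    [(t - c) * L] times the normalised frequency. Truncating the latter at 1 changes it only where
    [L < mu xi], and there the amplitude vanishes. *)
Lemma wave_local_sup c t x :
  (forall xi, L < mu xi -> F1 xi = 0 /\ F2 xi = 0) -> `|t - c| * L <= C ->
  ((wave2 F1 F2 (fun xi => t * mu xi) x)%:E <= localB c x)%E.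
Proof.
move=> F0 tcC.
have -> : wave2 F1 F2 (fun xi => t * mu xi) x =
    wave2 (rotRe c) (rotIm c) (fun xi => (t - c) * L * cap xi) x.
  have capE xi : L < mu xi \/ (t - c) * L * cap xi = t * mu xi - c * mu xi.
    have [H|H] := ltP L (mu xi); [by left|right].
    rewrite /cap (elimT min_idPr); last by rewrite ler_pdivrMr// mul1r.
    by rewrite mulrCA mulrC mulrBl; field; rewrite gt_eqF.
  rewrite /wave2 /waveRe /waveIm; congr (_ ^+ 2 + _ ^+ 2); congr Rintegral; apply/funext => xi.
    have [/F0[F10 F20]|->] := capE xi; first by rewrite /rotRe /rotIm F10 F20 !mul0r !(subr0, addr0, mul0r).
    rewrite /rotRe /rotIm -{1 2}[t * mu xi](subrK (c * mu xi)) !addrA.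
    by rewrite [cos (_ + c * mu xi)]cosD [sin (_ + c * mu xi)]sinD; ring.
  have [/F0[F10 F20]|->] := capE xi; first by rewrite /rotRe /rotIm F10 F20 !mul0r !(subr0, addr0, mul0r).
  rewrite /rotRe /rotIm -{1 2}[t * mu xi](subrK (c * mu xi)) !addrA.
  by rewrite [cos (_ + c * mu xi)]cosD [sin (_ + c * mu xi)]sinD; ring.
apply: wave_sup => //.
by rewrite normrM (gtr0_norm L0).
Qed.

End wave_local.

(** * Dyadic chaining of increments *)

Section chaining.
Context {R : realType}.

(** The total of [q] over the unit steps between [i] and [i + 2 ^ L] and over the left halves of all
    dyadic subintervals: the pieces that can occur in the binary decomposition of an initial
    segment. *)
Fixpoint chainB (q : nat -> nat -> \bar R) (L i : nat) : \bar R :=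
  if L is L'.+1 then (chainB q L' i + chainB q L' (i + 2 ^ L') + q i (i + 2 ^ L')%N)%E
  else q i i.+1.

Lemma chainB_ge0 q L i : (forall i j, 0 <= q i j)%E -> (0 <= chainB q L i)%E.
Proof.
by move=> q0; elim: L i => [|L ih] i //=; rewrite !adde_ge0.
Qed.

(** An initial segment either stays in the left half, or consists of the left half followed by an
    initial segment of the right half. Thus at most one increment is used per level, and the
    constant is linear in the number of levels. *)
Lemma chaining (q : nat -> nat -> \bar R) (u v : nat -> R) (L i r : nat) :
  (forall i j, 0 <= q i j)%E ->
  (forall i j, (i <= j)%N -> (((u j - u i) ^+ 2 + (v j - v i) ^+ 2)%:E <= q i j)%E) ->
  (r <= 2 ^ L)%N ->
  (((u (i + r)%N - u i) ^+ 2 + (v (i + r)%N - v i) ^+ 2)%:E <=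
   (L.+1%:R)%:E * chainB q L i)%E.
Proof.
move=> q0 uvq; elim: L i r => [|L ih] i r.
  rewrite expn0 mul1e; case: r => [_|[_|//]].
    by rewrite addn0 !subrr expr0n/= addr0; exact: q0.
  by rewrite addn1; exact: uvq.
move=> rL; rewrite /=; set X := chainB q L i; set Y := chainB q L _; set Z := q i _.
have X0 : (0 <= X)%E by exact: chainB_ge0.
have Y0 : (0 <= Y)%E by exact: chainB_ge0.
have Z0 : (0 <= Z)%E by exact: q0.
have L20 : (0 <= (L.+2%:R)%:E :> \bar R)%E by rewrite lee_fin.
have [rL'|/ltnW rL'] := leqP r (2 ^ L).
  apply: (le_trans (ih _ _ rL')); rewrite -/X.
  apply: lee_pmul => //; first by rewrite lee_fin ler_nat.
  by rewrite -addeA leeDl// adde_ge0.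
have r'L : (r - 2 ^ L <= 2 ^ L)%N by rewrite leq_subLR addnn -mul2n -expnS.
have := ih (i + 2 ^ L)%N _ r'L; rewrite -/Y -addnA subnKC//.
have := uvq i (i + 2 ^ L)%N (leq_addr _ _); rewrite -/Z.
move: X0 Y0 Z0; case: X => [X| |]//; case: Y => [Y| |]//; case: Z => [Z| |]//; rewrite ?lee_fin;
  try by move=> *; rewrite ?(addye, addey)// gt0_muley ?leey// lte_fin.
move=> X0 Y0 Z0.
set a := u (i + r)%N; set b := u (i + 2 ^ L)%N; set c := u i.
set a' := v (i + r)%N; set b' := v (i + 2 ^ L)%N; set c' := v i.
move=> HZ HY.
have k0 : 0 < L.+1%:R :> R by rewrite ltr0n.
rewrite (_ : L.+2%:R = L.+1%:R + 1); last by rewrite natr1.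
set k := L.+1%:R in k0 HY *.
(* The weights are chosen so that the constant grows from [k] to [k + 1] only: the difference of the
   two sides is the square of [x - k * y], where [x] is the increment in the right half and [y] the
   one over the left half. *)
have split x y : k * (x + y) ^+ 2 <= (k + 1) * x ^+ 2 + k * (k + 1) * y ^+ 2.
  by have := sqr_ge0 (x - k * y); nra.
have E1 : a - c = (a - b) + (b - c) by ring.
have E2 : a' - c' = (a' - b') + (b' - c') by ring.
rewrite -(ler_pM2l k0) mulrDr {1}E1 {1}E2.
apply: (le_trans (lerD (split _ _) (split _ _))).
have k10 : 0 <= k + 1 by rewrite addr_ge0// ltW.
apply: (@le_trans _ _ ((k + 1) * (k * Y) + k * (k + 1) * Z)).
  have := ler_wpM2l k10 HY; have := ler_wpM2l (mulr_ge0 (ltW k0) k10) HZ.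
  by rewrite !mulrDr; lra.
by have := mulr_ge0 (mulr_ge0 (ltW k0) k10) X0; nra.
Qed.

Context d (T : measurableType d) (mu : {measure set T -> \bar R}).

Lemma measurable_chainB (q : nat -> nat -> T -> \bar R) L i :
  (forall i j, measurable_fun setT (q i j)) ->
  measurable_fun setT (fun x => chainB (fun i j => q i j x) L i).
Proof.
move=> mq; elim: L i => [|L ih] i //=.
by apply: emeasurable_funD => //; exact: emeasurable_funD.
Qed.

(** The bounds on the integrals add up over adjacent intervals, so that each of the [L.+1] levels
    contributes at most the total increment of [W]. Together with the factor in [chaining] this
    makes the cost quadratic in [L.+1]. *)
Lemma integral_chainB (q : nat -> nat -> T -> \bar R) (W : nat -> R) L i :
  (forall i j, measurable_fun setT (q i j)) -> (forall i j x, 0 <= q i j x)%E ->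
  (forall i j, (i <= j)%N -> \int[mu]_x q i j x <= (W j - W i)%:E)%E ->
  (forall i j, (i <= j)%N -> W i <= W j) ->
  (\int[mu]_x chainB (fun i j => q i j x) L i <=
   (L.+1%:R * (W (i + 2 ^ L)%N - W i))%:E)%E.
Proof.
move=> mq q0 qW Wnd; elim: L i => [|L ih] i /=.
  by rewrite expn0 mul1r addn1; exact: qW.
have cb0 j L' x : (0 <= chainB (fun i j => q i j x) L' j)%E by exact: chainB_ge0.
have mcb L' j := measurable_chainB L' j mq.
rewrite ge0_integralD//; last 2 first.
- by move=> x _; rewrite adde_ge0.
- exact: emeasurable_funD.
rewrite ge0_integralD//.
apply: (le_trans (leeD (leeD (ih _) (ih _)) (qW _ _ (leq_addr _ _)))).
rewrite -!EFinD lee_fin -addnA addnn -mul2n -expnS.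
rewrite (_ : L.+2%:R = L.+1%:R + 1 :> R); last by rewrite natr1.
have : W (i + 2 ^ L)%N <= W (i + 2 ^ L.+1)%N.
  by apply: Wnd; rewrite leq_add2l leq_exp2l.
lra.
Qed.

End chaining.

(** * Uniqueness of the Fourier transform *)

Section normal_box.
Context {R : realType}.
Notation mu := (@lebesgue_measure R).
Implicit Types (e a b x t delta : R).

(** The indicator of []a, b]] mollified at scale [e], as a function of [x]. *)
Definition normal_box e a b x : R :=
  \int[mu]_t (normal_pdf x e t * \1_(`]a, b]%classic) t).

Let integrable_normal_indic e x (A : set R) : measurable A ->
  mu.-integrable setT (EFin \o (fun t => normal_pdf x e t * \1_A t)).
Proof.
move=> mA; apply: (@integrableMr_bounded _ _ _ _ _ _ _ 1) => //.
- exact: integrable_normal_pdf.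
- by move=> t _; rewrite indicE; case: (_ \in _); rewrite ?normr1 ?normr0.
Qed.

Lemma normal_box_ge0 e a b x : 0 <= normal_box e a b x.
Proof. by apply: Rintegral_ge0 => t _; rewrite mulr_ge0 ?normal_pdf_ge0. Qed.

Lemma normal_box_le1 e a b x : normal_box e a b x <= 1.
Proof.
have -> : 1 = \int[mu]_t normal_pdf x e t :> R by rewrite /Rintegral integral_normal_pdf.
apply: le_Rintegral => //.
- exact: integrable_normal_indic.
- exact: integrable_normal_pdf.
- by move=> t _; rewrite ler_piMr ?normal_pdf_ge0.
Qed.

(** The standard deviation is [delta ^+ 2], so the distance [delta] amounts to [1 / delta]
    deviations. Half of the exponent is bounded through [delta <= |t - x|]; the other half is, up to
    the factor [Num.sqrt 2], a normal density of deviation [Num.sqrt 2 * delta ^+ 2], of integral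
    1. *)
Lemma normal_tail (x delta : R) (A : set R) : 0 < delta -> measurable A ->
  (forall t, A t -> delta <= `|t - x|) ->
  \int[mu]_t (normal_pdf x (delta ^+ 2) t * \1_A t) <=
  Num.sqrt 2 * expR (- (4 * delta ^+ 2)^-1).
Proof.
move=> d0 mA Ad.
pose e := delta ^+ 2; pose e' := Num.sqrt 2 * e.
have e0 : 0 < e by rewrite exprn_gt0.
have e'0 : 0 < e' by rewrite mulr_gt0// sqrtr_gt0.
have -> : Num.sqrt 2 * expR (- (4 * delta ^+ 2)^-1) =
    \int[mu]_t (Num.sqrt 2 * expR (- (4 * delta ^+ 2)^-1) * normal_pdf x e' t).
  rewrite RintegralZl//; last exact: integrable_normal_pdf.
  by rewrite /Rintegral integral_normal_pdf mulr1.
apply: le_Rintegral => //.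
- exact: integrable_normal_indic.
- by apply: integrable_mull => //; exact: integrable_normal_pdf.
move=> t _; rewrite indicE; case: (boolP (t \in A)); last first.
  by move=> _; rewrite mulr0 mulr_ge0 ?normal_pdf_ge0// mulr_ge0 ?expR_ge0.
rewrite inE => /Ad tx; rewrite mulr1 !normal_pdfE ?gt_eqF// /normal_peak /normal_fun.
have pi2 : 0 < 2 * pi :> R by rewrite mulr_gt0 ?pi_gt0.
have peakE s : 0 < s -> (Num.sqrt (s ^+ 2 * pi *+ 2))^-1 = s^-1 * (Num.sqrt (2 * pi))^-1 :> R.
  move=> s0; have -> : s ^+ 2 * pi *+ 2 = s ^+ 2 * (2 * pi) by ring.
  by rewrite (@sqrtrM _ (s ^+ 2)) ?sqr_ge0// sqrtr_sqr gtr0_norm// invfM.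
rewrite !peakE// /e'.
set q := Num.sqrt (2 * pi).
have s2 : 0 < Num.sqrt 2 :> R by rewrite sqrtr_gt0.
have -> : Num.sqrt 2 * expR (- (4 * delta ^+ 2)^-1) *
    ((Num.sqrt 2 * e)^-1 * q^-1 * expR (- (t - x) ^+ 2 / ((Num.sqrt 2 * e) ^+ 2 *+ 2))) =
    e^-1 * q^-1 * (expR (- (4 * delta ^+ 2)^-1) * expR (- (t - x) ^+ 2 / ((Num.sqrt 2 * e) ^+ 2 *+ 2))).
  by rewrite invfM; field; rewrite !gt_eqF// sqrtr_gt0.
rewrite ler_wpM2l ?mulr_ge0 ?invr_ge0 ?sqrtr_ge0// ?(ltW e0)// -expRD ler_expR.
have tx2 : delta ^+ 2 <= (t - x) ^+ 2.
  by rewrite -[leRHS]real_normK ?num_real// lerXn2r ?nnegrE// ltW.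
have -> : (Num.sqrt 2 * e) ^+ 2 = 2 * e ^+ 2 by rewrite exprMn sqr_sqrtr.
have e2 : 0 < e ^+ 2 by rewrite exprn_gt0.
have -> : (4 * delta ^+ 2)^-1 = delta ^+ 2 / (e ^+ 2 *+ 4).
  by rewrite /e; field; rewrite gt_eqF.
have -> : - (t - x) ^+ 2 / (e ^+ 2 *+ 2) = - (t - x) ^+ 2 / (e ^+ 2 *+ 4) - (t - x) ^+ 2 / (e ^+ 2 *+ 4).
  by field; rewrite gt_eqF.
have -> : - (t - x) ^+ 2 / (2 * e ^+ 2 *+ 2) = - (t - x) ^+ 2 / (e ^+ 2 *+ 4).
  by congr (_ / _); ring.
by rewrite addrC lerD2r lerN2 ler_wpM2r// invr_ge0 ltW// pmulrn_lgt0.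
Qed.

Definition shrink k : R := k.+1%:R^-1.

Lemma cvg_shrink : shrink k @[k --> \oo] --> 0.
Proof. exact: cvg_harmonic. Qed.

Let tail k : R := Num.sqrt 2 * expR (- (4 * shrink k ^+ 2)^-1).

Let cvg_tail : tail k @[k --> \oo] --> 0.
Proof.
have tail_le k : tail k <= Num.sqrt 2 * (4 * shrink k).
  rewrite /tail ler_wpM2l// expRN.
  have d0 : 0 < shrink k by rewrite invr_gt0.
  have d1 : shrink k <= 1 by rewrite invf_le1// ler1n.
  rewrite -[leRHS]invrK lef_pV2 ?posrE ?expR_gt0 ?invr_gt0 ?mulr_gt0//.
  apply: le_trans (expR_ge1Dx _).
  apply: (@le_trans _ _ (4 * shrink k ^+ 2)^-1); last by rewrite lerDr.
  rewrite lef_pV2 ?posrE ?mulr_gt0 ?exprn_gt0// ler_pM2l//.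
  by rewrite expr2 ler_piMr// ltW.
apply: (@squeeze_cvgr _ _ _ _ (cst 0) (fun k => Num.sqrt 2 * (4 * shrink k))).
- by apply: nearW => k; rewrite tail_le /tail mulr_ge0 ?expR_ge0.
- exact: cvg_cst.
- rewrite -[X in _ --> X](mulr0 (Num.sqrt 2)) -(mulr0 4).
  by apply: cvgM; [exact: cvg_cst|apply: cvgM; [exact: cvg_cst|exact: cvg_shrink]].
Qed.

(** The endpoints are shifted to the right by [shrink k], which is large compared with the deviation
    [shrink k ^+ 2]. Hence the limits at [a] and [b] are 0 and 1, not 1/2, and the half-open
    indicator is reached at every point. *)
Lemma cvg_normal_box a b x :
  normal_box (shrink k ^+ 2) (a + shrink k) (b + shrink k) x @[k --> \oo] --> (\1_(`]a, b]%classic) x : R).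
Proof.
have sk k : 0 < shrink k by rewrite invr_gt0.
have small (eta : R) : 0 < eta -> \forall k \near \oo, 2 * shrink k <= eta.
  move=> eta0; have /cvgrPdist_le/(_ (eta / 2)) := cvg_shrink.
  rewrite divr_gt0// => /(_ isT); apply: filterS => k.
  by rewrite sub0r normrN gtr0_norm// ler_pdivlMr// mulrC.
have far : (\forall k \near \oo, forall t, a + shrink k < t <= b + shrink k -> shrink k <= `|t - x|) ->
    normal_box (shrink k ^+ 2) (a + shrink k) (b + shrink k) x @[k --> \oo] --> 0.
  move=> H; apply: (@squeeze_cvgr _ _ _ _ (cst 0) tail); [|exact: cvg_cst|exact: cvg_tail].
  apply: filterS H => k H; rewrite normal_box_ge0/=.
  apply: normal_tail => // t; rewrite /mkset in_itv/=; exact: H.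
have [xa|ax] := leP x a.
  rewrite indicE memNset/=; last by rewrite in_itv/= ltNge xa.
  apply: far; apply: nearW => k t /andP[+ _]; rewrite ler_normr => H.
  by apply/orP; left; have := sk k; lra.
have [xb|bx] := leP x b; last first.
  rewrite indicE memNset/=; last by rewrite in_itv/= [x <= b]leNgt bx andbF.
  apply: far; apply: filterS (small (x - b) _); last by lra.
  move=> k Hk t /andP[_ H]; rewrite ler_normr; apply/orP; right; lra.
rewrite indicE mem_set/=; last by rewrite in_itv/= ax.
rewrite [X in _ --> X](_ : _ = 1 - 0); last by rewrite subr0.
pose A k : set R := ~` `]a + shrink k, b + shrink k]%classic.
have mA k : measurable (A k) by apply: measurableC; exact: measurable_itv.
rewrite (_ : (fun k => _) = (fun k => 1 - \int[mu]_t (normal_pdf x (shrink k ^+ 2) t * \1_(A k) t))); last first.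
  apply/funext => k.
  have -> : 1 = \int[mu]_t normal_pdf x (shrink k ^+ 2) t :> R by rewrite /Rintegral integral_normal_pdf.
  rewrite -RintegralB//; [|exact: integrable_normal_pdf|exact: integrable_normal_indic].
  congr Rintegral; apply/funext => t; rewrite /A !indicE in_setC.
  by case: (_ \in _); rewrite /= !(mulr1, mulr0, subr0, subrr).
apply: cvgB; first exact: cvg_cst.
apply: (@squeeze_cvgr _ _ _ _ (cst 0) tail); [|exact: cvg_cst|exact: cvg_tail].
apply: filterS (small (x - a) _); last by lra.
move=> k Hk; apply/andP; split.
  by apply: Rintegral_ge0 => t _; rewrite mulr_ge0 ?normal_pdf_ge0.
apply: normal_tail => // t /= /negP; rewrite in_itv/= negb_and -leNgt -ltNge ler_normr.
move=> /orP[H|H]; apply/orP; [right|left]; last by lra.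
by have := sk k; lra.
Qed.

End normal_box.

Section uniqueness.
Context {R : realType} {n : nat}.
Notation T := (n.-tuple R).
Notation m := (@lebesgue_tuple R n).
Notation mu := (@lebesgue_measure R).
Implicit Types (a b : 'I_n -> R) (x y z : T).

Definition box a b : set T := [set x | forall i, a i < tnth x i <= b i].

Lemma measurable_box a b : measurable (box a b).
Proof.
have -> : box a b = \bigcap_(i in [set: 'I_n])
    ((fun x : T => tnth x i) @^-1` `]a i, b i]).
  by apply/seteqP; split=> x /= xN i => [_|]; have := xN i; rewrite /= in_itv/=; [apply|move/(_ I)].
apply: fin_bigcap_measurable => //= i _.
rewrite -[X in measurable X]setTI; exact: measurable_tnth.
Qed.

Lemma box_setI_closed : setI_closed [set A | exists a b, A = box a b].
Proof.
move=> _ _ [a [b ->]] [a' [b' ->]].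
exists (fun i => Num.max (a i) (a' i)), (fun i => Num.min (b i) (b' i)).
apply/seteqP; split=> x /=.
  by move=> [H H'] i; rewrite gt_max le_min; have := H i; have := H' i; lra.
by move=> H; split=> i; have := H i; rewrite gt_max le_min; lra.
Qed.

(** The sigma-algebra is generated by the slabs bounding one coordinate by a half-open interval, and
    such a slab is a countable union of boxes whose other sides grow. *)
Lemma measurable_g_box :
  @measurable _ T `<=` <<s [set A | exists a b, A = box a b] >>.
Proof.
apply: smallest_sub; first exact: smallest_sigma_algebra.
rewrite -bigcup_seq => A [i _] [Y mY <-]; rewrite setTI.
pose G := [set Y : set R | <<s [set A | exists a b, A = box a b] >> ((fun x : T => tnth x i) @^-1` Y)].
suff : @measurable _ (measurableTypeR R) `<=` G by apply.
apply: smallest_sub.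
  split => [|B GB|B GB].
  - rewrite /G/= preimage_set0; exact: sigma_algebra0.
  - rewrite /G/= setTD preimage_setC -setTD; exact: sigma_algebraCD.
  - rewrite /G/= preimage_bigcup; exact: sigma_algebra_bigcup.
move=> B /ocitvP[->|[[c d] /= _ ->]].
  rewrite /G/= preimage_set0; exact: sigma_algebra0.
rewrite /G/=.
have -> : (fun x : T => tnth x i) @^-1` `]c, d] = \bigcup_N
    box (fun j => if j == i then c else - N%:R) (fun j => if j == i then d else N%:R).
  apply/seteqP; split=> x /=; last first.
    by move=> [N _ /(_ i)]; rewrite eqxx in_itv/=.
  rewrite in_itv/= => xi; exists (Num.truncn (\sum_j `|tnth x j|)).+1 => // j.
  case: eqVneq => [->//|_].
  have : `|tnth x j| < (Num.truncn (\sum_j `|tnth x j|)).+1%:R.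
    apply: le_lt_trans (truncnS_gt _).
    by rewrite (bigD1 j)//= lerDl sumr_ge0.
  by rewrite ltr_norml => /andP[-> /ltW ->].
apply: sigma_algebra_bigcup => N; apply: sub_sigma_algebra.
by eexists; eexists; reflexivity.
Qed.

Section fixed.
Variable u : T -> R.
Hypothesis intu : m.-integrable setT (EFin \o u).
Hypothesis cosT0 : forall y, cosT u y = 0.
Hypothesis sinT0 : forall y, sinT u y = 0.

Let mu_ : measurable_fun setT u.
Proof. by have /measurable_EFinP := measurable_int _ intu. Qed.

(** The kernel is itself the Fourier integral of a Gaussian; exchanging the integrals leaves a
    Gaussian average of Fourier integrals of [u], all of which vanish. *)
Lemma convolution_gaussn_hat0 e z : 0 < e ->
  \int[m]_x (u x * gaussn_hat e (tuple_sub x z)) = 0.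
Proof.
move=> e0; have en0 : e != 0 by rewrite gt_eqF.
pose f (p : T * T) := u p.1 * gaussn e p.2 * cos (tuple_dot (tuple_sub p.1 z) p.2).
have mcos : measurable_fun [set: T * T] (fun p => cos (tuple_dot (tuple_sub p.1 z) p.2)).
  apply: (measurableT_comp (continuous_measurable_fun (@continuous_cos R))).
  apply: (measurableT_comp (@measurable_tuple_dot R n) (measurable_fun_pair _ _)) => //.
  exact: (measurableT_comp (@measurable_tuple_sub R n) (measurable_fun_pair (measurable_fst) (measurable_cst z))).
have intf : (m \x m)%E.-integrable setT (EFin \o f).
  have int1 := @integrable_prodM _ _ T T R m m u (@gaussn R n e) intu (integrable_gaussn n en0).
  refine (integrableMr_bounded measurableT int1 mcos (M := 1) _).
  by move=> y _; exact: normr_cos_le1.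
have E1 x y : f (x, y) = u x * (gaussn e y * cos (tuple_dot (tuple_sub x z) y + 0)).
  by rewrite /f/= addr0 mulrA.
have E2 x y : f (x, y) = gaussn e y * cos (tuple_dot z y) * (u x * cos (tuple_dot x y)) +
    gaussn e y * sin (tuple_dot z y) * (u x * sin (tuple_dot x y)).
  by rewrite /f/= tuple_dotBl cosB; ring.
have intx x c : m.-integrable setT (EFin \o (fun y => gaussn e y * cos (tuple_dot x y + c))).
  exact: integrable_gaussn_cos.
have -> : \int[m]_x (u x * gaussn_hat e (tuple_sub x z)) = \int[m]_x \int[m]_y f (x, y).
  congr Rintegral; apply/funext => x.
  rewrite -[gaussn_hat _ _]mulr1 -cos0 -integral_gaussn_cos// -RintegralZl//.
  by congr Rintegral; apply/funext => y; rewrite E1.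
rewrite Rintegral_fubini//; last 2 first.
- move=> x; rewrite (_ : (fun y => _) = (fun y => u x * (gaussn e y * cos (tuple_dot (tuple_sub x z) y + 0)))).
    exact: integrable_mull.
  by apply/funext => y; rewrite E1.
- move=> y; rewrite (_ : (fun x => _) = (fun x => gaussn e y * cos (tuple_dot z y) * (u x * cos (tuple_dot x y)) +
    gaussn e y * sin (tuple_dot z y) * (u x * sin (tuple_dot x y)))).
    by apply: integrable_addR => //; apply: integrable_mull => //; [exact: integrable_cosT|exact: integrable_sinT].
  by apply/funext => x; rewrite E2.
rewrite (_ : (fun y => _) = cst 0); last first.
  apply/funext => y /=.
  transitivity (gaussn e y * cos (tuple_dot z y) * cosT u y + gaussn e y * sin (tuple_dot z y) * sinT u y); last first.
    by rewrite cosT0 sinT0 !mulr0 addr0.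
  rewrite /cosT /sinT -!RintegralZl//; [|exact: integrable_sinT|exact: integrable_cosT].
  rewrite -RintegralD//; [|by apply: integrable_mull => //; exact: integrable_cosT|by apply: integrable_mull => //; exact: integrable_sinT].
  by congr Rintegral; apply/funext => x; rewrite E2.
by rewrite /Rintegral integral0.
Qed.

Let ghat_ub e x : e != 0 -> `|gaussn_hat e x| <= (2 * pi * normal_peak e) ^+ n.
Proof.
move=> e0; rewrite ger0_norm ?gaussn_hat_ge0// /gaussn_hat.
rewrite -[X in _ ^+ X]card_ord -prodr_const; apply: ler_prod => i _.
rewrite !mulr_ge0 ?pi_ge0 ?normal_pdf_ge0//= ler_wpM2l ?mulr_ge0 ?pi_ge0//.
exact: normal_pdf_ub.
Qed.

(** Integrating the vanishing convolution over [z] in the box and exchanging the integrals replaces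
    the Gaussian kernel by a mollified indicator of the box. *)
Let box_conv0 (e : R) a b : 0 < e ->
  \int[m]_x (u x * \prod_i normal_box e (a i) (b i) (tnth x i)) = 0.
Proof.
move=> e0; have en0 : e != 0 by rewrite gt_eqF.
pose K (x z : T) := \prod_i (normal_pdf (tnth x i) e (tnth z i) * \1_(`]a i, b i]%classic) (tnth z i)).
have KE x z : K x z = ((2 * pi) ^- n * gaussn_hat e (tuple_sub x z)) * \prod_i \1_(`]a i, b i]%classic) (tnth z i).
  rewrite /K big_split/=; congr (_ * _).
  rewrite /gaussn_hat big_split/= prodr_const card_ord mulrA mulVf ?mul1r; last first.
    by rewrite expf_neq0// mulf_neq0// gt_eqF// pi_gt0.
  by apply: eq_bigr => i _; rewrite tnth_mktuple -opprB normal_pdfN// normal_pdf_sub.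
have K0 x z : 0 <= K x z by apply: prodr_ge0 => i _; rewrite mulr_ge0 ?normal_pdf_ge0.
have mK : measurable_fun [set: T * T] (fun p => K p.1 p.2).
  under eq_fun do rewrite KE.
  apply: measurable_funM.
    apply: measurable_funM => //.
    exact: (measurableT_comp (@measurable_gaussn_hat R n e) (@measurable_tuple_sub R n)).
  apply: measurable_prod => i _.
  apply: (measurableT_comp (measurable_indic _)); first exact: measurable_itv.
  exact: (measurableT_comp (@measurable_tnth _ R n i)).
have mKx x : measurable_fun setT (K x).
  exact: (measurableT_comp mK (measurable_fun_pair (measurable_cst x) (@measurable_id _ T setT))).
have intK x : (\int[m]_z (K x z)%:E = (\prod_i normal_box e (a i) (b i) (tnth x i))%:E)%E.
  rewrite /K (@ge0_integral_prod R n (fun i t => normal_pdf (tnth x i) e t * \1_(`]a i, b i]%classic) t)); last 2 first.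
  - move=> i; apply: measurable_funM; first exact: measurable_normal_pdf.
    by apply: measurable_indic; exact: measurable_itv.
  - by move=> i t; rewrite mulr_ge0 ?normal_pdf_ge0.
  rewrite -prodEFin; apply: eq_bigr => i _; rewrite fineK//.
  apply: integrable_fin_num => //; apply: (@integrableMr_bounded _ _ _ _ _ _ _ 1) => //.
  - exact: integrable_normal_pdf.
  - by move=> t _; rewrite indicE; case: (_ \in _); rewrite ?normr1 ?normr0.
have intKx x : m.-integrable setT (EFin \o K x).
  apply/integrableP; split; first by apply/measurable_EFinP.
  by under eq_integral do rewrite /= ger0_norm//; rewrite intK ltry.
have P1 x : `|\prod_i normal_box e (a i) (b i) (tnth x i)| <= 1.
  rewrite ger0_norm; last by apply: prodr_ge0 => i _; exact: normal_box_ge0.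
  by apply: prodr_ile1 => i _; rewrite normal_box_ge0 normal_box_le1.
pose f (p : T * T) := (u p.1 * K p.1 p.2)%:E.
have mf : measurable_fun setT f.
  by apply/measurable_EFinP; apply: measurable_funM => //; exact: measurableT_comp.
have intf : (m \x m)%E.-integrable setT f.
  apply/integrable12ltyP => //.
  apply: (@le_lt_trans _ _ (\int[m]_x `|u x|%:E)%E); last by case/integrableP : intu.
  apply: ge0_le_integral => //.
  - by move=> x _; exact: integral_ge0.
  - by apply: (measurable_fun_fubini_tonelli_F (fun p => `|f p|)%E) => //; exact: measurableT_comp.
  - by apply/measurable_EFinP; exact: measurableT_comp.
  - move=> x _; rewrite /f/=.
    under eq_integral do rewrite normrM EFinM (ger0_norm (K0 _ _)).
    rewrite ge0_integralZl//; last 2 first.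
    - by apply/measurable_EFinP.
    - by move=> z _; rewrite lee_fin.
    by rewrite intK -EFinM lee_fin ler_piMr// (le_trans (ler_norm _))// P1.
have L : (\int[m]_x \int[m]_y f (x, y) =
    \int[m]_x (u x * \prod_i normal_box e (a i) (b i) (tnth x i))%:E)%E.
  apply: eq_integral => x _; rewrite /f/= EFinM -intK -integralZl//; exact: intKx.
suff Rr : (\int[m]_y \int[m]_x f (x, y) = 0)%E.
  by rewrite /Rintegral -L (Fubini intf) Rr.
apply: integral0_eq => z _; rewrite /f/=.
pose c := (2 * pi) ^- n * \prod_i \1_(`]a i, b i]%classic) (tnth z i) : R.
  have intg : m.-integrable setT (EFin \o (fun x => u x * gaussn_hat e (tuple_sub x z))).
    apply: (@integrableMr_bounded _ _ _ _ _ _ _ ((2 * pi * normal_peak e) ^+ n)) => //.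
    - exact: (measurableT_comp (@measurable_gaussn_hat R n e)
        (measurableT_comp (@measurable_tuple_sub R n) (measurable_fun_pair (@measurable_id _ T setT) (measurable_cst z)))).
- by move=> x _; exact: ghat_ub.
  transitivity (\int[m]_x (c%:E * (u x * gaussn_hat e (tuple_sub x z))%:E))%E.
    by apply: eq_integral => x _; rewrite KE -EFinM /c; congr EFin; ring.
  rewrite integralZl//.
  rewrite -(fineK (integrable_fin_num _ intg))//.
  have := convolution_gaussn_hat0 z e0; rewrite /Rintegral => ->.
by rewrite mule0.
Qed.

Let Rintegral_indic B : measurable B -> \int[m]_(x in B) u x = \int[m]_x (u x * \1_B x).
Proof.
move=> mB; rewrite Rintegral_mkcond; congr Rintegral; apply/funext => x.
by rewrite /patch indicE; case: (_ \in _); rewrite ?mulr1 ?mulr0.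
Qed.

Let integral_box0 a b : \int[m]_(x in box a b) u x = 0.
Proof.
pose f k x := u x * \prod_i normal_box (shrink k ^+ 2) (a i + shrink k) (b i + shrink k) (tnth x i).
pose g x := u x * \prod_i \1_(`]a i, b i]%classic) (tnth x i).
have fg x : setT x -> f k x @[k --> \oo] --> g x.
  move=> _; apply: cvgM; first exact: cvg_cst.
  by apply: cvg_big => [|i _]; [exact: mul_continuous|exact: cvg_normal_box].
have mnb (e c d : R) : e != 0 -> measurable_fun setT (normal_box e c d).
  move=> e0.
  have H : measurable_fun setT (fun p : R * measurableTypeR R => normal_pdf p.1 e p.2 * \1_(`]c, d]%classic) p.2).
    apply: measurable_funM; last first.
      by apply: (measurableT_comp (measurable_indic _)) => //; exact: measurable_itv.
    under eq_fun do rewrite -normal_pdf_sub//.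
    by apply: (measurableT_comp (measurable_normal_pdf 0 e)); exact: measurable_funB.
  exact: (measurable_Rintegral mu H).
have sk k : 0 < shrink k :> R by rewrite invr_gt0.
have mf k : measurable_fun setT (f k).
  apply: measurable_funM => //; apply: measurable_prod => i _.
  apply: measurableT_comp; last exact: measurable_tnth.
  by apply: mnb; rewrite gt_eqF// exprn_gt0.
have fu k x : setT x -> `|f k x| <= `|u x|.
  move=> _; rewrite normrM ler_piMr// ger0_norm; last by apply: prodr_ge0 => i _; exact: normal_box_ge0.
  by apply: prodr_ile1 => i _; rewrite normal_box_ge0 normal_box_le1.
have [_] := dominated_cvg_Rintegral measurableT mf fg (integrable_norm intu) fu.
rewrite (_ : (fun k => _) = cst 0); last first.
  by apply/funext => k; apply: box_conv0; rewrite exprn_gt0.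
move/cvg_lim; rewrite lim_cst// => H.
rewrite Rintegral_indic; last exact: measurable_box.
rewrite [RHS]H//; congr Rintegral; apply/funext => x; rewrite /g; congr (_ * _).
rewrite indicE; have [|xB] := boolP (x \in box a b).
  rewrite inE => xB; rewrite big1// => i _.
  by rewrite indicE mem_set//= in_itv/=; exact: xB.
apply/esym/eqP; rewrite prodf_seq_eq0; apply/hasP.
have [i Hi] : exists i, ~~ (a i < tnth x i <= b i).
  apply: contrapT => H'; move/negP : xB; apply; rewrite inE => i.
  by apply: contrapT => /negP Hi; apply: H'; exists i.
exists i; first by rewrite mem_index_enum.
by rewrite indicE memNset//= in_itv/=; exact/negP.
Qed.

(** Dynkin's lemma: the boxes are closed under intersection and generate the sigma-algebra, and the
    measurable sets on which [u] has integral zero form a lambda-system. *)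
Let integral_measurable0 A : measurable A -> \int[m]_(x in A) u x = 0.
Proof.
move=> mA; pose G := [set A : set T | measurable A /\ \int[m]_(x in A) u x = 0].
suff : <<s [set A | exists a b, A = box a b] >> `<=` G.
  by move=> /(_ A (measurable_g_box mA)) [].
have ndG : ndseq_closed G.
  move=> F ndF GF; have mF k : measurable (F k) by case: (GF k).
  split; first exact: bigcupT_measurable.
  have [] := @dominated_cvg_Rintegral _ _ R m setT (fun k x => u x * \1_(F k) x)
    (fun x => u x * \1_(\bigcup_k F k) x) (fun x => `|u x|) measurableT.
  - by move=> k; apply: measurable_funM => //; exact: measurable_indic.
  - move=> x _; apply: cvgM; first exact: cvg_cst.
    rewrite indicE; have [|xF] := boolP (x \in \bigcup_k F k).
      rewrite inE => -[k _ Fkx]; apply: cvg_near_cst; exists k => // l /= kl.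
      by rewrite indicE mem_set//; move: Fkx; apply/subsetPset; exact: ndF.
    apply: cvg_near_cst; apply: nearW => k; rewrite indicE memNset// => Fkx.
    by move/negP : xF; apply; rewrite inE; exists k.
  - exact: integrable_norm.
  - by move=> k x _; rewrite normrM ler_piMr// indicE; case: (_ \in _); rewrite ?normr1 ?normr0.
  move=> _.
  rewrite -Rintegral_indic; last exact: bigcupT_measurable.
  rewrite (_ : (fun k => _) = cst 0); last by apply/funext => k /=; rewrite -Rintegral_indic//; case: (GF k).
  by move/cvg_lim => <-//; rewrite lim_cst.
have boxG : [set A | exists a b, A = box a b] `<=` G.
  by move=> _ [a [b ->]]; split; [exact: measurable_box|exact: integral_box0].
apply: lambda_system_subset => //; first exact: box_setI_closed.
split => //.
- have -> : [set: T] = \bigcup_N box (fun=> - N%:R) (fun=> N%:R).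
    apply/esym; rewrite -subTset => x _.
    exists (Num.truncn (\sum_j `|tnth x j|)).+1 => // j.
    have : `|tnth x j| < (Num.truncn (\sum_j `|tnth x j|)).+1%:R.
      apply: le_lt_trans (truncnS_gt _).
      by rewrite (bigD1 j)//= lerDl sumr_ge0.
    by rewrite ltr_norml => /andP[-> /ltW ->].
  apply: ndG => [N M NM|N]; last by apply: boxG; eexists; eexists; reflexivity.
  apply/subsetPset => x H i; have /andP[H1 H2] := H i.
  have NM' : N%:R <= M%:R :> R by rewrite ler_nat.
  by apply/andP; split; lra.
- move=> B D DB [mB B0] [mD D0]; split; first exact: measurableD.
  rewrite Rintegral_indic; last exact: measurableD.
  have intI E : measurable E -> m.-integrable setT (EFin \o (fun x => u x * \1_E x)).
    move=> mE; apply: (@integrableMr_bounded _ _ _ _ _ _ _ 1) => //.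
    by move=> t _; rewrite indicE; case: (_ \in _); rewrite ?normr1 ?normr0.
  transitivity (\int[m]_x (u x * \1_B x) - \int[m]_x (u x * \1_D x)).
    rewrite -RintegralB//; [|exact: intI|exact: intI].
    congr Rintegral; apply/funext => x; rewrite !indicE in_setD.
    have [xD|xD] := boolP (x \in D); last by rewrite /= andbT mulr0 subr0.
    by rewrite (_ : x \in B) /= ?subrr ?mulr0//; move: xD; rewrite !inE; exact: DB.
  by rewrite -!Rintegral_indic// B0 D0 subrr.
Qed.

Lemma fourier_transform_eq0 : {ae m, forall x, u x = 0}.
Proof.
have intT := intu.
have := @integral_ae_eq _ T R m setT measurableT (cst 0%E) (EFin \o u) intT (measurable_cst _).
have H E : E `<=` setT -> measurable E -> (\int[m]_(x in E) (EFin \o u) x = \int[m]_(x in E) cst 0 x)%E.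
  move=> _ mE; rewrite integral0 -[LHS]fineK; last first.
    by apply: integrable_fin_num => //; apply: integrableS intu.
  by have := integral_measurable0 mE; rewrite /Rintegral => ->.
move=> /(_ H); apply: filterS => x /(_ I) [].
by [].
Qed.

End fixed.
End uniqueness.

(** * Gaussians are Schwartz functions *)

Section schwartz_gauss.
Context {R : realType} {n : nat}.
Notation T := (n.-tuple R).
Implicit Types (x y : T) (p : 'I_n -> {poly R}).

(** One polynomial per coordinate: the family contains the translated Gaussians and is stable under
    [partial], which changes the polynomial of a single coordinate. *)
Definition gauss_poly p y x : R :=
  \prod_i ((p i).[tnth x i] * gauss 1 (tnth x i - tnth y i)).

Definition cgauss_poly p y x : R[i] := (gauss_poly p y x)%:C.

Definition gauss_poly_deriv i p y : 'I_n -> {poly R} :=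
  fun j => if j == i then deriv (p i) - ('X - (tnth y i)%:P) * p i else p j.

Let slice_val p y x i (t : R) : gauss_poly p y (replace_coord x i t) =
  ((p i).[t] * gauss 1 (t - tnth y i)) *
  \prod_(j | j != i) ((p j).[tnth x j] * gauss 1 (tnth x j - tnth y j)).
Proof.
rewrite /gauss_poly (bigD1 i)//= tnth_mktuple eqxx; congr (_ * _).
by apply: eq_bigr => j ji; rewrite tnth_mktuple (negbTE ji).
Qed.

Lemma is_derive_gauss_poly p y x i : is_derive (tnth x i) (1 : R)
  (fun t => gauss_poly p y (replace_coord x i t)) (gauss_poly (gauss_poly_deriv i p y) y x).
Proof.
rewrite (_ : (fun t => _) = (fun t => ((p i).[t] * gauss 1 (t - tnth y i)) *
  \prod_(j | j != i) ((p j).[tnth x j] * gauss 1 (tnth x j - tnth y j)))); last first.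
  by apply/funext => t; exact: slice_val.
have dp := is_derive_poly (p i) (tnth x i).
have dg : is_derive (tnth x i) (1 : R) (fun t => gauss 1 (t - tnth y i))
    (- ((tnth x i - tnth y i) * gauss 1 (tnth x i - tnth y i))).
  have dg := is_derive_gauss 1 (tnth x i - tnth y i).
  have ds : is_derive (tnth x i) (1 : R) (fun t : R => t - tnth y i) 1.
    by apply: is_derive_eq; rewrite subr0.
  have := @is_derive1_comp _ (gauss 1) (fun t : R => t - tnth y i) (tnth x i) _ _ dg ds.
  by rewrite expr1n !mul1r mulr1.
apply: is_derive_eq.
rewrite [RHS]/gauss_poly [RHS](bigD1 i)//= /gauss_poly_deriv eqxx /GRing.scale/=.
rewrite [X in _ = _ * X](eq_bigr (fun j => (p j).[tnth x j] * gauss 1 (tnth x j - tnth y j))); last first.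
  by move=> j ji; rewrite (negbTE ji).
by rewrite !hornerE; ring.
Qed.

Lemma partial_cgauss_poly p y i :
  partial i (cgauss_poly p y) = cgauss_poly (gauss_poly_deriv i p y) y.
Proof.
apply/funext => x; rewrite /partial /cgauss_poly.
have dp := is_derive_gauss_poly p y x i.
rewrite (_ : _ \o _ = (fun t => gauss_poly p y (replace_coord x i t)))//.
rewrite [X in _ +i* derive1 X _](_ : _ = cst 0)//.
rewrite derive1_cst derive1E; congr (_ +i* _).
exact: derive_val.
Qed.

Lemma iter_partial_cgauss_poly p y w :
  exists q, iter_partial w (cgauss_poly p y) = cgauss_poly q y.
Proof.
elim: w => [|i w [q ih]]; first by exists p.
exists (gauss_poly_deriv i q y).
by rewrite /iter_partial/= -/(iter_partial w _) ih partial_cgauss_poly.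
Qed.

Lemma pow_gauss_bounded N (z : R) : exists M, forall t : R, (1 + `|t|) ^+ N * gauss 1 (t - z) <= M.
Proof.
(* With [s = t - z], the factor in [z] comes from [1 + |t| <= (1 + |z|) * (1 + |s|)], the factorial
   from one term of the exponential series at [1 + |s|], and 3/2 is the maximum of
   [1 + |s| - s ^+ 2 / 2]. *)
exists ((1 + `|z|) ^+ N * (N`!%:R * expR (3 / 2))) => t.
pose s := t - z.
have H1 : 1 + `|t| <= (1 + `|z|) * (1 + `|s|).
  have : `|t| <= `|s| + `|z| by rewrite -{1}(subrK z t) ler_normD.
  by have := normr_ge0 s; have := normr_ge0 z; nra.
apply: (@le_trans _ _ (((1 + `|z|) * (1 + `|s|)) ^+ N * gauss 1 s)).
  by rewrite ler_wpM2r ?gauss_ge0// lerXn2r ?nnegrE ?addr_ge0// mulr_ge0// addr_ge0.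
rewrite exprMn -mulrA ler_wpM2l ?exprn_ge0 ?addr_ge0//.
have s0 : 0 <= 1 + `|s| by rewrite addr_ge0.
have H2 : (1 + `|s|) ^+ N <= N`!%:R * expR (1 + `|s|).
  have : exp_coeff (1 + `|s|) N <= expR (1 + `|s|).
    apply: le_trans (series_exp_coeff_le N.+1 s0).
    rewrite /series/= big_nat_recr//= lerDr; apply: sumr_ge0 => k _; exact: exp_coeff_ge0.
  by rewrite /exp_coeff/= ler_pdivrMr ?ltr0n ?fact_gt0// mulrC.
apply: (le_trans (ler_wpM2r (gauss_ge0 _ _) H2)).
rewrite -mulrA ler_wpM2l// /gauss -expRD ler_expR mul1r.
by have := real_normK (num_real s); have := sqr_ge0 (`|s| - 1); nra.
Qed.

Lemma poly_growth (q : {poly R}) : exists N C, forall t : R, `|q.[t]| <= C * (1 + `|t|) ^+ N.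
Proof.
elim/poly_ind: q => [|q c [N [C ih]]].
  by exists 0%N, 0 => t; rewrite horner0 normr0 mul0r.
exists N.+1, (C + `|c|) => t; rewrite !hornerE.
have t1 : 1 <= 1 + `|t| by rewrite lerDl.
have t0 : 0 <= 1 + `|t| by rewrite addr_ge0.
rewrite mulrDl; apply: (le_trans (ler_normD _ _)); apply: lerD.
  rewrite normrM exprSr mulrA; apply: ler_pM => //; last by rewrite lerDr.
rewrite ler_peMr//; exact: exprn_ege1.
Qed.

(** [1 + enorm x] is at most the product of the [1 + |x_i|], so that the polynomial weight splits
    along the coordinates as the function does. *)
Lemma gauss_poly_rapid p y k : exists M, forall x,
  (1 + enorm x) ^+ k * `|gauss_poly p y x| <= M.
Proof.
have H i : exists M, forall t : R, (1 + `|t|) ^+ k * (`|(p i).[t]| * gauss 1 (t - tnth y i)) <= M.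
  have [N [C pC]] := poly_growth (p i).
  have [M HM] := pow_gauss_bounded (k + N) (tnth y i).
  exists (`|C| * M) => t.
  have t0 : 0 <= 1 + `|t| by rewrite addr_ge0.
  apply: (@le_trans _ _ (`|C| * ((1 + `|t|) ^+ (k + N) * gauss 1 (t - tnth y i)))); last by rewrite ler_wpM2l.
  rewrite exprD [leRHS](_ : _ = (1 + `|t|) ^+ k * (`|C| * (1 + `|t|) ^+ N * gauss 1 (t - tnth y i))); last by ring.
  rewrite ler_wpM2l ?exprn_ge0// ler_wpM2r ?gauss_ge0// (le_trans (pC _))//.
  by rewrite ler_wpM2r ?exprn_ge0// ler_norm.
have [M HM] := choice H.
exists (\prod_i M i) => x.
have E : 1 + enorm x <= \prod_i (1 + `|tnth x i|).
  apply: (@le_trans _ _ (1 + \sum_i `|tnth x i|)).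
    by rewrite lerD2l enorm_le_sum.
  elim: (index_enum _) => [|i s ih]; first by rewrite !big_nil addr0.
  rewrite !big_cons; have : 0 <= \sum_(i <- s) `|tnth x i| by exact: sumr_ge0.
  by have := normr_ge0 (tnth x i); nra.
apply: (@le_trans _ _ ((\prod_i (1 + `|tnth x i|)) ^+ k * `|gauss_poly p y x|)).
  rewrite ler_wpM2r// lerXn2r ?nnegrE ?addr_ge0 ?sqrtr_ge0//.
  by apply: prodr_ge0 => i _; rewrite addr_ge0.
rewrite -prodrXl /gauss_poly normr_prod -big_split/=.
apply: ler_prod => i _.
rewrite mulr_ge0 ?exprn_ge0 ?addr_ge0//= normrM (ger0_norm (gauss_ge0 _ _)).
exact: HM.
Qed.

Lemma schwartz_cgauss_poly p y : schwartz (cgauss_poly p y).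
Proof.
split=> [w i x|k w]; have [q ->] := iter_partial_cgauss_poly p y w.
  have dp := is_derive_gauss_poly q y x i; split; first exact: ex_derive.
  exact: derivable_cst.
have [M HM] := gauss_poly_rapid q y k; exists M => x.
rewrite /cgauss_poly (_ : Normc.normc _ = `|gauss_poly q y x|)//.
by rewrite /Normc.normc /= expr0n/= addr0 sqrtr_sqr.
Qed.

End schwartz_gauss.

(** * Null sets of Hausdorff measures *)

Section hausdorff_null.
Context {R : realType}.
Implicit Types (A U : set R) (d : R).

Lemma diameter_ge0 U : U !=set0 -> (0 <= diameter U)%E.
Proof.
move=> [x Ux]; apply: ereal_sup_ubound; exists x => //; exists x => //.
by rewrite subrr normr0.
Qed.

Lemma diameter_le U (r : R) : (forall x y, U x -> U y -> `|x - y| <= r) ->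
  (diameter U <= r%:E)%E.
Proof.
by move=> Ur; apply: ge_ereal_sup => _ [x Ux [y Uy <-]]; rewrite lee_fin; exact: Ur.
Qed.

Lemma diameter_power_ge0 d U : (0 <= diameter_power d U)%E.
Proof. by rewrite /diameter_power; case: ifPn => // _; exact: poweR_ge0. Qed.

Lemma diameter_power_le d U (r : R) : 0 <= d -> 0 <= r ->
  (diameter U <= r%:E)%E -> (diameter_power d U <= (r `^ d)%:E)%E.
Proof.
move=> d0 r0 Ur; rewrite /diameter_power; case: ifPn => [_|/set0P U0].
  by rewrite lee_fin powR_ge0.
rewrite -poweR_EFin; apply: gt0_ler_poweR => //.
- by rewrite in_itv/= diameter_ge0// leey.
- by rewrite in_itv/= lee_fin r0 leey.
Qed.

Lemma hausdorff_content_ge0 d delta A : (0 <= hausdorff_content d delta A)%E.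
Proof.
apply: le_ereal_inf_tmp => _ [U _ <-].
by apply: nneseries_ge0 => k _ _; exact: diameter_power_ge0.
Qed.

Lemma hausdorff_measure_eq0 d A :
  (forall delta e : R, 0 < delta -> 0 < e -> (hausdorff_content d delta A <= e%:E)%E) ->
  hausdorff_measure d A = 0%E.
Proof.
move=> H; apply/eqP; rewrite eq_le; apply/andP; split.
  apply: ge_ereal_sup => _ [delta /= delta0 <-].
  by apply/lee_addgt0Pr => e e0; rewrite add0e; exact: H.
apply: (@le_trans _ _ (hausdorff_content d 1 A)); first exact: hausdorff_content_ge0.
by apply: ereal_sup_ubound; exists 1 => //=.
Qed.

Lemma diameter_set0 : diameter (@set0 R) = -oo%E.
Proof.
rewrite /diameter (_ : [set _ | _ in _ & _ in _] = set0) ?ereal_sup0//.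
by apply/seteqP; split=> // z [x].
Qed.

(* Borel-Cantelli for the outer measure [hausdorff_measure d] *)
Lemma hausdorff_measure_limsup0 d A (c : nat -> nat) (I : nat -> nat -> set R)
    (G : nat -> nat -> bool) (z : nat -> \bar R) :
  0 <= d ->
  (forall m j, (diameter (I m j) <= (2 ^- m)%:E)%E) ->
  (forall m, (0 <= z m)%E) ->
  (forall m, (\sum_(0 <= j < c m) (if G m j then ((2 ^- m) `^ d)%:E else 0) <= z m)%E) ->
  (\sum_(0 <= m <oo) z m < +oo)%E ->
  (forall t, A t -> forall M, exists m j, [/\ (M <= m)%N, (j < c m)%N, G m j & I m j t]) ->
  hausdorff_measure d A = 0%E.
Proof.
move=> d0 Ir z0 Gz zoo Acov; apply: hausdorff_measure_eq0 => delta e delta0 e0.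
have [M [MD Me]] : exists M, 2 ^- M <= delta /\ (\sum_(M <= m <oo) z m <= e%:E)%E.
  have H1 : \forall M \near \oo, (\sum_(M <= m <oo) z m <= e%:E)%E.
    have /fine_cvgP[fin /cvgrPdist_le/(_ _ e0) H] := nneseries_tail_cvg zoo (fun k _ => z0 k).
    apply: filterS2 fin H => M finM; rewrite sub0r normrN => HM.
    by rewrite -[leLHS]fineK// lee_fin (le_trans (ler_norm _)).
  have H2 : \forall M \near \oo, 2 ^- M <= delta.
    have : (2^-1 : R) ^+ M @[M --> \oo] --> 0 by apply: cvg_expr; rewrite ger0_norm ?invr_ge0// invf_lt1// ltr1n.
    move/cvgrPdist_le => /(_ _ delta0); apply: filterS => M.
    by rewrite sub0r normrN ger0_norm ?exprn_ge0 ?invr_ge0// exprVn.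
  have [M _ HM] := filterI H1 H2.
  by exists M; have [] := HM M (leqnn M).
pose sel m j := [&& (M <= m)%N, (j < c m)%N & G m j].
pose V (p : nat * nat) := if sel p.1 p.2 then I p.1 p.2 else set0.
(* A single sequence has to enumerate the selected pairs [(m, j)]. All other indices receive the
   empty set, whose diameter [-oo] is below [delta] and whose contribution is 0. *)
pose U k := if (pickle_inv k : option (nat * nat)) is Some p then V p else set0.
pose a m j : \bar R := if sel m j then ((2 ^- m) `^ d)%:E else 0%E.
have a0 m j : (0 <= a m j)%E by rewrite /a; case: ifP => // _; rewrite lee_fin powR_ge0.
apply: (@le_trans _ _ (\sum_(0 <= k <oo) diameter_power d (U k))%E).
  apply: ereal_inf_lbound; exists U => //; split=> [t At|k].
    have [m [j [Mm jc Gmj It]]] := Acov t At M.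
    by exists (pickle (m, j)) => //; rewrite /U pickleK_inv /V /sel/= Mm jc Gmj.
  rewrite /U; case: pickle_inv => [[m j]|]; last by rewrite diameter_set0 leNye.
  rewrite /V; case: ifPn => /= [/and3P[Mm _ _]|_]; last by rewrite diameter_set0 leNye.
  apply: (le_trans (Ir _ _)); rewrite lee_fin (le_trans _ MD)//.
  by rewrite lef_pV2 ?posrE ?exprn_gt0// ler_eXn2l// ltr1n.
have dp0 k : (0 <= diameter_power d (U k))%E by exact: diameter_power_ge0.
rewrite nneseries_esumT//.
have -> : (\esum_(k in [set: nat]) diameter_power d (U k) =
    \esum_(k in range (@pickle (nat * nat)%type)) diameter_power d (U k))%E.
  rewrite [RHS]esum_mkcond; apply: eq_esum => k _; case: ifPn => // kR.
  rewrite /U; have := @pickle_invK (nat * nat)%type k.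
  case: pickle_inv => [p /= pk|_]; last by rewrite /diameter_power eqxx.
  by move/negP : kR; case; rewrite inE; exists p.
rewrite (reindex_esum [set: nat * nat] _ pickle); last first.
  split=> [p _|p q _ _|k //]; first by exists p.
  exact: (pcan_inj pickleK).
apply: (@le_trans _ _ (\esum_(p in [set: nat * nat]) a p.1 p.2)%E).
  apply: le_esum => -[m j] _; rewrite /U pickleK_inv /V /a/=.
  case: ifP => // _; last by rewrite /diameter_power eqxx.
  by apply: diameter_power_le => //; rewrite invr_ge0 exprn_ge0.
rewrite (_ : [set: nat * nat] = [set: nat] `*`` (fun=> [set: nat])); last by apply/seteqP; split=> -[].
rewrite -esum_esum; last by move=> m j _ _; exact: a0.
apply: le_trans Me.
rewrite -nneseries_esumT; last by move=> m; apply: esum_ge0 => j _; exact: a0.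
rewrite (nneseries_split 0 M); last first.
  by move=> m _; apply: esum_ge0 => j _; exact: a0.
rewrite add0n big1_seq ?add0e; last first.
  move=> m /andP[_]; rewrite mem_index_iota => /andP[_ mM].
  by apply: esum1 => j _; rewrite /a /sel leqNgt mM.
apply: lee_nneseries => [m _ _|m _]; first by apply: esum_ge0 => j _; exact: a0.
rewrite -nneseries_esumT; last by move=> j; exact: a0.
rewrite (nneseries_split 0 (c m)); last by move=> j _; exact: a0.
rewrite add0n [X in (_ + X)%E]eseries0 ?adde0; last first.
  by move=> j jc _; rewrite /a /sel (ltnNge j) jc andbF.
apply: le_trans (Gz m); rewrite !big_seq; apply: lee_sum => j.
rewrite mem_index_iota => /andP[_ jc]; rewrite /a /sel jc/=.
by case: (M <= m)%N => //=; case: ifP => // _; rewrite lee_fin powR_ge0.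
Qed.

End hausdorff_null.

(** * Fourier inversion *)

Section inversion.
Context {R : realType} {n : nat}.
Notation T := (n.-tuple R).
Notation m := (@lebesgue_tuple R n).
Implicit Types (f F H h : T -> R) (x y xi : T).

Lemma gaussn_hat1 x : gaussn_hat 1 x = Num.sqrt (2 * pi) ^+ n * gaussn 1 x.
Proof.
transitivity (\prod_(i < n) (Num.sqrt (2 * pi) * gauss 1 (tnth x i))).
  apply: eq_bigr => i _; rewrite gauss_normal ?oner_neq0// invr1 normr1 divr1 mulrA.
  by rewrite -expr2 sqr_sqrtr// mulr_ge0 ?pi_ge0.
by rewrite big_split/= prodr_const card_ord.
Qed.

Lemma gaussn_atE (e : R) y x : gaussn_at e y x = gaussn e (tuple_sub x y).
Proof. by apply: eq_bigr => i _; rewrite tnth_mktuple. Qed.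

Let sinE (z : R) : sin z = cos (z + - (pi / 2)).
Proof. by rewrite cosD cosN sinN cos_pihalf sin_pihalf mulr0 sub0r mulrN mulr1 opprK. Qed.

(** The left side is the real part of the Fourier integral at frequency [y] of a Gaussian times a
    wave. After Fubini's theorem the Gaussian is integrated against the phase of [xi - y]; the term
    in [H2] carries a sine and vanishes. *)
Lemma integral_gaussn_wave H1 H2 y :
  m.-integrable setT (EFin \o H1) -> m.-integrable setT (EFin \o H2) ->
  \int[m]_x (gaussn 1 x * (waveRe H1 H2 (fun=> 0) x * cos (tuple_dot y x) +
                           waveIm H1 H2 (fun=> 0) x * sin (tuple_dot y x))) =
  \int[m]_xi (H1 xi * gaussn_hat 1 (tuple_sub xi y)).
Proof.
move=> intH1 intH2; have e0 : (1 : R) != 0 by rewrite oner_neq0.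
pose k (z : T * T) := gaussn 1 z.1 * H1 z.2 * cos (tuple_dot (tuple_sub z.2 y) z.1) -
  gaussn 1 z.1 * H2 z.2 * sin (tuple_dot (tuple_sub z.2 y) z.1).
have mtrig (g : R -> R) : continuous g ->
    measurable_fun [set: T * T] (fun z => g (tuple_dot (tuple_sub z.2 y) z.1)).
  move=> cg; apply: (measurableT_comp (continuous_measurable_fun cg)).
  apply: (measurableT_comp (@measurable_tuple_dot R n) (measurable_fun_pair _ _)) => //.
  exact: (measurableT_comp (@measurable_tuple_sub R n) (measurable_fun_pair (measurable_snd) (measurable_cst y))).
have intk : (m \x m)%E.-integrable setT (EFin \o k).
  apply: integrable_subR => //.
  - apply: (@integrableMr_bounded _ _ _ _ _ (fun z : T * T => gaussn 1 z.1 * H1 z.2) _ 1) => //.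
    + by apply: (@integrable_prodM _ _ T T R m m (@gaussn R n 1) H1) => //; exact: integrable_gaussn.
    + by apply: mtrig; exact: continuous_cos.
    + by move=> ? _; exact: normr_cos_le1.
  - apply: (@integrableMr_bounded _ _ _ _ _ (fun z : T * T => gaussn 1 z.1 * H2 z.2) _ 1) => //.
    + by apply: (@integrable_prodM _ _ T T R m m (@gaussn R n 1) H2) => //; exact: integrable_gaussn.
    + by apply: mtrig; exact: continuous_sin.
    + by move=> ? _; exact: normr_sin_le1.
have kE x xi : k (x, xi) =
    (gaussn 1 x * cos (tuple_dot y x)) * (H1 xi * cos (tuple_dot xi x) - H2 xi * sin (tuple_dot xi x)) +
    (gaussn 1 x * sin (tuple_dot y x)) * (H1 xi * sin (tuple_dot xi x) + H2 xi * cos (tuple_dot xi x)).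
  by rewrite /k/= tuple_dotBl cosB sinB; ring.
have kE' x xi : k (x, xi) =
    H1 xi * (gaussn 1 x * cos (tuple_dot (tuple_sub xi y) x + 0)) -
    H2 xi * (gaussn 1 x * cos (tuple_dot (tuple_sub xi y) x + - (pi / 2))).
  by rewrite /k/= -sinE addr0; ring.
have iRe x : m.-integrable setT (EFin \o (fun xi => H1 xi * cos (tuple_dot xi x) - H2 xi * sin (tuple_dot xi x))).
  by apply: integrable_subR => //; [exact: integrable_cosT|exact: integrable_sinT].
have iIm x : m.-integrable setT (EFin \o (fun xi => H1 xi * sin (tuple_dot xi x) + H2 xi * cos (tuple_dot xi x))).
  by apply: integrable_addR => //; [exact: integrable_sinT|exact: integrable_cosT].
transitivity (\int[m]_x \int[m]_xi k (x, xi)).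
  congr Rintegral; apply/funext => x.
  under [in RHS]eq_Rintegral do rewrite kE.
  rewrite RintegralD//; [|exact: integrable_mull|exact: integrable_mull].
  rewrite !RintegralZl// mulrDr; congr (_ + _).
    rewrite mulrCA mulrC; congr (_ * _); congr Rintegral; apply/funext => xi.
    by rewrite addr0.
  rewrite mulrCA mulrC; congr (_ * _); congr Rintegral; apply/funext => xi.
  by rewrite addr0.
rewrite Rintegral_fubini//; last 2 first.
- move=> x; rewrite (_ : (fun xi => _) = (fun xi =>
    (gaussn 1 x * cos (tuple_dot y x)) * (H1 xi * cos (tuple_dot xi x) - H2 xi * sin (tuple_dot xi x)) +
    (gaussn 1 x * sin (tuple_dot y x)) * (H1 xi * sin (tuple_dot xi x) + H2 xi * cos (tuple_dot xi x)))); last by apply/funext => xi; exact: kE.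
  by apply: integrable_addR => //; exact: integrable_mull.
- move=> xi; rewrite (_ : (fun x => _) = (fun x =>
    H1 xi * (gaussn 1 x * cos (tuple_dot (tuple_sub xi y) x + 0)) -
    H2 xi * (gaussn 1 x * cos (tuple_dot (tuple_sub xi y) x + - (pi / 2))))); last by apply/funext => x; rewrite kE'.
  by apply: integrable_subR => //; apply: integrable_mull => //; exact: integrable_gaussn_cos.
congr Rintegral; apply/funext => xi.
under eq_Rintegral do rewrite kE'.
rewrite RintegralB//; [|by apply: integrable_mull => //; exact: integrable_gaussn_cos
  |by apply: integrable_mull => //; exact: integrable_gaussn_cos].
rewrite !RintegralZl//; [|exact: integrable_gaussn_cos|exact: integrable_gaussn_cos].
by rewrite !integral_gaussn_cos// cos0 cosN cos_pihalf !mulr0 subr0 mulr1.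
Qed.

Lemma conull_Rintegral (A : set T) h : measurable A -> m (~` A) = 0%E ->
  measurable_fun setT h -> \int[m]_x (h x * \1_A x) = \int[m]_x h x.
Proof.
move=> mA A0 mh; rewrite /Rintegral; congr fine.
apply: ae_eq_integral => //.
- by apply/measurable_EFinP; exact: measurable_funM.
- by apply/measurable_EFinP.
exists (~` A); split => //; first exact: measurableC.
by move=> x /= Hx Ax; apply: Hx => _; rewrite indicE mem_set// mulr1.
Qed.

Lemma waveRe0 H1 H2 x : m.-integrable setT (EFin \o H1) -> m.-integrable setT (EFin \o H2) ->
  waveRe H1 H2 (fun=> 0) x = cosT H1 x - sinT H2 x.
Proof.
move=> i1 i2; rewrite /cosT /sinT -RintegralB//; [|exact: integrable_cosT|exact: integrable_sinT].
by congr Rintegral; apply/funext => xi; rewrite addr0.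
Qed.

Lemma waveIm0 H1 H2 x : m.-integrable setT (EFin \o H1) -> m.-integrable setT (EFin \o H2) ->
  waveIm H1 H2 (fun=> 0) x = sinT H1 x + cosT H2 x.
Proof.
move=> i1 i2; rewrite /cosT /sinT -RintegralD//; [|exact: integrable_sinT|exact: integrable_cosT].
by congr Rintegral; apply/funext => xi; rewrite addr0.
Qed.

Section component.
Variables (F1 F2 G1 G2 f1 f2 Hd : T -> R) (D : nat -> set T) (A : set T).
Hypothesis D_cvg : forall xi, \forall k \near \oo, D k xi.
Hypothesis mA : measurable A.
Hypothesis A0 : m (~` A) = 0%E.
Let H1 k xi := F1 xi * \1_(D k) xi.
Let H2 k xi := F2 xi * \1_(D k) xi.
Hypothesis intH1 : forall k, m.-integrable setT (EFin \o H1 k).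
Hypothesis intH2 : forall k, m.-integrable setT (EFin \o H2 k).
Let u k x := (2 * pi) ^- n * waveRe (H1 k) (H2 k) (fun=> 0) x.
Let v k x := (2 * pi) ^- n * waveIm (H1 k) (H2 k) (fun=> 0) x.
Hypothesis u_cvg : forall x, A x -> u k x @[k --> \oo] --> G1 x.
Hypothesis v_cvg : forall x, A x -> v k x @[k --> \oo] --> G2 x.
Hypothesis Hd0 : forall x, 0 <= Hd x.
Hypothesis uHd : forall k x, A x -> `|u k x| <= Hd x.
Hypothesis vHd : forall k x, A x -> `|v k x| <= Hd x.
Hypothesis intHd : m.-integrable setT (EFin \o (fun x => Hd x * gaussn 1 x)).

Let mu_ k : measurable_fun setT (u k).
Proof.
apply: measurable_funM => //.
rewrite [X in measurable_fun _ X](_ : _ = (fun x => cosT (H1 k) x - sinT (H2 k) x)); last first.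
  by apply/funext => x; rewrite waveRe0.
have /measurable_EFinP ? := measurable_int _ (intH1 k).
have /measurable_EFinP ? := measurable_int _ (intH2 k).
by apply: measurable_funB; [exact: measurable_cosT|exact: measurable_sinT].
Qed.

Let mv_ k : measurable_fun setT (v k).
Proof.
apply: measurable_funM => //.
rewrite [X in measurable_fun _ X](_ : _ = (fun x => sinT (H1 k) x + cosT (H2 k) x)); last first.
  by apply/funext => x; rewrite waveIm0.
have /measurable_EFinP ? := measurable_int _ (intH1 k).
have /measurable_EFinP ? := measurable_int _ (intH2 k).
by apply: measurable_funD; [exact: measurable_sinT|exact: measurable_cosT].
Qed.

Let integrable_lim (w : nat -> T -> R) (G : T -> R) : (forall k, measurable_fun setT (w k)) ->
  (forall x, A x -> w k x @[k --> \oo] --> G x) -> (forall k x, A x -> `|w k x| <= Hd x) ->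
  m.-integrable setT (EFin \o (fun x => G x * \1_A x * gaussn 1 x)).
Proof.
move=> mw wG wHd.
have [] := @dominated_cvg_Rintegral _ T R m setT (fun k x => w k x * \1_A x * gaussn 1 x)
  (fun x => G x * \1_A x * gaussn 1 x) _ measurableT _ _ intHd _ => //.
- move=> k; apply: measurable_funM; last exact: measurable_gaussn.
  exact: measurable_funM.
- move=> x _; apply: cvgM; last exact: cvg_cst.
  rewrite indicE; case: (boolP (x \in A)) => [/set_mem Ax|_].
    by apply: cvgM; [exact: wG|exact: cvg_cst].
  under eq_fun do rewrite mulr0; rewrite mulr0; exact: cvg_cst.
- move=> k x _; rewrite normrM (ger0_norm (gaussn_ge0 _ _)) ler_wpM2r ?gaussn_ge0//.
  rewrite indicE; case: (boolP (x \in A)) => [/set_mem Ax|_]; last by rewrite mulr0 normr0.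
  by rewrite mulr1 wHd.
Qed.

Lemma integrable_lim1 : m.-integrable setT (EFin \o (fun x => G1 x * \1_A x * gaussn 1 x)).
Proof. exact: (integrable_lim mu_). Qed.

Lemma integrable_lim2 : m.-integrable setT (EFin \o (fun x => G2 x * \1_A x * gaussn 1 x)).
Proof. exact: (integrable_lim mv_). Qed.

(** The Gaussian-weighted partial integrals are tested against the frequency [y], and the limit is
    computed twice: in [x] under the majorant [Hd], and in [xi] under the integrability of [F1]
    against the Gaussian. Only real parts appear; the imaginary part results from applying this to
    [F2] and [- F1], that is, after multiplication by [- i]. *)
Lemma inversion_component y :
  m.-integrable setT (EFin \o (fun xi => F1 xi * gaussn_hat 1 (tuple_sub xi y))) ->
  \int[m]_xi (F1 xi * gaussn_hat 1 (tuple_sub xi y)) = (2 * pi) ^+ n * (cosT f1 y + sinT f2 y) ->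
  cosT (fun x => G1 x * \1_A x * gaussn 1 x) y + sinT (fun x => G2 x * \1_A x * gaussn 1 x) y =
  cosT f1 y + sinT f2 y.
Proof.
move=> intF F1E.
have pi2 : 0 < 2 * pi :> R by rewrite mulr_gt0 ?pi_gt0.
have cos1 := @normr_cos_le1 R.
have sin1 := @normr_sin_le1 R.
pose w k x := gaussn 1 x * (u k x * cos (tuple_dot y x) + v k x * sin (tuple_dot y x)).
have mtrig (g : R -> R) : continuous g -> measurable_fun setT (fun x => g (tuple_dot y x)).
  move=> cg; under eq_fun do rewrite tuple_dotC.
  by apply: (measurableT_comp (continuous_measurable_fun cg)); exact: measurable_dotl.
have mw k : measurable_fun setT (w k).
  apply: measurable_funM; first exact: measurable_gaussn.
  by apply: measurable_funD; apply: measurable_funM => //;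
    [apply: mtrig; exact: continuous_cos|apply: mtrig; exact: continuous_sin].
have wb k x : `|w k x * \1_A x| <= 2 * (Hd x * gaussn 1 x).
  rewrite /w indicE; case: (boolP (x \in A)) => [/set_mem Ax|_]; last first.
    by rewrite mulr0 normr0 !mulr_ge0 ?gaussn_ge0.
  rewrite mulr1 normrM (ger0_norm (gaussn_ge0 _ _)) [leRHS](_ : _ = gaussn 1 x * (Hd x + Hd x)); last by ring.
  rewrite ler_wpM2l ?gaussn_ge0// (le_trans (ler_normD _ _))// lerD// normrM -[leRHS]mulr1 ler_pM ?uHd ?vHd//.
have [|||intw wlim] := @dominated_cvg_Rintegral _ T R m setT (fun k x => w k x * \1_A x)
  (fun x => gaussn 1 x * (G1 x * \1_A x * cos (tuple_dot y x) + G2 x * \1_A x * sin (tuple_dot y x)))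
  (fun x => 2 * (Hd x * gaussn 1 x)) measurableT _ _ (integrable_mull _ measurableT intHd).
- by move=> k; apply: measurable_funM.
- move=> x _; rewrite /w indicE; case: (boolP (x \in A)) => [/set_mem Ax|_].
    under eq_fun do rewrite mulr1; apply: cvgM; first exact: cvg_cst.
    by rewrite !mulr1; apply: cvgD; (apply: cvgM; last exact: cvg_cst); [exact: u_cvg|exact: v_cvg].
  under eq_fun do rewrite mulr0; rewrite !(mulr0, mul0r) addr0 mulr0; exact: cvg_cst.
- by move=> k x _; exact: wb.
have wE k : \int[m]_x (w k x * \1_A x) =
    (2 * pi) ^- n * \int[m]_xi (H1 k xi * gaussn_hat 1 (tuple_sub xi y)).
  pose w' x := gaussn 1 x * (waveRe (H1 k) (H2 k) (fun=> 0) x * cos (tuple_dot y x) +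
      waveIm (H1 k) (H2 k) (fun=> 0) x * sin (tuple_dot y x)).
  have ww' x : w k x = (2 * pi) ^- n * w' x by rewrite /w /w' /u /v; ring.
  have w'w x : w' x = (2 * pi) ^+ n * w k x by rewrite ww' mulrA mulfV ?mul1r// expf_neq0// gt_eqF.
  have mw' : measurable_fun setT w'.
    by rewrite (funext w'w); exact: measurable_funM.
  have i1 : m.-integrable setT (EFin \o (fun x => w' x * \1_A x)).
    rewrite (_ : (fun x => _) = (fun x => (2 * pi) ^+ n * (w k x * \1_A x))).
      apply: integrable_mull => //; apply: (le_integrableR _ _ (integrable_mull 2 measurableT intHd)) => //.
      exact: measurable_funM.
    by apply/funext => x; rewrite w'w mulrA.
  rewrite -(@integral_gaussn_wave _ (H2 k))// -/w' -(conull_Rintegral mA A0 mw') -RintegralZl//.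
  by congr Rintegral; apply/funext => x; rewrite ww' mulrA.
have Hlim : \int[m]_xi (H1 k xi * gaussn_hat 1 (tuple_sub xi y)) @[k --> \oo] -->
    \int[m]_xi (F1 xi * gaussn_hat 1 (tuple_sub xi y)).
  have intF' : m.-integrable setT (EFin \o (fun xi => `|F1 xi * gaussn_hat 1 (tuple_sub xi y)|)).
    exact: (integrable_abse intF).
  have [|||//] := @dominated_cvg_Rintegral _ T R m setT (fun k xi => H1 k xi * gaussn_hat 1 (tuple_sub xi y))
    (fun xi => F1 xi * gaussn_hat 1 (tuple_sub xi y))
    (fun xi => `|F1 xi * gaussn_hat 1 (tuple_sub xi y)|) measurableT _ _ intF' _.
  - move=> k; have /measurable_EFinP ? := measurable_int _ (intH1 k).
    apply: measurable_funM => //; apply: (measurableT_comp (@measurable_gaussn_hat R n 1)).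
    exact: (measurableT_comp (@measurable_tuple_sub R n) (measurable_fun_pair (@measurable_id _ T setT) (measurable_cst y))).
  - move=> xi _; apply: cvgM; last exact: cvg_cst.
    apply: cvg_near_cst; near=> k; rewrite /H1 indicE mem_set ?mulr1//; near: k; exact: D_cvg.
  - move=> k xi _; rewrite /H1 normrM [leRHS]normrM ler_wpM2r// normrM ler_piMr//.
    by rewrite indicE ger0_norm// lern1 leq_b1.
have wlim' : \int[m]_x (w k x * \1_A x) @[k --> \oo] -->
    (2 * pi) ^- n * \int[m]_xi (F1 xi * gaussn_hat 1 (tuple_sub xi y)).
  by under eq_fun do rewrite wE; apply: cvgM => //; exact: cvg_cst.
have := cvg_unique _ wlim wlim'.
rewrite F1E mulrA mulVf ?mul1r ?expf_neq0 ?gt_eqF// => <- //.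
rewrite /cosT /sinT -RintegralD//; last 2 first.
- by apply: integrable_cosT; exact: integrable_lim1.
- by apply: integrable_sinT; exact: integrable_lim2.
by congr Rintegral; apply/funext => x; rewrite tuple_dotC; ring.
Unshelve. all: by end_near. Qed.

End component.

Definition tuple_opp y : T := [tuple - tnth y i | i < n].

Lemma cosT_opp h y : cosT h (tuple_opp y) = cosT h y.
Proof.
congr Rintegral; apply/funext => x; congr (_ * _); rewrite -cosN; congr cos.
by rewrite /tuple_dot -sumrN; apply: eq_bigr => i _; rewrite tnth_mktuple mulrN opprK.
Qed.

Lemma sinT_opp h y : m.-integrable setT (EFin \o h) -> sinT h (tuple_opp y) = - sinT h y.
Proof.
move=> ih; rewrite /sinT -mulN1r -RintegralZl//; last exact: integrable_sinT.
congr Rintegral; apply/funext => x; rewrite mulN1r -mulrN; congr (_ * _); rewrite -sinN; congr sin.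
by rewrite /tuple_dot -sumrN; apply: eq_bigr => i _; rewrite tnth_mktuple mulrN.
Qed.

Lemma cgauss_poly1 y x : cgauss_poly (fun=> 1) y x = (gaussn_at 1 y x)%:C.
Proof.
by rewrite /cgauss_poly /gauss_poly; congr (_%:C); apply: eq_bigr => i _; rewrite hornerC mul1r.
Qed.

(** Translation by [y] becomes modulation by the phase [- tuple_dot y x]; the sine part is the
    cosine formula with phase [- (pi / 2)]. *)
Lemma fourier_cgauss_poly1 y x : fourier_schwartz (cgauss_poly (fun=> 1) y) x =
  (gaussn_hat 1 x * cos (tuple_dot y x)) +i* (- (gaussn_hat 1 x * sin (tuple_dot y x))).
Proof.
rewrite /fourier_schwartz /cintegral; congr (_ +i* _).
  transitivity (\int[m]_xi (gaussn_at 1 y xi * cos (tuple_dot x xi + 0))).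
    congr Rintegral; apply/funext => xi; rewrite cgauss_poly1 /=.
    by rewrite cosN mulr0 subr0 mulrC addr0.
  by rewrite integral_gaussn_at_cos// addr0 tuple_dotC.
transitivity (\int[m]_xi (- 1 * (gaussn_at 1 y xi * cos (tuple_dot x xi + - (pi / 2))))).
  congr Rintegral; apply/funext => xi; rewrite cgauss_poly1 /=.
  by rewrite -sinE sinN mulr0 add0r; ring.
rewrite RintegralZl//; last by apply: integrable_gaussn_at_cos; rewrite oner_neq0.
by rewrite integral_gaussn_at_cos// -sinE mulN1r tuple_dotC.
Qed.

(** * Inversion from the definition of the Fourier transform by duality *)

Section tempered.
Variables (f F : T -> R[i]) (G1 G2 Hd : T -> R) (D : nat -> set T) (A : set T).
Hypothesis tf : tempered_function f.
Hypothesis fF : is_fourier f F.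
Hypothesis D_cvg : forall xi, \forall k \near \oo, D k xi.
Hypothesis mA : measurable A.
Hypothesis A0 : m (~` A) = 0%E.
Let H1 k xi := Re (F xi) * \1_(D k) xi.
Let H2 k xi := Im (F xi) * \1_(D k) xi.
Hypothesis intH1 : forall k, m.-integrable setT (EFin \o H1 k).
Hypothesis intH2 : forall k, m.-integrable setT (EFin \o H2 k).
Let u k x := (2 * pi) ^- n * waveRe (H1 k) (H2 k) (fun=> 0) x.
Let v k x := (2 * pi) ^- n * waveIm (H1 k) (H2 k) (fun=> 0) x.
Hypothesis u_cvg : forall x, A x -> u k x @[k --> \oo] --> G1 x.
Hypothesis v_cvg : forall x, A x -> v k x @[k --> \oo] --> G2 x.
Hypothesis Hd0 : forall x, 0 <= Hd x.
Hypothesis uHd : forall k x, A x -> `|u k x| <= Hd x.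
Hypothesis vHd : forall k x, A x -> `|v k x| <= Hd x.
Hypothesis intHd : m.-integrable setT (EFin \o (fun x => Hd x * gaussn 1 x)).

Let pi2 : 0 < 2 * pi :> R. Proof. by rewrite mulr_gt0 ?pi_gt0. Qed.

Let tempered_gauss (g : T -> R[i]) y : tempered_function g ->
  m.-integrable setT (EFin \o (fun x => Re (g x) * gaussn_at 1 y x)) /\
  m.-integrable setT (EFin \o (fun x => Im (g x) * gaussn_at 1 y x)).
Proof.
case=> _ /(_ _ (schwartz_cgauss_poly (fun=> 1) y)) [i1 i2] _; split.
  rewrite (_ : (fun x => _) = (fun x => Re (g x * cgauss_poly (fun=> 1) y x)))//.
  by apply/funext => x; rewrite cgauss_poly1; case: (g x) => a b /=; rewrite mulr0 subr0.
rewrite (_ : (fun x => _) = (fun x => Im (g x * cgauss_poly (fun=> 1) y x)))//.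
by apply/funext => x; rewrite cgauss_poly1; case: (g x) => a b /=; rewrite mulr0 add0r.
Qed.

Let gaussn_hat_at y xi : gaussn_hat 1 (tuple_sub xi y) = Num.sqrt (2 * pi) ^+ n * gaussn_at 1 y xi.
Proof. by rewrite gaussn_hat1 gaussn_atE. Qed.

Let intF y :
  m.-integrable setT (EFin \o (fun xi => Re (F xi) * gaussn_hat 1 (tuple_sub xi y))) /\
  m.-integrable setT (EFin \o (fun xi => Im (F xi) * gaussn_hat 1 (tuple_sub xi y))).
Proof.
have [i1 i2] := tempered_gauss y fF.1.
split.
  rewrite (_ : (fun x => _) = (fun x => Num.sqrt (2 * pi) ^+ n * (Re (F x) * gaussn_at 1 y x))).
    exact: integrable_mull.
  by apply/funext => x; rewrite gaussn_hat_at; ring.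
rewrite (_ : (fun x => _) = (fun x => Num.sqrt (2 * pi) ^+ n * (Im (F x) * gaussn_at 1 y x))).
  exact: integrable_mull.
by apply/funext => x; rewrite gaussn_hat_at; ring.
Qed.

Let f1 x := Re (f x) * gaussn 1 x.
Let f2 x := Im (f x) * gaussn 1 x.

Let intf : m.-integrable setT (EFin \o f1) /\ m.-integrable setT (EFin \o f2).
Proof.
have [] := tempered_gauss [tuple 0 | i < n] tf.
by rewrite gaussn_at0.
Qed.

(** Duality tested on the Gaussian centred at [y]: a translate on the side of [F] is a modulation on
    the side of [f], hence a Fourier integral of [f] times the Gaussian. One factor
    [Num.sqrt (2 * pi) ^+ n] comes from [gaussn_hat] on each side. *)
Let fourier_pair y :
  \int[m]_xi (Re (F xi) * gaussn_hat 1 (tuple_sub xi y)) = (2 * pi) ^+ n * (cosT f1 y + sinT f2 y) /\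
  \int[m]_xi (Im (F xi) * gaussn_hat 1 (tuple_sub xi y)) = (2 * pi) ^+ n * (cosT f2 y - sinT f1 y).
Proof.
have [if1 if2] := intf.
have [iF1 iF2] := tempered_gauss y fF.1.
have := fF.2 _ (schwartz_cgauss_poly (fun=> 1) y).
rewrite /distribution_of /cintegral => -[E1 E2].
have pE : (2 * pi) ^+ n = Num.sqrt (2 * pi) ^+ n * Num.sqrt (2 * pi) ^+ n :> R.
  by rewrite -exprMn -expr2 sqr_sqrtr// ltW.
split.
  transitivity (Num.sqrt (2 * pi) ^+ n * \int[m]_xi Re (F xi * cgauss_poly (fun=> 1) y xi)).
    rewrite -RintegralZl//.
      congr Rintegral; apply/funext => xi; rewrite gaussn_hat_at cgauss_poly1.
      by case: (F xi) => a b /=; ring.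
    rewrite (_ : (fun x => _) = (fun x => Re (F x) * gaussn_at 1 y x))//.
    by apply/funext => x; rewrite cgauss_poly1; case: (F x) => a b /=; rewrite mulr0 subr0.
  rewrite E1 pE -mulrA; congr (_ * _).
  rewrite /cosT /sinT -RintegralD//; [|exact: integrable_cosT|exact: integrable_sinT].
  rewrite -RintegralZl//; last by apply: integrable_addR => //; [exact: integrable_cosT|exact: integrable_sinT].
  congr Rintegral; apply/funext => x; rewrite fourier_cgauss_poly1 gaussn_hat1 /f1 /f2 (tuple_dotC x y).
  by case: (f x) => a b /=; ring.
transitivity (Num.sqrt (2 * pi) ^+ n * \int[m]_xi Im (F xi * cgauss_poly (fun=> 1) y xi)).
  rewrite -RintegralZl//.
    congr Rintegral; apply/funext => xi; rewrite gaussn_hat_at cgauss_poly1.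
    by case: (F xi) => a b /=; ring.
  rewrite (_ : (fun x => _) = (fun x => Im (F x) * gaussn_at 1 y x))//.
  by apply/funext => x; rewrite cgauss_poly1; case: (F x) => a b /=; rewrite mulr0 add0r.
rewrite E2 pE -mulrA; congr (_ * _).
rewrite /cosT /sinT -RintegralB//; [|exact: integrable_cosT|exact: integrable_sinT].
rewrite -RintegralZl//; last by apply: integrable_subR => //; [exact: integrable_cosT|exact: integrable_sinT].
congr Rintegral; apply/funext => x; rewrite fourier_cgauss_poly1 gaussn_hat1 /f1 /f2 (tuple_dotC x y).
by case: (f x) => a b /=; ring.
Qed.

Let g1 x := G1 x * \1_A x * gaussn 1 x.
Let g2 x := G2 x * \1_A x * gaussn 1 x.

Let intg1 : m.-integrable setT (EFin \o g1).
Proof. exact: (integrable_lim1 mA intH1 intH2 u_cvg Hd0 uHd intHd). Qed.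

Let intg2 : m.-integrable setT (EFin \o g2).
Proof. exact: (integrable_lim2 mA intH1 intH2 v_cvg Hd0 vHd intHd). Qed.

Let eq1 y : cosT g1 y + sinT g2 y = cosT f1 y + sinT f2 y.
Proof.
apply: (@inversion_component (fun xi => Re (F xi)) (fun xi => Im (F xi)) G1 G2 f1 f2 Hd D A) => //.
- exact: (intF y).1.
- exact: (fourier_pair y).1.
Qed.

Let cosTN h y : m.-integrable setT (EFin \o h) -> cosT (fun x => - h x) y = - cosT h y.
Proof.
move=> ih; rewrite /cosT -mulN1r -RintegralZl//; last exact: integrable_cosT.
by congr Rintegral; apply/funext => x; rewrite mulN1r mulNr.
Qed.

Let sinTN h y : m.-integrable setT (EFin \o h) -> sinT (fun x => - h x) y = - sinT h y.
Proof.
move=> ih; rewrite /sinT -mulN1r -RintegralZl//; last exact: integrable_sinT.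
by congr Rintegral; apply/funext => x; rewrite mulN1r mulNr.
Qed.

Let eq2 y : cosT g2 y - sinT g1 y = cosT f2 y - sinT f1 y.
Proof.
have [if1 if2] := intf.
have NH k : (fun xi => - Re (F xi) * \1_(D k) xi) = (fun xi => - H1 k xi).
  by apply/funext => xi; rewrite mulNr.
have intNH k : m.-integrable setT (EFin \o (fun xi => - H1 k xi)).
  rewrite (_ : (fun xi => _) = (fun xi => -1 * H1 k xi)); first exact: integrable_mull.
  by apply/funext => xi; rewrite mulN1r.
have wRe k x : waveRe (H2 k) (fun xi => - H1 k xi) (fun=> 0) x = waveIm (H1 k) (H2 k) (fun=> 0) x.
  by rewrite waveRe0// waveIm0// sinTN// opprK addrC.
have wIm k x : waveIm (H2 k) (fun xi => - H1 k xi) (fun=> 0) x = - waveRe (H1 k) (H2 k) (fun=> 0) x.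
  by rewrite waveRe0// waveIm0// cosTN// opprB.
rewrite -(sinTN y intg1) -(sinTN y if1).
rewrite (_ : (fun x => - g1 x) = (fun x => - G1 x * \1_A x * gaussn 1 x)); last first.
  by apply/funext => x; rewrite !mulNr.
apply: (@inversion_component (fun xi => Im (F xi)) (fun xi => - Re (F xi)) G2 (fun x => - G1 x)
  f2 (fun x => - f1 x) Hd D A) => //.
- by move=> k; rewrite NH.
- by move=> x Ax; under eq_fun do rewrite NH wRe; exact: v_cvg.
- by move=> x Ax; under eq_fun do rewrite NH wIm mulrN; apply: cvgN; exact: u_cvg.
- by move=> k x Ax; rewrite NH wRe vHd.
- by move=> k x Ax; rewrite NH wIm mulrN normrN uHd.
- exact: (intF y).2.
- by rewrite sinTN//; exact: (fourier_pair y).2.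
Qed.

(** [f] and the limit are compared after multiplication by a Gaussian, which makes both integrable;
    as the Gaussian vanishes nowhere, it is divided out at the end. *)
Lemma tempered_inversion : {ae m, forall x, f x = G1 x +i* G2 x}.
Proof.
have [if1 if2] := intf.
have cosTB h h' y : m.-integrable setT (EFin \o h) -> m.-integrable setT (EFin \o h') ->
    cosT (fun x => h x - h' x) y = cosT h y - cosT h' y.
  move=> ih ih'; rewrite /cosT -RintegralB//; [|exact: integrable_cosT|exact: integrable_cosT].
  by congr Rintegral; apply/funext => x; rewrite mulrBl.
have sinTB h h' y : m.-integrable setT (EFin \o h) -> m.-integrable setT (EFin \o h') ->
    sinT (fun x => h x - h' x) y = sinT h y - sinT h' y.
  move=> ih ih'; rewrite /sinT -RintegralB//; [|exact: integrable_sinT|exact: integrable_sinT].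
  by congr Rintegral; apply/funext => x; rewrite mulrBl.
have d1 := fourier_transform_eq0 (integrable_subR measurableT if1 intg1).
have d2 := fourier_transform_eq0 (integrable_subR measurableT if2 intg2).
(* Each identity mixes the cosine transform of one component with the sine transform of the other.
   The first is even and the second odd in the frequency, so the values at [y] and at its opposite
   separate them. *)
have E y := (eq1 y, eq2 y, eq1 (tuple_opp y), eq2 (tuple_opp y)).
have {}d1 : {ae m, forall x, f1 x - g1 x = 0}.
  apply: d1 => y; have := E y; rewrite !cosT_opp !sinT_opp//; rewrite ?cosTB ?sinTB//.
    by case=> [[[? ?] ?] ?]; lra.
  by case=> [[[? ?] ?] ?]; lra.
have {}d2 : {ae m, forall x, f2 x - g2 x = 0}.
  apply: d2 => y; have := E y; rewrite !cosT_opp !sinT_opp//; rewrite ?cosTB ?sinTB//.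
    by case=> [[[? ?] ?] ?]; lra.
  by case=> [[[? ?] ?] ?]; lra.
have aeA : {ae m, forall x, A x}.
  by exists (~` A); split => //; exact: measurableC.
have gn0 x : gaussn 1 x != 0 :> R.
  by apply/prodf_neq0 => i _; rewrite gt_eqF// expR_gt0.
move: d1 d2 aeA; apply: filterS3 => x; rewrite /f1 /f2 /g1 /g2 => e1 e2 Ax.
move: e1 e2; rewrite indicE mem_set// !mulr1 -!mulrBl => /eqP; rewrite mulf_eq0 (negPf (gn0 x)) orbF subr_eq0 => /eqP e1.
move=> /eqP; rewrite mulf_eq0 (negPf (gn0 x)) orbF subr_eq0 => /eqP e2.
by move: e1 e2; case: (f x) => a b /= -> ->.
Qed.

End tempered.

End inversion.

(** * Convergence along blocks *)

Section sequences.
Context {R : realType}.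


Lemma cvg_blocks (N : nat -> nat) (S e : nat -> R) (l : R) :
  {homo N : i j / (i <= j)%N} -> (forall m, exists k, (m < N k)%N) ->
  S (N m) @[m --> \oo] --> l -> e m @[m --> \oo] --> 0 ->
  (\forall m \near \oo, forall i, (N m <= i <= N m.+1)%N -> `|S i - S (N m)| <= e m) ->
  S i @[i --> \oo] --> l.
Proof.
move=> Nm Noo SN e0 Se; apply/cvgrPdist_le => eps eps0.
have eps2 : 0 < eps / 2 by rewrite divr_gt0.
move/cvgrPdist_le : SN => /(_ _ eps2) H1.
move/cvgrPdist_le : e0 => /(_ _ eps2) H2.
have [M _ HM] := filterI (filterI H1 H2) Se.
exists (N M) => // i /= NMi.
have [k ik] := Noo i.
have exP : exists k, (i < N k)%N by exists k.
(* The predecessor of the least [k] with [i < N k] is the block that contains [i]. *)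
case: (ex_minnP exP) => m im mmin.
have Mm : (M < m)%N.
  by rewrite ltnNge; apply/negP => /Nm; rewrite leqNgt (leq_ltn_trans NMi im).
case: m im mmin Mm => // m im mmin Mm.
have Nmi : (N m <= i)%N by rewrite leqNgt; apply/negP => /mmin; rewrite ltnn.
have [[A B] D] := HM m Mm.
have := D i; rewrite Nmi (ltnW im) => /(_ isT) {}D.
rewrite sub0r normrN in B.
rewrite (_ : l - S i = (l - S (N m)) - (S i - S (N m))); last by ring.
rewrite (le_trans (ler_normB _ _))// [leRHS](splitr eps) lerD//.
by rewrite (le_trans D)// (le_trans (ler_norm _)).
Qed.

(** Weierstrass's test: the increments are dominated by the terms of a convergent series, uniformly
    on [E], so that the limit inherits along [E] the continuity at 0 of each [S m]. *)
Lemma cvg_limit_within (E : set R) (S : nat -> R -> R) (h : nat -> R) :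
  E 0 -> (forall m, 0 <= h m) -> cvgn (series h) ->
  (forall m t, E t -> `|S m.+1 t - S m t| <= h m) ->
  (forall m, {for 0, continuous (S m)}) ->
  (forall t, E t -> S m t @[m --> \oo] --> limn (S ^~ t)) /\
  (limn (S ^~ t) @[t --> within E 0^'] --> limn (S ^~ 0)).
Proof.
move=> E0 h0 ch Sh cS.
have tele t p q : E t -> (p <= q)%N -> `|S q t - S p t| <= series h q - series h p.
  move=> Et; elim: q => [|q ih]; first by rewrite leqn0 => /eqP ->; rewrite !subrr normr0.
  rewrite leq_eqVlt => /predU1P[->|pq]; first by rewrite !subrr normr0.
  rewrite (_ : S q.+1 t - S p t = (S q.+1 t - S q t) + (S q t - S p t)); last by ring.
  rewrite seriesSr (le_trans (ler_normD _ _))//.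
  by have := ih pq; have := Sh q t Et; lra.
have mono : {homo series h : p q / (p <= q)%N >-> p <= q}.
  by move=> p q pq; have := tele 0 p q E0 pq; have := normr_ge0 (S q 0 - S p 0); lra.
pose s := limn (series h).
have hs p : series h p <= s by exact: nondecreasing_cvgn_le.
have cS' t : E t -> cvgn (S ^~ t).
  move=> Et; apply: cauchy_cvg; apply/cauchy_exP => eps eps0.
  have /cvgrPdist_lt/(_ eps eps0)[M _ HM] := ch.
  exists (S M t); exists M => // p /= Mp; rewrite /ball /= distrC.
  have := tele t M p Et Mp; have := HM M (leqnn _); have := hs p; rewrite -/s.
  by rewrite ltr_norml => ? /andP[? ?] ?; lra.
have lim t : E t -> S m t @[m --> \oo] --> limn (S ^~ t) by move/cS'.
split=> //; apply/cvgrPdist_le => eps eps0.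
have eps3 : 0 < eps / 3 by rewrite divr_gt0.
have /cvgrPdist_lt/(_ _ eps3)[M _ HM] := ch.
have close t : E t -> `|limn (S ^~ t) - S M t| <= eps / 3.
  move=> Et.
  have cB : `|S m t - S M t| @[m --> \oo] --> `|limn (S ^~ t) - S M t|.
    by apply: cvg_norm; apply: cvgB; [exact: lim|exact: cvg_cst].
  rewrite -(cvg_lim _ cB)//; apply: limr_le; first by apply/cvg_ex; eexists; exact: cB.
  exists M => // q /= Mq; rewrite (le_trans (tele t M q Et Mq))//.
  have := HM M (leqnn _); have := hs q; rewrite -/s ltr_norml => ? /andP[? ?]; lra.
have /cvgrPdist_le/(_ _ eps3) := cS M => near0.
rewrite near_withinE; apply: nbhs_dnbhs; apply: filterS near0 => t Ht Et.
have C0 := close 0 E0; have Ct := close t Et.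
rewrite (_ : _ - _ = (limn (S ^~ 0) - S M 0) + (S M 0 - S M t) - (limn (S ^~ t) - S M t)); last by ring.
rewrite (le_trans (ler_normB _ _))//.
have := ler_normD (limn (S ^~ 0) - S M 0) (S M 0 - S M t); lra.
Qed.

Lemma cvg_complex (T : Type) (G : set_system T) {FG : Filter G} (u v : T -> R) (a b : R) :
  u @ G --> a -> v @ G --> b ->
  ((fun t => (u t +i* v t : R[i]^o)) : T -> R[i]^o) @ G --> ((a +i* b) : R[i]^o).
Proof.
move=> ua vb; apply/cvgrPdist_lt => /= eps; case: eps => e1 im.
rewrite ltcE /= => /andP[/eqP im0 e10]; rewrite im0.
have e2 : 0 < e1 / 2 by rewrite divr_gt0.
move/cvgrPdist_lt : ua => /(_ _ e2) H1.
move/cvgrPdist_lt : vb => /(_ _ e2) H2.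
move: H1 H2; apply: filterS2 => t H1 H2.
rewrite normc_def /= ltcE /= eqxx/=.
apply: (@le_lt_trans _ _ (`|a - u t| + `|b - v t|)).
  rewrite -[leRHS]ger0_norm ?addr_ge0// -sqrtr_sqr ler_wsqrtr//.
  rewrite -(real_normK (num_real (a - u t))) -(real_normK (num_real (b - v t))).
  have := normr_ge0 (a - u t); have := normr_ge0 (b - v t); nra.
by lra.
Qed.

(** A finite infimum of natural numbers is attained; passing to closed intervals forgets the choices
    of endpoints. *)
Lemma covering_number_attained (E : set R) (r : R) : (covering_number E r < +oo)%E ->
  exists N (c : 'I_N -> R), covering_number E r = (N%:R : R)%:E /\
    forall t, E t -> exists l, c l <= t <= c l + r.
Proof.
rewrite /covering_number => H.
pose P N := `[< exists (b b' : 'I_N -> bool) (c : 'I_N -> R),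
      E `<=` \bigcup_l
        [set` Interval (BSide (b l) (c l)) (BSide (b' l) (c l + r))] >].
have exP : exists N, P N.
  apply: contrapT => /forallNP nP; move: H; rewrite (_ : [set _ | _ in _] = set0) ?ereal_inf0//.
  by rewrite -subset0 => y [N HN _]; apply: (nP N); apply/asboolP.
case: (ex_minnP exP) => N /asboolP PN Nmin.
have [b [b' [c Ec]]] := PN; exists N, c; split.
  apply/eqP; rewrite eq_le; apply/andP; split; first by apply: ereal_inf_lbound; exists N.
  apply: le_ereal_inf_tmp => _ [M HM <-]; rewrite lee_fin ler_nat; apply: Nmin; exact/asboolP.
move=> t /Ec[l _ /= tl]; exists l.
by move: tl; rewrite /= in_itv/=; case: (b l); case: (b' l) => /andP[/= ? ?]; lra.
Qed.

End sequences.

(** * Frequency scales *)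

Section scales.
Context {R : realType}.
Variable a : R.
Hypothesis a0 : 0 < a.

Definition dyscale m : nat := Num.truncn ((2 : R) `^ (m%:R / a)).

Let y_ m : R := 2 `^ (m%:R / a).

Let y_ge1 m : 1 <= y_ m.
Proof.
rewrite -[leLHS](powRr0 2) ler_powR ?ler1n// divr_ge0 ?ler0n// ltW//.
Qed.

Lemma dyscale_gt0 m : (0 < dyscale m)%N.
Proof. by rewrite truncn_gt0 y_ge1. Qed.

Lemma dyscale_le m : (dyscale m)%:R <= (2 : R) `^ (m%:R / a).
Proof. by rewrite truncn_le powR_ge0. Qed.

Lemma dyscale_ge m : (2 : R) `^ (m%:R / a) <= 2 * (dyscale m)%:R.
Proof.
have := truncnS_gt (y_ m); have : (1 : R) <= (dyscale m)%:R by rewrite ler1n dyscale_gt0.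
by rewrite /dyscale -/(y_ m) -natr1; lra.
Qed.

Lemma dyscale_homo : {homo dyscale : i j / (i <= j)%N}.
Proof.
move=> i j ij; apply: le_truncn; rewrite ler_powR ?ler1n//.
by rewrite ler_pM2r ?invr_gt0// ler_nat.
Qed.

Lemma dyscale_unbounded k : exists m, (k < dyscale m)%N.
Proof.
exists (Num.truncn (a * k.+1%:R)).+1; rewrite truncn_gt_nat.
apply: (@le_trans _ _ (2 `^ (k.+1%:R))).
  by rewrite powR_mulrn// -natrX ler_nat ltnW// ltn_expl.
rewrite ler_powR ?ler1n// ler_pdivlMr// mulrC ltW//; exact: truncnS_gt.
Qed.

(** The number of levels for the chaining between the scales [m] and [m + 1]: [2 ^ dylevel m] is at
    least the number of cubes to cross, yet [dylevel m] is of linear growth in [m]. *)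
Definition dylevel m : nat := (Num.truncn (m.+1%:R / a)).+1.

Lemma dyscale_dylevel m : (dyscale m.+1 <= 2 ^ dylevel m)%N.
Proof.
rewrite -(ler_nat R) (le_trans (dyscale_le _))// natrX -powR_mulrn//.
rewrite ler_powR ?ler1n// ltW//; exact: truncnS_gt.
Qed.

Lemma dylevel_bound (k : R) : 0 < k -> exists C, forall m,
  (dylevel m).+1%:R ^+ 2 * 2 `^ (- (m%:R * k / 2)) <= C.
Proof.
move=> k0; have l2 : 0 < ln (2 : R) by rewrite ln_gt0// ltr1n.
(* With [y = m%:R * b], the power of 2 is the square of [expR (- y)]. As the level plus one is at
   most [m.+1%:R / a + 2], the constant [c] is made for it to be at most [c * (1 + y)], hence at
   most [c * expR y]. *)
pose b := k / 4 * ln 2; have b0 : 0 < b by rewrite mulr_gt0// divr_gt0.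
pose c : R := a^-1 + 2 + (a * b)^-1.
have ai : 0 < a^-1 by rewrite invr_gt0.
have abi : 0 < (a * b)^-1 by rewrite invr_gt0 mulr_gt0.
exists (c ^+ 2) => m; set y := m%:R * b.
have y0 : 0 <= y by rewrite mulr_ge0// ltW.
have -> : 2 `^ (- (m%:R * k / 2)) = expR (- y) ^+ 2 :> R.
  rewrite /powR pnatr_eq0/= -expRM_natl; congr expR; rewrite /y /b; by field.
rewrite -exprMn; rewrite ler_sqr ?nnegrE; last 2 first.
- by rewrite mulr_ge0 ?expR_ge0.
- by rewrite /c; lra.
rewrite expRN ler_pdivrMr ?expR_gt0//.
apply: (@le_trans _ _ (c * (1 + y))); last first.
  by rewrite ler_wpM2l ?expR_ge1Dx// /c; lra.
have : (Num.truncn (m.+1%:R / a))%:R <= m.+1%:R / a by rewrite truncn_le divr_ge0// ltW.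
rewrite /dylevel -!natr1 => H.
have E : y * (a * b)^-1 = m%:R / a by rewrite /y; field; rewrite !gt_eqF.
have : c * (1 + y) = a^-1 + 2 + (a * b)^-1 + y * a^-1 + y * 2 + y * (a * b)^-1.
  by rewrite /c; ring.
rewrite E => ->.
move: H; rewrite mulrDl mul1r.
have : 0 <= y * a^-1 by rewrite mulr_ge0// ltW.
lra.
Qed.

Variable n : nat.
Implicit Types xi : n.-tuple R.

Definition freq xi : R := enorm xi `^ a.

Lemma freq_ge0 xi : 0 <= freq xi. Proof. exact: powR_ge0. Qed.

Lemma measurable_freq : measurable_fun setT freq.
Proof.
apply: (measurableT_comp (measurable_powR _)) => //; exact: measurable_enorm.
Qed.

Lemma freq_cube m xi : cube (dyscale m) xi -> freq xi <= n%:R `^ a * 2 ^+ m.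
Proof.
move=> cx; have -> : (2 : R) ^+ m = (2 `^ (m%:R / a)) `^ a.
  by rewrite -powRrM divfK ?gt_eqF// powR_mulrn.
rewrite -powRM ?powR_ge0//; apply: ge0_ler_powR; rewrite ?nnegrE ?enorm_ge0 ?mulr_ge0 ?powR_ge0 ?(ltW a0)//.
rewrite (le_trans (enorm_le_sum xi))// -[in leRHS](card_ord n) mulr_natl -sumr_const.
apply: ler_sum => i _; rewrite (le_trans (cx i))//.
rewrite (le_trans _ (dyscale_le m))// ler_pdivrMr// ler_peMr//; lra.
Qed.

Lemma enorm_cubeC m xi : ~ cube (dyscale m) xi -> 2 `^ (m%:R / a) <= 4 * enorm xi.
Proof.
move=> /existsNP[i /negP]; rewrite -ltNge => Hi.
apply: (@le_trans _ _ (4 * `|tnth xi i|)).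
  by have := dyscale_ge m; lra.
rewrite ler_wpM2l// -sqrtr_sqr ler_wsqrtr// (bigD1 i)//= lerDl.
by apply: sumr_ge0 => j _; exact: sqr_ge0.
Qed.

(** Outside the cube [2]^ (m%:R / a)[is at most]4 * enorm xi[: a factor 2 is lost in the integer
    part and another because the cube has half-side]N /
    2[. Squaring and raising to the power]s[yields]16 [^ s]. *)
Lemma weight_cubeC (s : R) m xi : 0 < s -> ~ cube (dyscale m) xi ->
  1 <= 16 `^ s * 2 `^ (- (2 * m%:R * s / a)) * (1 + enorm xi ^+ 2) `^ s.
Proof.
move=> s0 /enorm_cubeC H.
rewrite powRN mulrAC ler_pdivlMr ?powR_gt0// mul1r.
have e2 : 0 <= enorm xi ^+ 2 by exact: sqr_ge0.
rewrite -powRM ?addr_ge0//.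
have -> : 2 `^ (2 * m%:R * s / a) = ((2 `^ (m%:R / a)) ^+ 2) `^ s :> R.
  rewrite -powR_mulrn ?powR_ge0// -!powRrM; congr (_ `^ _); field; exact: lt0r_neq0.
apply: ge0_ler_powR; rewrite ?nnegrE ?mulr_ge0 ?addr_ge0 ?sqr_ge0 ?(ltW s0)//.
have := powR_ge0 2 (m%:R / a) : 0 <= (2 : R) `^ _.
nra.
Qed.

End scales.

(** * Partial integrals over cubes and their frequency blocks *)

Section cuts.
Context {R : realType} {n : nat}.
Notation T := (n.-tuple R).
Notation m := (@lebesgue_tuple R n).
Implicit Types (A B : set T) (H : T -> R) (xi x : T) (t : R).

Definition cutoff B H xi : R := H xi * \1_B xi.

Lemma measurable_cutoff B H : measurable B -> measurable_fun setT H -> measurable_fun setT (cutoff B H).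
Proof. by move=> mB mH; exact: measurable_funM. Qed.

Variables (F1 F2 : T -> R) (a s : R).
Hypothesis mF1 : measurable_fun setT F1.
Hypothesis mF2 : measurable_fun setT F2.
Hypothesis s0 : 0 < s.

Definition density xi : R := F1 xi ^+ 2 + F2 xi ^+ 2.
(** When [F1] and [F2] are the real and imaginary parts of [fourier f], this is the integrand of the
    squared Sobolev norm. *)
Definition weight xi : R := (1 + enorm xi ^+ 2) `^ s * density xi.

Hypothesis intw : m.-integrable setT (EFin \o weight).

Lemma density_ge0 xi : 0 <= density xi.
Proof. by rewrite addr_ge0 ?sqr_ge0. Qed.

Lemma measurable_density : measurable_fun setT density.
Proof. by apply: measurable_funD; exact: measurable_funX. Qed.

Let enorm1 xi : 1 <= (1 + enorm xi ^+ 2) `^ s.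
Proof.
rewrite -[leLHS](powRr0 (1 + enorm xi ^+ 2)) ler_powR ?(ltW s0)//.
by rewrite lerDl sqr_ge0.
Qed.

Lemma density_le_weight xi : density xi <= weight xi.
Proof. by rewrite /weight ler_peMl// density_ge0. Qed.

Lemma weight_ge0 xi : 0 <= weight xi.
Proof. exact: le_trans (density_ge0 xi) (density_le_weight xi). Qed.

Lemma indic_le1 B xi : 0 <= (\1_B xi : R) <= 1.
Proof. by rewrite indicE; case: (_ \in _); rewrite /= lexx ler01. Qed.

Lemma integrable_cut_density B : measurable B -> m.-integrable setT (EFin \o cutoff B density).
Proof.
move=> mB; apply: (le_integrableR _ _ intw) => //.
  by apply: measurable_cutoff => //; exact: measurable_density.
move=> xi _; have /andP[i0 i1] := indic_le1 B xi.
rewrite /cutoff ger0_norm ?mulr_ge0 ?density_ge0// (le_trans _ (density_le_weight xi))//.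
by rewrite ler_piMr// density_ge0.
Qed.

Lemma integrable_cut_weight B : measurable B -> m.-integrable setT (EFin \o cutoff B weight).
Proof.
move=> mB; apply: (le_integrableR _ _ intw) => //.
  apply: measurable_cutoff => //.
  by have /measurable_EFinP := measurable_int _ intw.
move=> xi _; have /andP[i0 i1] := indic_le1 B xi.
by rewrite /cutoff ger0_norm ?(mulr_ge0 (weight_ge0 xi) i0)// ler_piMr// weight_ge0.
Qed.

Lemma integrable_indic_cube N : m.-integrable setT (EFin \o (\1_(@cube R n N) : T -> R)).
Proof.
apply/integrableP; split.
  by apply/measurable_EFinP; apply: measurable_indic; exact: measurable_cube.
under eq_integral => xi _.
  rewrite /= ger0_norm; last by have /andP[] := indic_le1 (cube N) xi.
  over.
rewrite integral_indic//; last exact: measurable_cube.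
rewrite setIT; suff : (lebesgue_tuple n (@cube R n N) < +oo)%E by [].
by rewrite lebesgue_tuple_cube ltry.
Qed.

(** [|H| <= 1 + H ^+ 2] on a bounded set: the constant is integrable because cubes have finite
    measure, the square because of the weight. *)
Lemma integrable_cutoff H B N : measurable_fun setT H -> (forall xi, H xi ^+ 2 <= density xi) ->
  measurable B -> B `<=` cube N -> m.-integrable setT (EFin \o cutoff B H).
Proof.
move=> mH Hd mB BN.
apply: (le_integrableR _ _ (integrable_addR measurableT (integrable_indic_cube N) intw)) => //.
  exact: measurable_cutoff.
move=> xi _; rewrite /cutoff; have /andP[i0 i1] := indic_le1 B xi.
have [xB|xB] := boolP (xi \in B); last first.
  by rewrite indicE (negPf xB) mulr0 normr0 addr_ge0 ?weight_ge0//; have /andP[] := indic_le1 (cube N) xi.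
rewrite !indicE xB mulr1 mem_set /= ?mulr1n; last by apply: BN; exact/set_mem.
have := density_le_weight xi; have := Hd xi.
by rewrite -(real_normK (num_real (H xi))); have := sqr_ge0 (`|H xi| - 1); nra.
Qed.

Lemma integrable_cut1 B N : measurable B -> B `<=` cube N -> m.-integrable setT (EFin \o cutoff B F1).
Proof. by apply: integrable_cutoff => // xi; rewrite lerDl sqr_ge0. Qed.

Lemma integrable_cut2 B N : measurable B -> B `<=` cube N -> m.-integrable setT (EFin \o cutoff B F2).
Proof. by apply: integrable_cutoff => // xi; rewrite lerDr sqr_ge0. Qed.

(** Cumulative quantities, so that those of a block are increments: they telescope over the scales
    and are additive over subblocks, as chaining requires. *)
Definition mass N : R := \int[m]_xi cutoff (cube N) density xi.
Definition wmass N : R := \int[m]_xi cutoff (cube N) weight xi.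

Let mcube N : measurable (@cube R n N). Proof. exact: measurable_cube. Qed.

Lemma indic_cubeD N M xi : (N <= M)%N -> \1_(cube M `\` cube N) xi = \1_(cube M) xi - \1_(cube N) xi :> R.
Proof.
move=> NM; rewrite !indicE in_setD; have [xN|xN] := boolP (xi \in cube N).
  by rewrite (mem_set (subset_cube NM (set_mem xN)))/= subrr.
by rewrite subr0 andbT.
Qed.

Lemma integral_cubeD H N M : (N <= M)%N -> m.-integrable setT (EFin \o cutoff (cube N) H) ->
  m.-integrable setT (EFin \o cutoff (cube M) H) ->
  \int[m]_xi cutoff (cube M `\` cube N) H xi = \int[m]_xi cutoff (cube M) H xi - \int[m]_xi cutoff (cube N) H xi.
Proof.
move=> NM i1 i2; rewrite -RintegralB//; congr Rintegral; apply/funext => xi.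
by rewrite /cutoff indic_cubeD// mulrBr.
Qed.

Lemma mass_homo : {homo mass : i j / (i <= j)%N >-> i <= j}.
Proof.
move=> i j ij; rewrite -subr_ge0 -integral_cubeD//; [|exact: integrable_cut_density|exact: integrable_cut_density].
apply: Rintegral_ge0 => xi _; rewrite mulr_ge0 ?density_ge0//; by have /andP[] := indic_le1 (cube j `\` cube i) xi.
Qed.

Lemma wmass_le N : wmass N <= \int[m]_xi weight xi.
Proof.
apply: le_Rintegral => //; first exact: integrable_cut_weight.
by move=> xi _; rewrite /cutoff ler_piMr ?weight_ge0//; have /andP[] := indic_le1 (cube N) xi.
Qed.

Lemma wmass_ge0 N : 0 <= wmass N.
Proof.
apply: Rintegral_ge0 => xi _; apply: mulr_ge0; first exact: weight_ge0.
by have /andP[] := indic_le1 (cube N) xi.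
Qed.

Hypothesis a0 : 0 < a.

Let N_ := dyscale a.

Lemma mass_block k : mass (N_ k.+1) - mass (N_ k) <=
  16 `^ s * 2 `^ (- (2 * k%:R * s / a)) * (wmass (N_ k.+1) - wmass (N_ k)).
Proof.
have Nk : (N_ k <= N_ k.+1)%N by exact: dyscale_homo.
rewrite -!integral_cubeD//; do ?[exact: integrable_cut_density|exact: integrable_cut_weight].
have iw : m.-integrable setT (EFin \o cutoff (cube (N_ k.+1) `\` cube (N_ k)) weight).
  by apply: integrable_cut_weight; exact: measurableD.
rewrite -RintegralZl//; apply: le_Rintegral => //.
- by apply: integrable_cut_density; exact: measurableD.
- exact: integrable_mull.
move=> xi _; rewrite /cutoff indicE; case: (boolP (xi \in _)) => [/set_mem[_ xN]|_]; last by rewrite !mulr0.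
rewrite !mulr1 /weight mulrA ler_peMl ?density_ge0//; exact: weight_cubeC.
Qed.

(** With [evolIm], the evolution restricted to the frequencies in [B], without the factor
    [(2 * pi) ^- n]. *)
Definition evolRe B t x : R := waveRe (cutoff B F1) (cutoff B F2) (fun xi => t * freq a xi) x.
Definition evolIm B t x : R := waveIm (cutoff B F1) (cutoff B F2) (fun xi => t * freq a xi) x.

Let mphase (f : R -> R) t x : continuous f ->
  measurable_fun setT (fun xi : T => f (tuple_dot xi x + t * freq a xi)).
Proof.
move=> cf; apply: (measurableT_comp (continuous_measurable_fun cf)).
apply: measurable_funD; first exact: measurable_dotl.
by apply: measurable_funM => //; exact: measurable_freq.
Qed.

Lemma integrable_phase H (f : R -> R) t x : m.-integrable setT (EFin \o H) -> continuous f ->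
  (forall y, `|f y| <= 1) ->
  m.-integrable setT (EFin \o (fun xi => H xi * f (tuple_dot xi x + t * freq a xi))).
Proof.
move=> iH cf f1; apply: (@integrableMr_bounded _ _ _ _ _ _ _ 1) => //.
exact: mphase.
Qed.

Let cos1 := @normr_cos_le1 R.
Let sin1 := @normr_sin_le1 R.

Let icut1 N : m.-integrable setT (EFin \o cutoff (cube N) F1).
Proof. exact: (integrable_cut1 (mcube N) (@subset_refl _ _)). Qed.

Let icut2 N : m.-integrable setT (EFin \o cutoff (cube N) F2).
Proof. exact: (integrable_cut2 (mcube N) (@subset_refl _ _)). Qed.

Lemma evolRe_cubeD N M t x : (N <= M)%N ->
  evolRe (cube M `\` cube N) t x = evolRe (cube M) t x - evolRe (cube N) t x.
Proof.
move=> NM; rewrite /evolRe /waveRe -RintegralB//; last 2 first.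
- by apply: integrable_subR => //; apply: integrable_phase => //;
    [exact: continuous_cos|exact: continuous_sin].
- by apply: integrable_subR => //; apply: integrable_phase => //;
    [exact: continuous_cos|exact: continuous_sin].
by congr Rintegral; apply/funext => xi; rewrite /cutoff indic_cubeD//; ring.
Qed.

Lemma evolIm_cubeD N M t x : (N <= M)%N ->
  evolIm (cube M `\` cube N) t x = evolIm (cube M) t x - evolIm (cube N) t x.
Proof.
move=> NM; rewrite /evolIm /waveIm -RintegralB//; last 2 first.
- by apply: integrable_addR => //; apply: integrable_phase => //;
    [exact: continuous_sin|exact: continuous_cos].
- by apply: integrable_addR => //; apply: integrable_phase => //;
    [exact: continuous_sin|exact: continuous_cos].
by congr Rintegral; apply/funext => xi; rewrite /cutoff indic_cubeD//; ring.
Qed.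

(** Independent of [t] and [x]: its integrand dominates in the proof of continuity at time 0, and
    its value at the lowest scale starts the telescoping bound of the dyadic partial integrals. *)
Definition evol_bound N : R := \int[m]_xi (`|cutoff (cube N) F1 xi| + `|cutoff (cube N) F2 xi|).

Let icut_norm N : m.-integrable setT (EFin \o (fun xi => `|cutoff (cube N) F1 xi| + `|cutoff (cube N) F2 xi|)).
Proof. by apply: integrable_addR => //; [exact: (integrable_abse (icut1 N))|exact: (integrable_abse (icut2 N))]. Qed.

Let trig_comb (p q u v : R) : `|u| <= 1 -> `|v| <= 1 -> `|p * u + q * v| <= `|p| + `|q|.
Proof.
move=> u1 v1; rewrite (le_trans (ler_normD _ _))// !normrM lerD//; exact: ler_piMr.
Qed.

Lemma evol_boundP N t x :
  `|evolRe (cube N) t x| <= evol_bound N /\ `|evolIm (cube N) t x| <= evol_bound N.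
Proof.
split; (apply: le_trans (le_normr_Rintegral _ _) _ => //; last apply: le_Rintegral => //).
all: try exact: icut_norm.
- by apply: integrable_subR => //; apply: integrable_phase => //;
    [exact: continuous_cos|exact: continuous_sin].
- apply: (@integrable_abse _ _ _ _ _ (EFin \o _)).
  by apply: integrable_subR => //; apply: integrable_phase => //;
    [exact: continuous_cos|exact: continuous_sin].
- by move=> xi _; rewrite -mulrN; apply: trig_comb; rewrite ?normrN.
- by apply: integrable_addR => //; apply: integrable_phase => //;
    [exact: continuous_sin|exact: continuous_cos].
- apply: (@integrable_abse _ _ _ _ _ (EFin \o _)).
  by apply: integrable_addR => //; apply: integrable_phase => //;
    [exact: continuous_sin|exact: continuous_cos].
- by move=> xi _; apply: trig_comb.
Qed.

Let continuous_phase (f : R -> R) x (xi : T) : continuous f ->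
  continuous (fun t : R => f (tuple_dot xi x + t * freq a xi)).
Proof.
move=> cf t; apply: continuous_comp; last exact: cf.
by apply: cvgD; [exact: cvg_cst|apply: cvgM; [exact: cvg_id|exact: cvg_cst]].
Qed.

Lemma continuous_evolRe N x : {for 0, continuous (fun t => evolRe (cube N) t x)}.
Proof.
apply: (continuity_under_integral measurableT (u := -1) (v := 1) _ _ (icut_norm N)) => [t _|||].
- by apply: integrable_subR => //; apply: integrable_phase => //;
    [exact: continuous_cos|exact: continuous_sin].
- apply: aeW => xi _ t _; apply: cvgB; (apply: cvgM; first exact: cvg_cst).
    by apply: continuous_phase; exact: continuous_cos.
  by apply: continuous_phase; exact: continuous_sin.
- by move=> t _; apply: aeW => xi _; rewrite -mulrN; apply: trig_comb; rewrite ?normrN.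
- by rewrite inE/= in_itv/= ltr01 ltrN10.
Qed.

Lemma continuous_evolIm N x : {for 0, continuous (fun t => evolIm (cube N) t x)}.
Proof.
apply: (continuity_under_integral measurableT (u := -1) (v := 1) _ _ (icut_norm N)) => [t _|||].
- by apply: integrable_addR => //; apply: integrable_phase => //;
    [exact: continuous_sin|exact: continuous_cos].
- apply: aeW => xi _ t _; apply: cvgD; (apply: cvgM; first exact: cvg_cst).
    by apply: continuous_phase; exact: continuous_sin.
  by apply: continuous_phase; exact: continuous_cos.
- by move=> t _; apply: aeW => xi _; apply: trig_comb.
- by rewrite inE/= in_itv/= ltr01 ltrN10.
Qed.

Hypothesis n_gt0 : (0 < n)%N.

(** The bound of the frequency on the cube of scale [k + 1]. Its product with the radius [2 ^- k] of
    the time intervals is [block_phase], which does not depend on [k]. *)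
Definition block_freq k : R := n%:R `^ a * 2 ^+ k.+1.
Definition block_phase : R := 2 * n%:R `^ a.
Definition block_const : R := 8 * expR block_phase * expR block_phase * (2 * pi) ^+ n.

Let na_gt0 : 0 < (n%:R : R) `^ a.
Proof. by rewrite powR_gt0// ltr0n. Qed.

Lemma block_const_ge0 : 0 <= block_const.
Proof. by rewrite !mulr_ge0 ?expR_ge0 ?exprn_ge0 ?mulr_ge0 ?pi_ge0. Qed.

Let block_freq_gt0 k : 0 < block_freq k.
Proof. by rewrite mulr_gt0// exprn_gt0. Qed.

Let block_phase_ge0 : 0 <= block_phase.
Proof. by rewrite mulr_ge0// ltW. Qed.

(** [i] and [j] are sides of cubes rather than scales, since chaining works with subblocks; the
    frequency bound remains that of the whole block [k]. *)
Definition blockB i j k c x : \bar R :=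
  localB (cutoff (cube j `\` cube i) F1) (cutoff (cube j `\` cube i) F2) (@freq R a n)
    (block_freq k) block_phase c x.

Let icutD1 i j : m.-integrable setT (EFin \o cutoff (cube j `\` cube i) F1).
Proof. by apply: (@integrable_cut1 _ j); [exact: measurableD|exact: subDsetl]. Qed.

Let icutD2 i j : m.-integrable setT (EFin \o cutoff (cube j `\` cube i) F2).
Proof. by apply: (@integrable_cut2 _ j); [exact: measurableD|exact: subDsetl]. Qed.

Lemma blockB_ge0 i j k c x : (0 <= blockB i j k c x)%E.
Proof. exact: localB_ge0. Qed.

Lemma measurable_blockB i j k c : measurable_fun setT (blockB i j k c).
Proof. by apply: measurable_localB => //; exact: measurable_freq. Qed.

Lemma integral_blockB i j k c : (i <= j)%N ->
  (\int[m]_x blockB i j k c x <= (block_const * (mass j - mass i))%:E)%E.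
Proof.
move=> ij; apply: (le_trans (integral_localB _ _ _ _ _ _ _)) => //; do ?[exact: measurable_freq|exact: freq_ge0].
rewrite [leRHS]EFinM; apply: lee_pmul => //.
- by rewrite lee_fin block_const_ge0.
- by apply: integral_ge0 => xi _; rewrite lee_fin addr_ge0 ?sqr_ge0.
rewrite -integral_cubeD//; do ?exact: integrable_cut_density.
rewrite /Rintegral fineK; last first.
  by apply: (integrable_fin_num _ (integrable_cut_density _)) => //; exact: measurableD.
rewrite le_eqVlt; apply/orP; left; apply/eqP; apply: eq_integral => xi _; congr EFin.
rewrite /cutoff /density indicE; case: (_ \in _); rewrite ?mulr1 ?mulr0//.
by rewrite expr0n addr0.
Qed.

Lemma blockB_sup i j k c t x : (i <= j)%N -> (j <= N_ k.+1)%N -> `|t - c| <= 2 ^- k ->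
  (((evolRe (cube j) t x - evolRe (cube i) t x) ^+ 2 +
    (evolIm (cube j) t x - evolIm (cube i) t x) ^+ 2)%:E <= blockB i j k c x)%E.
Proof.
move=> ij jN tc; rewrite -evolRe_cubeD// -evolIm_cubeD//.
apply: wave_local_sup => //; do ?[exact: measurable_freq|exact: freq_ge0].
  move=> xi Hxi; rewrite /cutoff indicE memNset ?mulr0//= => -[xj _].
  by have := freq_cube a0 (subset_cube jN xj); rewrite leNgt Hxi.
rewrite (le_trans (ler_wpM2r (ltW (block_freq_gt0 k)) tc))// /block_freq /block_phase exprS.
set p := 2 ^+ k; have p0 : p != 0 :> R by rewrite expf_neq0.
by rewrite [leLHS](_ : _ = 2 * n%:R `^ a)//; field.
Qed.

End cuts.

(** * Almost everywhere convergence *)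

Section series_helpers.
Context {R : realType}.

Lemma nneseries_le_bound (u : nat -> \bar R) (b : nat -> R) (B : R) :
  (forall k, 0 <= u k)%E -> (forall k, u k <= (b k)%:E)%E ->
  (forall M, \sum_(0 <= k < M) b k <= B) -> (\sum_(0 <= k <oo) u k <= B%:E)%E.
Proof.
move=> u0 ub bB; apply: lime_le; first by apply: is_cvg_nneseries => k _ _; exact: u0.
apply: nearW => M; apply: (@le_trans _ _ (\sum_(0 <= k < M) (b k)%:E)%E).
  by apply: lee_sum => k _; exact: ub.
by rewrite sumEFin lee_fin.
Qed.

Lemma nneseries_fine (u : nat -> \bar R) : (forall k, 0 <= u k)%E ->
  (\sum_(0 <= k <oo) u k < +oo)%E ->
  (forall k, u k \is a fin_num) /\
  forall M, \sum_(0 <= k < M) fine (u k) <= fine (\sum_(0 <= k <oo) u k)%E.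
Proof.
move=> u0 uoo.
have ufin k : u k \is a fin_num.
  rewrite ge0_fin_numE//; apply: le_lt_trans uoo.
  apply: le_trans (nneseries_lim_ge k.+1 _) => //.
  by rewrite big_nat_recr//= leeDr// sume_ge0.
split=> // M; rewrite -lee_fin -sumEFin fineK; last first.
  by rewrite ge0_fin_numE// nneseries_ge0.
rewrite (eq_bigr u) => [|k _]; last by rewrite fineK.
exact: nneseries_lim_ge.
Qed.

Lemma cvg_series_bounded (h : nat -> R) (B : R) : (forall k, 0 <= h k) ->
  (forall M, \sum_(0 <= k < M) h k <= B) -> cvgn (series h).
Proof.
move=> h0 hB; apply: nondecreasing_is_cvgn; first by apply: nondecreasing_series => k _ _; exact: h0.
by exists B => _ [M _ <-]; exact: hB.
Qed.

End series_helpers.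

Section almost_everywhere.
Context {R : realType} {n : nat}.
Notation T := (n.-tuple R).
Notation m := (@lebesgue_tuple R n).
Implicit Types (xi x : T) (t : R).

Variables (F1 F2 : T -> R) (a s kappa : R).
Hypothesis mF1 : measurable_fun setT F1.
Hypothesis mF2 : measurable_fun setT F2.
Hypothesis n_gt0 : (0 < n)%N.
Hypothesis a0 : 0 < a.
Hypothesis s0 : 0 < s.
Hypothesis k0 : 0 < kappa.
Hypothesis intw : m.-integrable setT (EFin \o weight F1 F2 s).

Variables (E : set R) (c : nat -> nat) (ctr : nat -> nat -> R).
Hypothesis E0 : E 0.
Hypothesis cover : forall k t, E t -> exists2 j, (j < c k)%N & ctr k j <= t <= ctr k j + 2 ^- k.
(** When [c k] is the covering number at scale [2 ^- k], this is the [k]-th term of the series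
    assumed to converge. *)
Definition level k : R := (c k)%:R * 2 `^ (- (2 * k%:R * s / a)).
Variable SA : R.
Hypothesis level_sum : forall M, \sum_(0 <= k < M) level k <= SA.

Let N_ := dyscale a.
Let W := @wmass R n F1 F2 s.
Let Wtot : R := \int[m]_xi weight F1 F2 s xi.

(** As 0 belongs to [E], no covering is empty; so [level k] is positive and may be divided by. *)
Let c_gt0 k : (0 < c k)%N.
Proof. by have [j jc _] := cover k E0; exact: leq_ltn_trans jc. Qed.

Let level_gt0 k : 0 < level k.
Proof. by rewrite mulr_gt0 ?ltr0n ?powR_gt0. Qed.

Let icw (B : set T) : measurable B -> m.-integrable setT (EFin \o cutoff B (weight F1 F2 s)).
Proof. exact: integrable_cut_weight. Qed.

Let W_homo k : W (N_ k) <= W (N_ k.+1).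
Proof.
have Nk : (N_ k <= N_ k.+1)%N by exact: dyscale_homo.
have i1 := icw (@measurable_cube R n (N_ k)).
have i2 := icw (@measurable_cube R n (N_ k.+1)).
rewrite -subr_ge0 -integral_cubeD//.
apply: Rintegral_ge0 => xi _; apply: mulr_ge0; first exact: weight_ge0.
by have /andP[] := @indic_le1 _ _ (cube (N_ k.+1) `\` cube (N_ k)) xi.
Qed.

Let sum_W M : \sum_(0 <= k < M) (W (N_ k.+1) - W (N_ k)) <= Wtot.
Proof.
rewrite telescope_sumr//.
rewrite lerBlDr (le_trans (wmass_le s0 intw (N_ M)))// lerDl.
exact: wmass_ge0.
Qed.

Definition blockP k x : \bar R := (\sum_(0 <= j < c k) blockB F1 F2 a (N_ k) (N_ k.+1) k (ctr k j) x)%E.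
(** Division by [level k] cancels both the number of covering intervals and the decay of the mass of
    block [k]: the integral of each term is bounded by a constant times an increment of [W], and
    these increments are summable. *)
Definition blockPhi x : \bar R := (\sum_(0 <= k <oo) ((level k)^-1%:E * blockP k x))%E.

Lemma blockP_ge0 k x : (0 <= blockP k x)%E.
Proof. by apply: sume_ge0 => j _; exact: blockB_ge0. Qed.

Lemma measurable_blockP k : measurable_fun setT (blockP k).
Proof. by apply: emeasurable_sum => j; exact: (measurable_blockB _ mF1 mF2 s0 intw). Qed.

Let K := @block_const R n a.
Let K0 : 0 <= K. Proof. exact: block_const_ge0. Qed.

Let mass_block_le k : (c k)%:R * (K * (mass F1 F2 (N_ k.+1) - mass F1 F2 (N_ k))) <=
  level k * (K * 16 `^ s * (W (N_ k.+1) - W (N_ k))).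
Proof.
rewrite [leRHS](_ : _ = (c k)%:R * (K * (16 `^ s * 2 `^ (- (2 * k%:R * s / a)) * (W (N_ k.+1) - W (N_ k))))).
  by rewrite ler_wpM2l// ler_wpM2l//; exact: mass_block.
have gen (p q r u v : R) : p * q * (r * u * v) = p * (r * (u * q * v)) by ring.
exact: gen.
Qed.

Lemma integral_blockPhi : (\int[m]_x blockPhi x <= (K * 16 `^ s * Wtot)%:E)%E.
Proof.
have l0 k : (0 <= ((level k)^-1)%:E)%E by rewrite lee_fin invr_ge0 ltW.
rewrite integral_nneseries//; last 2 first.
- by move=> k; apply: measurable_funeM; exact: measurable_blockP.
- by move=> k x _; rewrite mule_ge0// blockP_ge0.
apply: (@nneseries_le_bound _ _ (fun k => K * 16 `^ s * (W (N_ k.+1) - W (N_ k)))) => [k|k|M].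
- by apply: integral_ge0 => x _; rewrite mule_ge0// blockP_ge0.
- rewrite ge0_integralZl//; [|exact: measurable_blockP|by move=> x _; exact: blockP_ge0].
  rewrite ge0_integral_sum//; last 2 first.
  + by move=> j; exact: (measurable_blockB _ mF1 mF2 s0 intw).
  + by move=> j x _; exact: blockB_ge0.
  apply: (@le_trans _ _ (((level k)^-1)%:E * \sum_(0 <= j < c k) (K * (mass F1 F2 (N_ k.+1) - mass F1 F2 (N_ k)))%:E)%E).
    rewrite lee_wpmul2l//; apply: lee_sum => j _.
    by apply: (integral_blockB _ mF1 mF2 s0 intw) => //; exact: dyscale_homo.
  rewrite sumEFin -EFinM lee_fin ler_pdivrMl// (le_trans _ (mass_block_le k))//.
  by rewrite sumr_const_nat subn0 mulr_natl.
rewrite -mulr_sumr; apply: ler_wpM2l; last exact: sum_W.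
by apply: mulr_ge0; [exact: K0|exact: powR_ge0].
Qed.

(** The sides from [N_ k] on, frozen at [N_ k.+1]: chaining runs over [2 ^ dylevel a k] steps, more
    than the block may contain. *)
Let step k (i : nat) : nat := minn (N_ k + i) (N_ k.+1).

Definition blockChain k j x : \bar R :=
  chainB (fun i i' => blockB F1 F2 a (step k i) (step k i') k (ctr k j) x) (dylevel a k) 0.

(** Chebyshev's inequality: an interval of scale [k] has kappa-content [2 ^ (- k kappa)]. If the
    chaining bound exceeds [2 ^ (- k kappa / 2)] there, the content is below that bound times
    [2 ^ (- k kappa / 2)], which is the summand. *)
Definition blockZ k x : \bar R := (\sum_(0 <= j < c k)
  ((2 `^ (- (k%:R * kappa / 2)) * (dylevel a k).+1%:R)%:E * blockChain k j x))%E.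

Let coef_ge0 k : (0 <= (2 `^ (- (k%:R * kappa / 2)) * (dylevel a k).+1%:R)%:E :> \bar R)%E.
Proof. by rewrite lee_fin mulr_ge0 ?powR_ge0. Qed.

Let mchain k j : measurable_fun setT (blockChain k j).
Proof.
apply: measurable_chainB => i i'; exact: (measurable_blockB _ mF1 mF2 s0 intw).
Qed.

Let chain_ge0 k j x : (0 <= blockChain k j x)%E.
Proof. by apply: chainB_ge0 => i i'; exact: blockB_ge0. Qed.

Lemma blockZ_ge0 k x : (0 <= blockZ k x)%E.
Proof. by apply: sume_ge0 => j _; exact: mule_ge0. Qed.

Lemma measurable_blockZ k : measurable_fun setT (blockZ k).
Proof. by apply: emeasurable_sum => j; exact: measurable_funeM. Qed.

Let mass_homo' : {homo mass F1 F2 : i j / (i <= j)%N >-> i <= j}.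
Proof. exact: (mass_homo mF1 mF2 s0 intw). Qed.

Let step_homo k : {homo step k : i j / (i <= j)%N}.
Proof. by move=> i j ij; rewrite /step; lia. Qed.

Let step_dylevel k : step k (0 + 2 ^ dylevel a k) = N_ k.+1.
Proof. by have := dyscale_dylevel a k; rewrite /step /N_; lia. Qed.

Let step0 k : step k 0 = N_ k.
Proof. by have := dyscale_homo a0 (leqnSn k); rewrite /step /N_; lia. Qed.

(** The factor [(dylevel a k).+1] occurs twice, from [chaining] and from the integral of the chain;
    its square is absorbed by the power of 2. The number of intervals is absorbed by the decay of
    the mass, since [level k] is bounded by [SA]. *)
Lemma integral_blockZ : (\int[m]_x (\sum_(0 <= k <oo) blockZ k x) < +oo)%E.
Proof.
have [C2 C2P] := dylevel_bound a0 k0.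
have C20 : 0 <= C2 by apply: le_trans (C2P 0%N); rewrite mulr_ge0 ?powR_ge0 ?sqr_ge0.
have SA0 k : level k <= SA.
  apply: le_trans (level_sum k.+1); rewrite big_nat_recr//= lerDr.
  by apply: sumr_ge0 => i _; exact: ltW.
have SA_ge0 : 0 <= SA by apply: le_trans (SA0 0%N); exact: ltW.
apply: (@le_lt_trans _ _ ((C2 * SA * (K * 16 `^ s) * Wtot)%:E)); last exact: ltry.
rewrite integral_nneseries//; last 2 first.
- by move=> k; exact: measurable_blockZ.
- by move=> k x _; exact: blockZ_ge0.
apply: (@nneseries_le_bound _ _ (fun k => C2 * SA * (K * 16 `^ s) * (W (N_ k.+1) - W (N_ k)))) => [k|k|M].
- by apply: integral_ge0 => x _; exact: blockZ_ge0.
- rewrite ge0_integral_sum//; last 2 first.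
  + by move=> j; exact: measurable_funeM.
  + by move=> j x _; exact: mule_ge0.
  pose d := mass F1 F2 (N_ k.+1) - mass F1 F2 (N_ k).
  have d0 : 0 <= d by rewrite subr_ge0 mass_homo'// dyscale_homo.
  pose l : R := (dylevel a k).+1%:R.
  apply: (@le_trans _ _ (\sum_(0 <= j < c k) (2 `^ (- (k%:R * kappa / 2)) * l * (l * (K * d)))%:E)%E).
    apply: lee_sum => j _; rewrite ge0_integralZl//.
    rewrite [leRHS]EFinM lee_wpmul2l//.
    have := @integral_chainB R _ T m (fun i i' x => blockB F1 F2 a (step k i) (step k i') k (ctr k j) x)
      (fun i => K * mass F1 F2 (step k i)) (dylevel a k) 0.
    rewrite step_dylevel step0 -mulrBr; apply.
    + by move=> i i'; exact: (measurable_blockB _ mF1 mF2 s0 intw).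
    + by move=> i i' x; exact: blockB_ge0.
    + move=> i i' ii'; rewrite -mulrBr; apply: (integral_blockB _ mF1 mF2 s0 intw) => //.
      exact: step_homo.
    + by move=> i i' ii'; apply: (ler_wpM2l K0); apply: mass_homo'; exact: step_homo.
  rewrite sumEFin lee_fin sumr_const_nat subn0 -[leLHS]mulr_natl.
  rewrite [leLHS](_ : _ = (l ^+ 2 * 2 `^ (- (k%:R * kappa / 2))) * ((c k)%:R * (K * d))); last first.
    have gen (p q r u : R) : p * (q * r * (r * u)) = r ^+ 2 * q * (p * u) by ring.
    exact: gen.
  apply: (@le_trans _ _ (C2 * (level k * (K * 16 `^ s * (W (N_ k.+1) - W (N_ k)))))).
    apply: ler_pM => //.
    - by apply: mulr_ge0; [exact: sqr_ge0|exact: powR_ge0].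
    - by apply: mulr_ge0 => //; exact: mulr_ge0.
    - exact: C2P.
  have gen (p q q' r u : R) : 0 <= p -> q <= q' -> 0 <= r -> 0 <= u -> p * (q * (r * u)) <= p * q' * r * u.
    by move=> p0 qq' r0 u0; rewrite -!mulrA; apply: ler_wpM2l => //; apply: ler_wpM2r => //; exact: mulr_ge0.
  apply: gen => //; last by rewrite subr_ge0.
  by apply: mulr_ge0; [exact: K0|exact: powR_ge0].
rewrite -mulr_sumr; apply: ler_wpM2l; last exact: sum_W.
apply: mulr_ge0; first exact: mulr_ge0.
by apply: mulr_ge0; [exact: K0|exact: powR_ge0].
Qed.

Section point.
Variable x : T.
Hypothesis Phix : (blockPhi x < +oo)%E.
Hypothesis Zx : (\sum_(0 <= k <oo) blockZ k x < +oo)%E.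

Let p k : R := fine (((level k)^-1)%:E * blockP k x)%E.
(** The arithmetic mean, in place of the square root of [level k * p k]: it is summable because both
    terms are. *)
Let h k : R := (p k + level k) / 2.

Let term_ge0 k : (0 <= ((level k)^-1)%:E * blockP k x)%E.
Proof. by rewrite mule_ge0 ?blockP_ge0// lee_fin invr_ge0 ltW. Qed.

Let p_ge0 k : 0 <= p k. Proof. exact: fine_ge0. Qed.

Let h_ge0 k : 0 <= h k.
Proof. by apply: divr_ge0 => //; apply: addr_ge0 => //; exact: ltW. Qed.

Let h_sum M : \sum_(0 <= k < M) h k <= (fine (blockPhi x) + SA) / 2.
Proof.
rewrite -mulr_suml ler_wpM2r// big_split/=; apply: lerD; last exact: level_sum.
exact: (nneseries_fine term_ge0 Phix).2.
Qed.

Let blockPE k : blockP k x = (level k * p k)%:E.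
Proof.
have [fin _] := nneseries_fine term_ge0 Phix.
rewrite EFinM /p fineK// muleA -EFinM mulfV ?mul1e//.
by rewrite gt_eqF.
Qed.

Let sqr_bound (u v l q : R) : 0 <= l -> 0 <= q -> u ^+ 2 + v ^+ 2 <= l * q ->
  `|u| <= (q + l) / 2 /\ `|v| <= (q + l) / 2.
Proof.
move=> l0 q0 H; have y0 : 0 <= (q + l) / 2 by rewrite divr_ge0// addr_ge0.
split; rewrite -ler_sqr ?nnegrE// real_normK ?num_real//.
  have := sqr_ge0 v; have := sqr_ge0 (q - l); nra.
have := sqr_ge0 u; have := sqr_ge0 (q - l); nra.
Qed.

Let close k j t : ctr k j <= t <= ctr k j + 2 ^- k -> `|t - ctr k j| <= 2 ^- k.
Proof. by move=> /andP[? ?]; rewrite ger0_norm; lra. Qed.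

(** The time [t] lies in some covering interval, whose local majorant is one of the nonnegative
    summands of [blockP k x]. *)
Let increment k t : E t ->
  `|evolRe F1 F2 a (cube (N_ k.+1)) t x - evolRe F1 F2 a (cube (N_ k)) t x| <= h k /\
  `|evolIm F1 F2 a (cube (N_ k.+1)) t x - evolIm F1 F2 a (cube (N_ k)) t x| <= h k.
Proof.
move=> Et; have [j jc tj] := cover k Et.
have Nk : (N_ k <= N_ k.+1)%N by exact: dyscale_homo.
have H := blockB_sup mF1 mF2 s0 intw a0 n_gt0 x Nk (leqnn _) (close tj).
apply: sqr_bound => //; first exact: ltW.
rewrite -lee_fin -blockPE (le_trans H)// /blockP big_mkord.
rewrite (bigD1 (Ordinal jc))//= leeDl//.
by apply: sume_ge0 => i _; exact: blockB_ge0.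
Qed.

Let bound : R := evol_bound F1 F2 (N_ 0) + (fine (blockPhi x) + SA) / 2.

Let sum_bound (S : nat -> R) B : `|S 0%N| <= B -> (forall k, `|S k.+1 - S k| <= h k) ->
  forall k, `|S k| <= B + (fine (blockPhi x) + SA) / 2.
Proof.
move=> S0 Sh k; apply: (@le_trans _ _ (B + \sum_(0 <= i < k) h i)); last by rewrite lerD2l.
elim: k => [|k ih]; first by rewrite big_nil addr0.
rewrite big_nat_recr//= addrA -[S k.+1](subrK (S k)) addrC (le_trans (ler_normD _ _))//.
exact: lerD.
Qed.

(** The bound does not depend on [k] and, as a function of [x], is integrable against a Gaussian; it
    dominates the partial integrals in the inversion at time 0. *)
Lemma evol_dyadic_bound k :
  `|evolRe F1 F2 a (cube (N_ k)) 0 x| <= bound /\ `|evolIm F1 F2 a (cube (N_ k)) 0 x| <= bound.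
Proof.
have [b1 b2] := evol_boundP a mF1 mF2 s0 intw (N_ 0) 0 x.
split.
  apply: (sum_bound (S := fun k => evolRe F1 F2 a (cube (N_ k)) 0 x)) => // i.
  by have [] := increment i E0.
apply: (sum_bound (S := fun k => evolIm F1 F2 a (cube (N_ k)) 0 x)) => // i.
by have [] := increment i E0.
Qed.

Let limRe t := limn (fun k => evolRe F1 F2 a (cube (N_ k)) t x).
Let limIm t := limn (fun k => evolIm F1 F2 a (cube (N_ k)) t x).

Lemma evol_dyadic_limit :
  [/\ forall t, E t -> evolRe F1 F2 a (cube (N_ k)) t x @[k --> \oo] --> limRe t,
      forall t, E t -> evolIm F1 F2 a (cube (N_ k)) t x @[k --> \oo] --> limIm t,
      limRe t @[t --> within E 0^'] --> limRe 0 &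
      limIm t @[t --> within E 0^'] --> limIm 0].
Proof.
have ch := cvg_series_bounded h_ge0 h_sum.
have [r1 r2] := @cvg_limit_within R E (fun k t => evolRe F1 F2 a (cube (N_ k)) t x) h E0 h_ge0 ch
  (fun k t Et => (increment k Et).1) (fun k => @continuous_evolRe _ _ _ _ a s mF1 mF2 s0 intw (N_ k) x).
have [i1 i2] := @cvg_limit_within R E (fun k t => evolIm F1 F2 a (cube (N_ k)) t x) h E0 h_ge0 ch
  (fun k t Et => (increment k Et).2) (fun k => @continuous_evolIm _ _ _ _ a s mF1 mF2 s0 intw (N_ k) x).
split; [exact: r1|exact: i1|exact: r2|exact: i2].
Qed.

(** The square root of the threshold [2 ^ (- k kappa / 2)], which applies to squared increments: the
    increments over good intervals are at most [e k]. *)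
Let e k : R := 2 `^ (- (k%:R * kappa / 4)).

Let eE k : 2 `^ (- (k%:R * kappa / 2)) = e k ^+ 2.
Proof. by rewrite /e -powR_mulrn ?powR_ge0// -powRrM; congr (_ `^ _); field. Qed.

Let cvg_e : e k @[k --> \oo] --> 0.
Proof.
have -> : e = (fun k => (2 `^ (- (kappa / 4))) ^+ k).
  by apply/funext => k; rewrite /e -powR_mulrn ?powR_ge0// -powRrM; congr (_ `^ _); field.
apply: cvg_expr; rewrite ger0_norm ?powR_ge0// powRN invf_lt1 ?powR_gt0//.
by rewrite /powR pnatr_eq0/= expR_gt1 mulr_gt0 ?divr_gt0 ?ln_gt0// ltr1n.
Qed.

Let bad k j := ~~ (((dylevel a k).+1%:R)%:E * blockChain k j x <= (e k ^+ 2)%:E)%E.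

Let good_increment k j t i : ctr k j <= t <= ctr k j + 2 ^- k -> ~~ bad k j ->
  (N_ k <= i <= N_ k.+1)%N ->
  `|evolRe F1 F2 a (cube i) t x - evolRe F1 F2 a (cube (N_ k)) t x| <= e k /\
  `|evolIm F1 F2 a (cube i) t x - evolIm F1 F2 a (cube (N_ k)) t x| <= e k.
Proof.
move=> tj; rewrite negbK => good /andP[ki ik].
have := @chaining R (fun i i' => blockB F1 F2 a (step k i) (step k i') k (ctr k j) x)
  (fun i => evolRe F1 F2 a (cube (step k i)) t x) (fun i => evolIm F1 F2 a (cube (step k i)) t x)
  (dylevel a k) 0 (i - N_ k) (fun _ _ => blockB_ge0 _ _ _ _ _ _ _ _).
rewrite step0 (_ : step k (0 + (i - N_ k)) = i); last by rewrite /step add0n subnKC//; exact/minn_idPl.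
move=> H; have {}H : ((evolRe F1 F2 a (cube i) t x - evolRe F1 F2 a (cube (N_ k)) t x) ^+ 2 +
    (evolIm F1 F2 a (cube i) t x - evolIm F1 F2 a (cube (N_ k)) t x) ^+ 2) <= e k ^+ 2.
  rewrite -lee_fin; apply: le_trans good; apply: H.
    move=> i1 i2 i12; apply: (blockB_sup mF1 mF2 s0 intw a0 n_gt0).
    - exact: step_homo.
    - by rewrite /step geq_minr.
    - exact: close.
  by rewrite (leq_trans (leq_subr _ _))// (leq_trans ik)// dyscale_dylevel.
have := sqr_bound (powR_ge0 _ _ : 0 <= e k) (powR_ge0 _ _ : 0 <= e k).
rewrite -expr2 => /(_ _ _ H); rewrite (_ : (e k + e k) / 2 = e k)//; by field.
Qed.

(** A time of [B] lies in bad intervals of arbitrarily large scale. Otherwise, from some scale on,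
    the partial integrals inside each block would stay within [e k] of the dyadic one, and the full
    sequence would converge to the dyadic limit. The contents of the bad intervals of scale [k] add
    up to at most [blockZ k x]. *)
Lemma evol_exceptional_null (B : set R) : B `<=` E ->
  (forall t, B t -> ~ (evolRe F1 F2 a (cube i) t x @[i --> \oo] --> limRe t /\
                       evolIm F1 F2 a (cube i) t x @[i --> \oo] --> limIm t)) ->
  hausdorff_measure kappa B = 0%E.
Proof.
move=> BE nB.
have [cRe cIm _ _] := evol_dyadic_limit.
apply: (@hausdorff_measure_limsup0 R kappa _ c (fun k j => [set t | ctr k j <= t <= ctr k j + 2 ^- k])
  bad (fun k => blockZ k x)) => //.
- exact: ltW.
- move=> k j; apply: diameter_le => u v /= /andP[? ?] /andP[? ?].
  by rewrite ler_norml; apply/andP; split; lra.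
- by move=> k; exact: blockZ_ge0.
- move=> k; apply: lee_sum => j _; case: ifPn => [|_]; last by rewrite mule_ge0// chain_ge0.
  rewrite /bad -ltNge => /ltW H; rewrite EFinM -muleA.
  rewrite [leLHS](_ : _ = ((e k ^+ 2)%:E * (e k ^+ 2)%:E)%E); last first.
    rewrite -EFinM; congr EFin; rewrite -eE -powRD ?pnatr_eq0 ?implybT//.
    have -> : 2 ^- k = 2 `^ (- k%:R) :> R by rewrite powRN powR_mulrn.
    by rewrite -powRrM; congr (_ `^ _); field.
  by rewrite eE lee_wpmul2l// lee_fin sqr_ge0.
move=> t Bt M; apply: contrapT => H; have Et := BE t Bt; apply: (nB t Bt).
have key : \forall k \near \oo, forall i, (N_ k <= i <= N_ k.+1)%N ->
  `|evolRe F1 F2 a (cube i) t x - evolRe F1 F2 a (cube (N_ k)) t x| <= e k /\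
  `|evolIm F1 F2 a (cube i) t x - evolIm F1 F2 a (cube (N_ k)) t x| <= e k.
  exists M => // k /= Mk i ki; have [j jc tj] := cover k Et.
  apply: (good_increment tj) => //; apply/negP => bkj; apply: H.
  by exists k, j; split.
have Nh := dyscale_homo a0; have Nu := dyscale_unbounded a0.
split; [apply: (cvg_blocks Nh Nu (cRe t Et) cvg_e)|apply: (cvg_blocks Nh Nu (cIm t Et) cvg_e)].
  by apply: filterS key => k Hk i /Hk[].
by apply: filterS key => k Hk i /Hk[].
Qed.

End point.

End almost_everywhere.

(** * From the Sobolev norm and the coverings to the maximal estimates *)

Section assembly.
Context {R : realType} {n : nat}.
Notation T := (n.-tuple R).
Notation m := (@lebesgue_tuple R n).
Implicit Types (x xi : T).

Lemma schrodinger_partialE a (f : T -> R[i]) N x t :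
  schrodinger_partial a f N x t =
  ((2 * pi) ^- n * evolRe (fun xi => Re (fourier f xi)) (fun xi => Im (fourier f xi)) a (cube N) t x) +i*
  ((2 * pi) ^- n * evolIm (fun xi => Re (fourier f xi)) (fun xi => Im (fourier f xi)) a (cube N) t x).
Proof.
have reE : \int[m]_(xi in cube N) Re (expi (tuple_dot xi x) * expi (t * enorm xi `^ a) * fourier f xi) =
    evolRe (fun xi => Re (fourier f xi)) (fun xi => Im (fourier f xi)) a (cube N) t x.
  rewrite Rintegral_mkcond; congr Rintegral; apply/funext => xi.
  rewrite patchE /cutoff indicE; case: ifPn => _; last by rewrite !mulr0 !mul0r subr0.
  by rewrite !mulr1 cosD sinD /freq; case: (fourier f xi) => p q /=; ring.
have imE : \int[m]_(xi in cube N) Im (expi (tuple_dot xi x) * expi (t * enorm xi `^ a) * fourier f xi) =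
    evolIm (fun xi => Re (fourier f xi)) (fun xi => Im (fourier f xi)) a (cube N) t x.
  rewrite Rintegral_mkcond; congr Rintegral; apply/funext => xi.
  rewrite patchE /cutoff indicE; case: ifPn => _; last by rewrite !mulr0 !mul0r addr0.
  by rewrite !mulr1 cosD sinD /freq; case: (fourier f xi) => p q /=; ring.
rewrite /schrodinger_partial /cintegral reE imE.
by apply/eqP; rewrite eq_complex /= !mul0r subr0 addr0 !eqxx.
Qed.

Lemma sobolev_weight (s : R) (f : T -> R[i]) : sobolev s f ->
  [/\ is_fourier f (fourier f),
      measurable_fun setT (fun xi => Re (fourier f xi)),
      measurable_fun setT (fun xi => Im (fourier f xi)) &
      m.-integrable setT (EFin \o weight (fun xi => Re (fourier f xi)) (fun xi => Im (fourier f xi)) s)].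
Proof.
move=> [tf [F fF] nf].
have ff : is_fourier f (fourier f) by exact: (xgetPex (fun=> 0) (ex_intro _ F fF)).
have [[[m1 m2] _ _] _] := ff; split => //.
apply/integrableP; split.
  apply/measurable_EFinP; apply: measurable_funM; last exact: measurable_density.
  apply: (measurableT_comp (measurable_powR _)) => //.
  by apply: measurable_funD => //; apply: measurable_funX; exact: measurable_enorm.
have wE xi : (1 + enorm xi ^+ 2) `^ s * Normc.normc (fourier f xi) ^+ 2 =
    weight (fun xi => Re (fourier f xi)) (fun xi => Im (fourier f xi)) s xi.
  rewrite /weight /density; congr (_ * _).
  by case: (fourier f xi) => p q /=; rewrite sqr_sqrtr// addr_ge0 ?sqr_ge0.
have w0 xi : 0 <= weight (fun xi => Re (fourier f xi)) (fun xi => Im (fourier f xi)) s xi.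
  by rewrite mulr_ge0 ?powR_ge0 ?addr_ge0 ?sqr_ge0.
rewrite (eq_integral (fun xi => (weight (fun xi => Re (fourier f xi)) (fun xi => Im (fourier f xi)) s xi)%:E)); last first.
  by move=> xi _; rewrite /= ger0_norm.
move: nf; rewrite /sobolev_norm.
rewrite (_ : integral _ _ _ = \int[m]_xi (weight (fun xi => Re (fourier f xi)) (fun xi => Im (fourier f xi)) s xi)%:E)%E; last first.
  by apply: eq_integral => xi _; rewrite wE.
(* An infinite integral would make its square root infinite, so finiteness passes from the norm to
   the integral. *)
set I := (\int[_]_x _)%E; case: I => [r|//|//]; rewrite ?ltry// => /=.
by rewrite invr_eq0 pnatr_eq0.
Qed.

End assembly.

(** The weights being positive, convergence of the series forces every covering number to be finite,
    hence attained by a covering. *)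
Lemma dyadic_cover (R : realType) (E : set R) (p : nat -> R) : (forall k, 0 < p k) ->
  (\sum_(0 <= k <oo) (covering_number E (2 ^- k) * (p k)%:E) < +oo)%E ->
  exists (c : nat -> nat) (ctr : nat -> nat -> R) (B : R),
    (forall k t, E t -> exists2 j, (j < c k)%N & ctr k j <= t <= ctr k j + 2 ^- k) /\
    forall M, \sum_(0 <= k < M) (c k)%:R * p k <= B.
Proof.
move=> p0 Hsum.
have cov0 k : (0 <= covering_number E (2 ^- k))%E.
  by apply: le_ereal_inf_tmp => _ [N _ <-]; rewrite lee_fin.
have t0 k : (0 <= covering_number E (2 ^- k) * (p k)%:E)%E.
  by rewrite mule_ge0// lee_fin ltW.
have [fin bnd] := nneseries_fine t0 Hsum.
have covoo k : (covering_number E (2 ^- k) < +oo)%E.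
  have := fin k; case: covering_number (cov0 k) => [r|//|//] _; first by rewrite ltry.
  by rewrite mulyr gtr0_sg// mul1e.
have /choice[cc ccP] k : exists cc : nat * (nat -> R), covering_number E (2 ^- k) = ((cc.1)%:R : R)%:E /\
    forall t, E t -> exists2 j, (j < cc.1)%N & cc.2 j <= t <= cc.2 j + 2 ^- k.
  have [N [c [cE cP]]] := covering_number_attained (covoo k).
  (* The centres are extended by 0 to all indices; only those with [j < N] are used to cover [E]. *)
  exists (N, fun j => if insub j is Some l then c l else 0); split => // t /cP[l lt].
  by exists l => //=; rewrite valK.
exists (fun k => (cc k).1), (fun k => (cc k).2), (fine (\sum_(0 <= k <oo) (covering_number E (2 ^- k) * (p k)%:E))%E).
split=> [k|M]; first exact: (ccP k).2.
rewrite (le_trans _ (bnd M))// le_eqVlt; apply/orP; left; apply/eqP; apply: eq_bigr => k _.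
by rewrite (ccP k).1.
Qed.

Theorem theorem5 (R : realType) (n : nat) (a s kappa : R) (E : set R)
    (f : n.-tuple R -> R[i])
    (n_ge1 : (1 <= n)%N) (a_gt0 : 0 < a) (s_gt0 : 0 < s)
    (kappa_gt0 : 0 < kappa) (kappa_lt1 : kappa < 1)
    (E_bounded : bounded_set E) (E_borel : measurable E)
    (E_dim : hausdorff_dim E = kappa%:E)
    (E_gt0 : (0 < hausdorff_measure kappa E)%E)
    (E_fin : (hausdorff_measure kappa E < +oo)%E)
    (E_0 : E 0)
    (E_sum : (\sum_(0 <= m <oo)
        (covering_number E (2 ^- m) * (2 `^ (- (2 * m%:R * s / a)))%:E)
      < +oo)%E)
    (f_Hs : sobolev s f) :
  {ae lebesgue_tuple n, forall x, exists g : R -> R[i]^o,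
    hausdorff_measure kappa
      [set t | E t /\
        ~ (schrodinger_dom a f (x, t) /\ g t = schrodinger a f x t)] = 0%E /\
    g t @[t --> within E 0^'] --> (f x : R[i]^o)}.
Proof.
have [fF mF1 mF2 intw] := sobolev_weight f_Hs.
have tf : tempered_function f by case: f_Hs.
pose F1 xi := Re (fourier f xi); pose F2 xi := Im (fourier f xi).
have p0 k : 0 < 2 `^ (- (2 * k%:R * s / a)) :> R by rewrite powR_gt0.
have [c [ctr [SA [cover SAP]]]] := dyadic_cover p0 E_sum.
pose Phi := blockPhi F1 F2 a s c ctr.
pose Z x := (\sum_(0 <= k <oo) blockZ F1 F2 a kappa c ctr k x)%E.
have l0 k : (0 <= ((level a s c k)^-1)%:E)%E.
  by rewrite lee_fin invr_ge0 mulr_ge0 ?ler0n ?powR_ge0.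
have mPhi : measurable_fun setT Phi.
  apply: measurable_nneseries => [k x|k]; first by rewrite mule_ge0// blockP_ge0.
  by apply: measurable_funeM; exact: (measurable_blockP _ mF1 mF2 s_gt0 intw).
have mZ : measurable_fun setT Z.
  apply: measurable_nneseries => [k x|k]; first exact: blockZ_ge0.
  exact: (measurable_blockZ _ _ mF1 mF2 s_gt0 intw).
have Phi0 x : (0 <= Phi x)%E.
  by apply: nneseries_ge0 => k _ _; rewrite mule_ge0// blockP_ge0.
have Z0 x : (0 <= Z x)%E by apply: nneseries_ge0 => k _ _; exact: blockZ_ge0.
have iPhi : (lebesgue_tuple n).-integrable setT Phi.
  apply/integrableP; split => //; under eq_integral do rewrite gee0_abs//.
  exact: le_lt_trans (integral_blockPhi mF1 mF2 n_ge1 a_gt0 s_gt0 intw E_0 cover) (ltry _).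
have iZ : (lebesgue_tuple n).-integrable setT Z.
  apply/integrableP; split => //; under eq_integral do rewrite gee0_abs//.
  exact: (integral_blockZ mF1 mF2 n_ge1 a_gt0 s_gt0 kappa_gt0 intw E_0 cover SAP).
have aePhi : {ae lebesgue_tuple n, forall x, (Phi x < +oo)%E}.
  have := integrable_ae measurableT iPhi; apply: filterS => x /(_ I).
  by rewrite ge0_fin_numE.
have aeZ : {ae lebesgue_tuple n, forall x, (Z x < +oo)%E}.
  have := integrable_ae measurableT iZ; apply: filterS => x /(_ I).
  by rewrite ge0_fin_numE.
(* The dyadic limits, and thereby the inversion at time 0, rest on the finiteness of [Phi x]; that
   of [Z x] serves for the exceptional times. *)
pose A := [set x | (Phi x < +oo)%E].
have mA : measurable A.
  rewrite -[A]setTI; exact: emeasurable_fun_infty_o.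
have A0 : lebesgue_tuple n (~` A) = 0%E.
  apply: measure_negligible; first exact: measurableC.
  exact: aePhi.
pose lRe t x := limn (fun k => evolRe F1 F2 a (cube (dyscale a k)) t x).
pose lIm t x := limn (fun k => evolIm F1 F2 a (cube (dyscale a k)) t x).
pose kap : R := (2 * pi) ^- n.
have kap0 : 0 <= kap by rewrite invr_ge0 exprn_ge0// mulr_ge0// pi_ge0.
have inv : {ae lebesgue_tuple n, forall x, f x = (kap * lRe 0 x) +i* (kap * lIm 0 x)}.
  (* The bound of [evol_dyadic_bound] times the constant of the inversion formula; it is integrable
     against the Gaussian because [Phi] is integrable. *)
  pose Hd x := kap * (evol_bound F1 F2 (dyscale a 0) + (fine (Phi x) + SA) / 2).
  have D_cvg (xi : n.-tuple R) : \forall k \near \oo, cube (dyscale a k) xi.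
    have [N _ xN] : (\bigcup_N @cube R n N) xi by rewrite bigcup_cube.
    have [k Nk] := dyscale_unbounded a_gt0 N; exists k => // k' /= kk'.
    apply: subset_cube xN; exact: leq_trans (ltnW Nk) (dyscale_homo a_gt0 kk').
  have SA0 : 0 <= SA by have := SAP 0%N; rewrite big_geq.
  have Re0 N x : waveRe (cutoff (cube N) F1) (cutoff (cube N) F2) (fun=> 0) x = evolRe F1 F2 a (cube N) 0 x.
    by congr (waveRe _ _ _ x); apply/funext => xi; rewrite mul0r.
  have Im0 N x : waveIm (cutoff (cube N) F1) (cutoff (cube N) F2) (fun=> 0) x = evolIm F1 F2 a (cube N) 0 x.
    by congr (waveIm _ _ _ x); apply/funext => xi; rewrite mul0r.
  have lim x (Ax : A x) := evol_dyadic_limit mF1 mF2 n_ge1 a_gt0 s_gt0 intw E_0 cover SAP Ax.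
  have bnd x (Ax : A x) := evol_dyadic_bound mF1 mF2 n_ge1 a_gt0 s_gt0 intw E_0 cover SAP Ax.
  have gn0 : (1 : R) != 0 by rewrite oner_neq0.
  apply: (@tempered_inversion _ _ f (fourier f) _ _ Hd (fun k => cube (dyscale a k)) A) => //.
  - by move=> k; apply: (integrable_cut1 mF1 s_gt0 intw (measurable_cube (dyscale a k))); exact: subset_refl.
  - by move=> k; apply: (integrable_cut2 mF2 s_gt0 intw (measurable_cube (dyscale a k))); exact: subset_refl.
  - move=> x Ax; have [cR _ _ _] := lim x Ax.
    rewrite (_ : (fun k => _) = (fun k => kap * evolRe F1 F2 a (cube (dyscale a k)) 0 x)).
      by apply: cvgM; [exact: cvg_cst|exact: cR].
    by apply/funext => k; rewrite -Re0.
  - move=> x Ax; have [_ cI _ _] := lim x Ax.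
    rewrite (_ : (fun k => _) = (fun k => kap * evolIm F1 F2 a (cube (dyscale a k)) 0 x)).
      by apply: cvgM; [exact: cvg_cst|exact: cI].
    by apply/funext => k; rewrite -Im0.
  - move=> x; rewrite mulr_ge0// addr_ge0//; last by rewrite divr_ge0// addr_ge0// fine_ge0.
    by apply: Rintegral_ge0 => xi _; rewrite addr_ge0.
  - move=> k x Ax; rewrite normrM (ger0_norm kap0) ler_wpM2l//.
    have [+ _] := bnd x Ax k; rewrite -Re0; exact.
  - move=> k x Ax; rewrite normrM (ger0_norm kap0) ler_wpM2l//.
    have [_ +] := bnd x Ax k; rewrite -Im0; exact.
  have ig := integrable_gaussn n gn0.
  rewrite (_ : (fun x => _) = (fun x => kap * (evol_bound F1 F2 (dyscale a 0) + SA / 2) * gaussn 1 x +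
      kap / 2 * (fine (Phi x) * gaussn 1 x))); last first.
    apply/funext => x; rewrite /Hd.
    have gen (p q r u v : R) : p * (q + (r + u) / 2) * v = p * (q + u / 2) * v + p / 2 * (r * v) by field.
    exact: gen.
  apply: integrable_addR => //; first exact: integrable_mull.
  apply: integrable_mull => //; apply: (@integrableMr_bounded _ _ _ _ _ _ _ 1) => //.
  - apply/integrableP; split.
      by apply/measurable_EFinP; apply: measurableT_comp.
    apply: le_lt_trans (integrable_lty measurableT iPhi).
    apply: ge0_le_integral => //.
    + by apply/measurable_EFinP; apply: measurableT_comp => //; apply: measurableT_comp.
    + by move=> x _; rewrite /= ger0_norm ?fine_ge0//; case: (Phi x) (Phi0 x) => //= r _; rewrite leey.
  - exact: measurable_gaussn.
  - by move=> x _; rewrite ger0_norm ?gaussn_ge0 ?gaussn_le1.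
move: aePhi aeZ inv; apply: filterS3 => x Phix Zx fx.
have [cRe cIm lRe0 lIm0] := evol_dyadic_limit mF1 mF2 n_ge1 a_gt0 s_gt0 intw E_0 cover SAP Phix.
(* The modified function is the limit along the dyadic scales: it has the limit [f x] along [E] at
   0, and it agrees with [schrodinger] wherever the full sequence converges to it. *)
exists (fun t => (kap * lRe t x) +i* (kap * lIm t x)); split; last first.
  rewrite fx; apply: cvg_complex; (apply: cvgM; first exact: cvg_cst); [exact: lRe0|exact: lIm0].
apply: (evol_exceptional_null mF1 mF2 n_ge1 a_gt0 s_gt0 kappa_gt0 intw E_0 cover SAP Phix Zx) => [t []//|t [_ nt] [cR cI]].
apply: nt; have cS : (fun N => schrodinger_partial a f N x t) @ \oo --> ((kap * lRe t x) +i* (kap * lIm t x) : R[i]^o).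
  under eq_fun do rewrite schrodinger_partialE.
  apply: cvg_complex; (apply: cvgM; first exact: cvg_cst); [exact: cR|exact: cI].
split; first by apply/cvg_ex; exists ((kap * lRe t x) +i* (kap * lIm t x)).
by apply/esym/cvg_lim.
Qed.
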